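(* Let $\Omega\subset\mathbb{R}^n$ be open and bounded with Lipschitz boundary $\partial\Omega$. Let $\Phi=\Phi(x,p):\Omega\times\mathbb{R}^n\to\mathbb{R}$ and $\Psi=\Psi(x,z):\Omega\times\mathbb{R}\to\mathbb{R}$ be of class $C^2$, with $\Phi$ convex in $p$ and $\Psi$ convex in $z$, and suppose there are constants $\theta,\mu>0$ such that for all $x\in\Omega$, $p\in\mathbb{R}^n$ and $z\in\mathbb{R}$ $$\theta I\le \nabla_p^2\Phi(x,p)\le \theta^{-1}I \qquad\text{and}\qquad \Psi_{zz}(x,z)\le \mu .$$ Let $$E[u]=\int_\Omega \Phi(x,\nabla u)+\Psi(x,u)\,dx,\qquad \nabla E[u]=\Psi_z(x,u)-\operatorname{div}\big(\nabla_p\Phi(x,\nabla u)\big).$$ Let $u^*=u^*(x)$ be the steady state solution of $\nabla E[u^*]=0$ in $\Omega$ with $u^*=g$ on $\partial\Omega$, let $a>0$ be a constant, and let $u=u(x,t)$ satisfy the damped nonlinear wave equation $$u_{tt}+a\,u_t=-\nabla E[u]\quad\text{in }\Omega\times(0,\infty),\qquad u(x,t)=u^*(x)=g(x)\ \text{ for } x\in\partial\Omega,\ t\ge 0 .$$ Let $\lambda>0$ be the Poincaré constant for $\Omega$. Then, for given $\Omega,\Phi,\Psi$ and $u^*$, there exists $C>0$ depending on $a$, $\theta$, $u(x,0)$ and $u_t(x,0)$ such that for all $t\ge 0$ $$\|u(\cdot,t)-u^*\|_{H^1(\Omega)}^2\le C\exp(-\beta t),$$ where $$\beta=\frac{a\sqrt{c^2+4\lambda\theta}-ac}{2\sqrt{\lambda\theta}+a},\qquad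 c=a+\frac{\mu}{a}+\frac{2\lambda}{a}\left(\theta^{-1}-\theta\right).$$
   Context: Subscripts $t$ and $z$ denote partial derivatives; $\nabla_p\Phi$ and $\nabla_p^2\Phi$ are the gradient and Hessian of $\Phi$ in the variable $p$; matrix inequalities are in the sense of symmetric matrices; $\nabla$ and $\operatorname{div}$ without subscript act in $x$. The Poincaré constant $\lambda$ for $\Omega$ is the (largest) constant in the inequality $\lambda\int_\Omega w^2\,dx\le\int_\Omega|\nabla w|^2\,dx$ for all $w\in H^1_0(\Omega)$. Convention: $u$ and $u^*$ are solutions regular enough (up to the boundary and up to $t=0$) that the equations hold in the classical sense, $E$ and the relevant integrals are finite, and differentiation under the integral sign and integration by parts over $\Omega$ are justified. *)

(* Defs.v *)
From HB Require Import structures.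
From mathcomp Require Import all_boot all_order all_algebra.
From mathcomp Require Import all_classical all_reals all_analysis.
Set Implicit Arguments.
Unset Strict Implicit.
Unset Printing Implicit Defensive.
Import Order.TTheory GRing.Theory Num.Theory.
Import numFieldNormedType.Exports.
Local Open Scope classical_set_scope.
Local Open Scope ring_scope.

(* R^n is 'rV[R]_n; its library norm is the sup norm,
   so Euclidean lengths are always written through [dotv] and [sqn]. *)

Definition rV_display : measure_display -> measure_display.
Proof. exact. Qed.

Section rV_measurable.
Context {R : realType} (n : nat).

(* The sigma-algebra generated by the n coordinate maps, i.e. the Borel sets. *)
Definition rV_measurable : set (set 'rV[R]_n) :=
  g_sigma_preimage (fun (i : 'I_n) (x : 'rV[R]_n) => x ord0 i).

Let rV_set0 : rV_measurable set0.
Proof. exact: sigma_algebra0. Qed.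

Let rV_setC A : rV_measurable A -> rV_measurable (~` A).
Proof. exact: sigma_algebraC. Qed.

Let rV_bigcup (F : (set 'rV[R]_n)^nat) :
  (forall i, rV_measurable (F i)) -> rV_measurable (\bigcup_i F i).
Proof. exact: sigma_algebra_bigcup. Qed.

HB.instance Definition _ := @isMeasurable.Build (rV_display default_measure_display)
  'rV[R]_n rV_measurable rV_set0 rV_setC rV_bigcup.

End rV_measurable.

Lemma measurable_coord (R : realType) n (i : 'I_n) :
  measurable_fun [set: 'rV[R]_n] (fun x => x ord0 i).
Proof.
move=> _ Y mY; rewrite setTI; apply: sub_sigma_algebra => /=.
rewrite -bigcup_seq/=; exists i => /=; first by rewrite mem_index_enum.
by exists Y => //; rewrite setTI.
Qed.

Lemma measurable_rV d (T : measurableType d) (R : realType) n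
    (f : T -> 'rV[R]_n) :
  (forall i, measurable_fun [set: T] (fun x => f x ord0 i)) ->
  measurable_fun [set: T] f.
Proof.
move=> mf; apply: (@measurability _ _ _ _ setT f
  (\big[setU/set0]_(i < n) preimage_set_system setT
     (fun x : 'rV[R]_n => x ord0 i) measurable)) => //.
move=> _ [B + <-]; rewrite -bigcup_seq/= => -[i _ [Y mY <-]].
by rewrite !setTI -[X in measurable X]setTI; exact: mf.
Qed.

Section lebesgue_rV.
Context {R : realType}.

Definition rVcons n (p : measurableTypeR R * 'rV[R]_n) : 'rV[R]_n.+1 :=
  \row_i (if unlift ord0 i is Some j then p.2 ord0 j else p.1).

Definition rVsplit n (v : 'rV[R]_n.+1) : measurableTypeR R * 'rV[R]_n :=
  (v ord0 ord0, \row_i v ord0 (lift ord0 i)).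

Lemma rVcons0 n (p : measurableTypeR R * 'rV[R]_n) : rVcons p ord0 ord0 = p.1.
Proof. by rewrite mxE unlift_none. Qed.

Lemma rVconsS n (p : measurableTypeR R * 'rV[R]_n) i : rVcons p ord0 (lift ord0 i) = p.2 ord0 i.
Proof. by rewrite mxE liftK. Qed.

Lemma rVconsK n : cancel (@rVcons n) (@rVsplit n).
Proof.
move=> [x v]; rewrite /rVsplit rVcons0; congr pair.
by apply/rowP => i; rewrite mxE rVconsS.
Qed.

Lemma rVsplitK n : cancel (@rVsplit n) (@rVcons n).
Proof.
move=> v; apply/rowP => i; have [j ->|->] := unliftP ord0 i.
  by rewrite rVconsS mxE.
by rewrite rVcons0.
Qed.

Lemma measurable_rVcons n : measurable_fun setT (@rVcons n).
Proof.
apply: measurable_rV => i; have [j ->|->] := unliftP ord0 i.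
  under eq_fun do rewrite rVconsS.
  exact: (measurableT_comp (measurable_coord j) measurable_snd).
under eq_fun do rewrite rVcons0.
exact: measurable_fst.
Qed.

Lemma measurable_rVsplit n : measurable_fun setT (@rVsplit n).
Proof.
apply/measurable_fun_pairP; split; first exact: measurable_coord.
apply: measurable_rV => i; rewrite /comp /=.
under eq_fun do rewrite mxE.
exact: measurable_coord.
Qed.

Section rVprod.
Variables (n : nat) (mu : {sigma_finite_measure set 'rV[R]_n -> \bar R}).

Definition rVprod : set 'rV[R]_n.+1 -> \bar R :=
  pushforward ((@lebesgue_measure R) \x mu)%E (@rVcons n).


Let mcons A : measurable A -> measurable (@rVcons n @^-1` A).
Proof. by move=> mA; rewrite -[X in measurable X]setTI; exact: measurable_rVcons. Qed.

Let rVprod0 : rVprod set0 = 0%E.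
Proof. by rewrite /rVprod /pushforward preimage_set0 measure0. Qed.

Let rVprod_ge0 A : (0 <= rVprod A)%E.
Proof. by rewrite /rVprod /pushforward; exact: measure_ge0. Qed.

Let rVprod_sigma_additive : semi_sigma_additive rVprod.
Proof.
move=> F mF tF mUF; rewrite /rVprod /pushforward preimage_bigcup.
apply: measure_semi_sigma_additive.
- by move=> i; exact: mcons.
- apply/trivIsetP => /= i j _ _ ij; rewrite -preimage_setI.
  by move/trivIsetP : tF => /(_ _ _ _ _ ij) ->//; rewrite preimage_set0.
- by rewrite -preimage_bigcup; exact: mcons.
Qed.

HB.instance Definition _ := isMeasure.Build _ _ _ rVprod
  rVprod0 rVprod_ge0 rVprod_sigma_additive.

Let rVprod_sigma_finite : sigma_finite setT rVprod.
Proof.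
have /sigma_finiteP[F [FT ndF Foo]] := sigma_finiteT (@lebesgue_measure R).
have /sigma_finiteP[G [GT ndG Goo]] := sigma_finiteT mu.
exists (fun k => @rVsplit n @^-1` (F k `*` G k)) => [|k].
  rewrite -preimage_bigcup (_ : \bigcup_i _ = setT) ?preimage_setT//.
  apply/seteqP; split => // -[x v] _.
  have [i _ Fix] : (\bigcup_i F i) x by rewrite -FT.
  have [j _ Gjv] : (\bigcup_i G i) v by rewrite -GT.
  exists (maxn i j) => //=; split.
    by move: x Fix; apply/subsetPset/ndF; exact: leq_maxl.
  by move: v Gjv; apply/subsetPset/ndG; exact: leq_maxr.
have [mF Fk] := Foo k; have [mG Gk] := Goo k; split.
  rewrite -[X in measurable X]setTI.
  by apply: measurable_rVsplit => //; exact: measurableX.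
rewrite /rVprod /pushforward -comp_preimage (_ : _ \o _ = id).
  by rewrite preimage_id product_measure1E// lte_mul_pinfty// ge0_fin_numE.
by apply/funext => p /=; rewrite rVconsK.
Qed.

HB.instance Definition _ := Measure_isSigmaFinite.Build _ _ _ rVprod
  rVprod_sigma_finite.

End rVprod.

Fixpoint lebesgue_rV n : {sigma_finite_measure set 'rV[R]_n -> \bar R} :=
  if n is m.+1 then rVprod (lebesgue_rV m) else \d_(0 : 'rV[R]_0).

Lemma lebesgue_rV_box n (a b : 'rV[R]_n) : (forall i, a ord0 i <= b ord0 i) ->
  lebesgue_rV n [set x : 'rV[R]_n | forall i, a ord0 i <= x ord0 i <= b ord0 i] =
  (\prod_(i < n) (b ord0 i - a ord0 i))%:E.
Proof.
elim: n a b => [|n IH] a b ab.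
  rewrite big_ord0 /= diracE mem_set//= => -[]//.
rewrite /= /rVprod /pushforward.
pose a' := (rVsplit a).2; pose b' := (rVsplit b).2.
have -> : @rVcons n @^-1` [set x : 'rV[R]_n.+1 | forall i, a ord0 i <= x ord0 i <= b ord0 i] =
    `[a ord0 ord0, b ord0 ord0]%classic `*`
    [set x : 'rV[R]_n | forall i, a' ord0 i <= x ord0 i <= b' ord0 i].
  apply/seteqP; split => -[x v] /=.
    move=> h; split; first by have := h ord0; rewrite rVcons0 in_itv.
    by move=> i; have := h (lift ord0 i); rewrite rVconsS !mxE.
  move=> [h1 h2] i; have [j ->|->] := unliftP ord0 i.
    by have := h2 j; rewrite rVconsS !mxE.
  by move: h1; rewrite rVcons0 in_itv.
rewrite product_measure1E//; last first.
  rewrite (_ : mkset _ = \bigcap_(i in [set: 'I_n])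
     ((fun x : 'rV[R]_n => x ord0 i) @^-1` `[a' ord0 i, b' ord0 i]%classic)).
    apply: fin_bigcap_measurable => // i _; rewrite -[X in measurable X]setTI.
    exact: measurable_coord.
  apply/seteqP; split => x /= h i; first by move=> _; rewrite /= in_itv; exact: h.
  by have := h i I; rewrite /= in_itv.
have ab' i : a' ord0 i <= b' ord0 i by rewrite !mxE.
rewrite IH//.
have := lebesgue_measure_itv `[a ord0 ord0, b ord0 ord0]%R => /= ->.
rewrite lte_fin big_ord_recl.
rewrite (eq_bigr (fun i => b ord0 (lift ord0 i) - a ord0 (lift ord0 i))); last first.
  by move=> i _; rewrite !mxE.
have [_|le] := ltP; first by rewrite EFinM EFinB.
have -> : a ord0 ord0 = b ord0 ord0 by apply/eqP; rewrite eq_le ab le.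
by rewrite subrr mul0r mul0e.
Qed.

End lebesgue_rV.

Section calculus.
Context {R : realType} {n : nat}.
Implicit Types (x p q : 'rV[R]_n) (f : 'rV[R]_n -> R).

Definition dotv p q : R := \sum_i p ord0 i * q ord0 i.

Definition sqn p : R := dotv p p.

Definition pd i f x : R := 'D_(delta_mx ord0 i) f x.

Definition grad f x : 'rV[R]_n := \row_i pd i f x.

Definition hess f x : 'M[R]_n := \matrix_(i, j) pd i (pd j f) x.

Definition div (F : 'rV[R]_n -> 'rV[R]_n) x : R :=
  \sum_i pd i (fun y => F y ord0 i) x.

Definition psd_le (A B : 'M[R]_n) : Prop :=
  forall v : 'rV[R]_n, 0 <= (v *m (B - A) *m v^T) ord0 ord0.

End calculus.

Section smoothness.
Context {R : realType} {V : normedModType R}.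
Implicit Types (U : set V) (f : V -> R).

(* Class C^k on an open subset U of a finite-dimensional space V; in finite
   dimension, continuity of v |-> 'd f x v for each v is continuity of 'd f. *)
Fixpoint Ck (k : nat) U f : Prop :=
  if k is j.+1 then
    (forall x, U x -> differentiable f x) /\ (forall v, Ck j U ('D_v f))
  else forall x, U x -> {for x, continuous f}.

(* Class C^1 up to the boundary: f is continuous on closure U, and the
   derivatives of f on U extend continuously to closure U. *)
Definition C1_closure U f : Prop :=
  [/\ {within closure U, continuous f},
      forall x, U x -> differentiable f x &
      forall v, exists F : V -> R,
        {within closure U, continuous F} /\ (forall x, U x -> F x = 'D_v f x)].

End smoothness.

Section domains.
Context {R : realType} {n : nat}.
Implicit Types (Om : set 'rV[R]_n) (w f : 'rV[R]_n -> R)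
  (G : 'rV[R]_n -> 'rV[R]_n).
Local Notation leb := (lebesgue_rV n).

Definition bdry Om : set 'rV[R]_n := closure Om `\` interior Om.

(* Near each boundary point, Om is the strict epigraph, in the direction of a
   unit vector e, of a Lipschitz function of the component orthogonal to e. *)
Definition lipschitz_boundary Om : Prop :=
  forall x0, bdry Om x0 ->
  exists (e : 'rV[R]_n) (gamma : 'rV[R]_n -> R) (L : R),
    [/\ sqn e = 1,
        forall y z, `|gamma y - gamma z| <= L * `|y - z| &
        \forall x \near x0, Om x <-> gamma (x - dotv x e *: e) < dotv x e].

Definition L2 Om f : Prop :=
  measurable_fun Om f /\ leb.-integrable Om (fun x => (f x ^+ 2)%:E).

Definition C1c Om f : Prop :=
  Ck 1 setT f /\
  exists K, [/\ compact K, K `<=` Om & forall x, ~ K x -> f x = 0].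

(* w is in H^1(Om), with weak gradient G. *)
Definition H1 Om w G : Prop :=
  [/\ L2 Om w,
      forall i, L2 Om (fun x => G x ord0 i) &
      forall (phi : 'rV[R]_n -> R) i, C1c Om phi ->
        \int[leb]_(x in Om) (w x * pd i phi x) =
        - \int[leb]_(x in Om) (G x ord0 i * phi x)].

(* H^1_0(Om) is the closure in H^1(Om) of the C^1 functions with compact support
   in Om; by mollification this is also the closure of the smooth ones. *)
Definition H10 Om w G : Prop :=
  H1 Om w G /\
  exists phi : nat -> 'rV[R]_n -> R,
    (forall k, C1c Om (phi k)) /\
    (\int[leb]_(x in Om)
       ((phi k x - w x) ^+ 2 + sqn (grad (phi k) x - G x))%:E)%E
      @[k --> \oo] --> 0%E.

Definition poincare_ineq Om (l : R) : Prop :=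
  forall w G, H10 Om w G ->
  (l%:E * \int[leb]_(x in Om) (w x ^+ 2)%:E <=
   \int[leb]_(x in Om) (sqn (G x))%:E)%E.

Definition poincare_constant Om (l : R) : Prop :=
  poincare_ineq Om l /\ (forall l', poincare_ineq Om l' -> l' <= l).

(* The squared H^1(Om) norm of a classically differentiable function; it is
   extended-real valued so that a divergent integral is not read as 0. *)
Definition H1_normsq Om w : \bar R :=
  (\int[leb]_(x in Om) (w x ^+ 2 + sqn (grad w x))%:E)%E.

(* Locally in time, f(., t) is dominated on Om by an integrable function. *)
Definition loc_dominated Om (f : 'rV[R]_n -> R -> R) : Prop :=
  forall T : R, exists h : 'rV[R]_n -> R,
    leb.-integrable Om (EFin \o h) /\
    (forall x t, Om x -> 0 < t < T -> `|f x t| <= h x).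

End domains.

Section wave.
Context {R : realType} {n : nat}.
Variables (Om : set 'rV[R]_n) (Phi : 'rV[R]_n -> 'rV[R]_n -> R)
  (Psi : 'rV[R]_n -> R -> R).

(* The L^2 gradient of E[u] = int_Om Phi(x, grad u) + Psi(x, u) dx. *)
Definition gradE (u : 'rV[R]_n -> R) (x : 'rV[R]_n) : R :=
  derive1 (Psi x) (u x) - div (fun y => grad (Phi y) (grad u y)) x.

Definition finite_energy (u : 'rV[R]_n -> R) : Prop :=
  (lebesgue_rV n).-integrable Om (fun x => (Phi x (grad u x))%:E) /\
  (lebesgue_rV n).-integrable Om (fun x => (Psi x (u x))%:E).

Definition steady_state (g ustar : 'rV[R]_n -> R) : Prop :=
  [/\ Ck 2 Om ustar, C1_closure Om ustar, finite_energy ustar,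
      forall x, Om x -> gradE ustar x = 0 &
      forall x, bdry Om x -> ustar x = g x].

(* What is required for the energy identities: the two terms of the time
   derivative of the integrand of E[u(., t)], and u_tt (in the time derivatives
   of u_t ^+ 2 and of (u - ustar) * u_t), are dominated locally in time. *)
Definition wave_regular (u : 'rV[R]_n -> R -> R) : Prop :=
  let U := fun q : 'rV[R]_n * R => u q.1 q.2 in
  let Q := Om `*` [set t : R | 0 < t] in
  [/\ Ck 2 Q U, C1_closure Q U,
      forall t, 0 <= t -> finite_energy (u ^~ t),
      loc_dominated Om (fun x t => derive1n 2 (u x) t) &
      loc_dominated Om (fun x t => dotv (grad (Phi x) (grad (u ^~ t) x))
                                     (grad (fun y => derive1 (u y) t) x)) /\
      loc_dominated Om (fun x t => derive1 (Psi x) (u x t) * derive1 (u x) t)].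

Definition damped_wave (a : R) (g : 'rV[R]_n -> R) (u : 'rV[R]_n -> R -> R) :
    Prop :=
  (forall x t, Om x -> 0 < t ->
     derive1n 2 (u x) t + a * derive1 (u x) t = - gradE (u ^~ t) x) /\
  (forall x t, bdry Om x -> 0 <= t -> u x t = g x).

(* u(x, 0) = u0 x and u_t(x, 0) = u1 x, the latter as a right derivative. *)
Definition initial_data (u0 u1 : 'rV[R]_n -> R) (u : 'rV[R]_n -> R -> R) :
    Prop :=
  forall x, Om x ->
    u x 0 = u0 x /\ h^-1 * (u x h - u x 0) @[h --> 0^'+] --> u1 x.

End wave.

(* Main.v *)
Require Import Defs.
From mathcomp Require Import all_boot all_order all_algebra.
From mathcomp Require Import all_classical all_reals all_analysis.
From mathcomp Require Import measurable_realfun ring lra.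
Set Implicit Arguments.
Unset Strict Implicit.
Unset Printing Implicit Defensive.
Import Order.TTheory GRing.Theory Num.Theory.
Import numFieldNormedType.Exports.
Local Open Scope classical_set_scope.
Local Open Scope ring_scope.

(* Put w = u - ustar and take as Lyapunov functional
     J = int u_t^2 / 2 + D_Phi + D_Psi + (a / 2) w u_t + (a^2 / 4) w^2,
   where D_Phi and D_Psi are the Bregman distances of Phi(x, .) and Psi(x, .)
   between (grad u, u) and (grad ustar, ustar).  Bounding these by the Hessian
   bounds, a pointwise computation with a quadratic form in (u_t, w) gives
     J' + beta J <= - A int (|grad w|^2 - lambda w^2) <= 0   for some A >= 0,
   the last step being the Poincare inequality.  Since J dominates
   (theta / 2) int |grad w|^2 and its coefficients do not involve mu, the constant
   does not depend on mu either.

   The steady equation shows that J differs by a constant from the functional with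
   Phi + Psi in place of D_Phi + D_Psi. The latter can be differentiated in t, but
   only the former, which is bounded in terms of grad w, passes to the limit t -> 0.

   Integration by parts and the Poincare inequality for a C^1 function v vanishing
   at the boundary follow from the compactly supported case applied to a C^1
   truncation eta_k(v) that is 0 for small |v|; the set where v = 0 and grad v <> 0,
   on which d eta_k(v) does not converge to dv, is Lebesgue-null because on every
   line it is a countable set of isolated points. *)

(** * Lebesgue measure on row vectors *)

(** The weights in J are forced. With u_tt = - a u_t - grad E and the cross term (a / 2) w u_t, the
    terms in w u_t cancel in J' exactly when w^2 has weight a^2 / 4, and J' = - (a / 2) int (u_t^2 +
    M) remains, with M the sum of the symmetrized Bregman distances. The quadratic part of J is (u_t
    + a w / 2)^2 / 2 + a^2 w^2 / 8, hence the lower bound on J. In J' + beta J the Bregman distances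
    carry the coefficient beta - a / 2. If it is nonpositive they are bounded from below (theta and
    convexity), otherwise from above (theta^-1 and mu); the single formula for beta has to serve
    both regimes. The obstacle is regularity: second space derivatives of u are not controlled near
    the boundary or as t -> 0. Therefore every divergence under an integral is replaced by what the
    equation gives for it, and t = 0 is reached only as a limit along t = 1 / (k + 1). *)

Lemma measurable_box (R : realType) n (P : 'I_n -> set R) :
  (forall i, measurable (P i)) ->
  measurable [set x : 'rV[R]_n | forall i, P i (x ord0 i)].
Proof.
move=> mP; rewrite (_ : mkset _ = \bigcap_(i in [set: 'I_n])
   ((fun x : 'rV[R]_n => x ord0 i) @^-1` P i)).
  apply: fin_bigcap_measurable => // i _; rewrite -[X in measurable X]setTI.
  exact: measurable_coord.
by apply/seteqP; split => x /= h i => [_|]; [exact: h | exact: h i I].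
Qed.

(** The sigma-algebra is generated by the coordinates, so U is written as a countable union of cubes
    with rational centre and half-side 1 / (k + 1). *)
Lemma open_measurable_rV (R : realType) n (U : set 'rV[R]_n) : open U -> measurable U.
Proof.
move=> oU.
pose B (q : 'rV[rat]_n) (k : nat) : set 'rV[R]_n :=
  [set y | forall i, `](ratr (q ord0 i) - k.+1%:R^-1), (ratr (q ord0 i) + k.+1%:R^-1)[%classic (y ord0 i)].
have mB q k : measurable (B q k).
  by apply: (@measurable_box R n (fun i => `](ratr (q ord0 i) - k.+1%:R^-1), (ratr (q ord0 i) + k.+1%:R^-1)[%classic)) => i; exact: measurable_itv.
pose F m : set 'rV[R]_n := match unpickle m with
  | Some (q, k) => if `[< B q k `<=` U >] then B q k else set0 | None => set0 end.
rewrite (_ : U = \bigcup_m F m).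
  apply: bigcupT_measurable => m; rewrite /F; case: (unpickle m) => [[q k]|//].
  by case: ifP.
apply/seteqP; split => [x Ux|x [m _]]; last first.
  rewrite /F; case: (unpickle m) => [[q k]|//].
  by case: asboolP => // + Bx; exact.
have /nbhs_ballP[e /= e0 xeU] : nbhs x U by exact: open_nbhs_nbhs.
(* Half of e, because the cube is not centred at x but at a rational point within 1 / (k + 1) of
   it. *)
have [k ke] : exists k : nat, k.+1%:R^-1 < e / 2.
  have e20 : 0 < e / 2 by rewrite divr_gt0.
  by have [k _ h] := near_infty_natSinv_lt (PosNum e20); exists k; apply: h => /=.
have qi i : exists q : rat, ratr q \in `](x ord0 i - k.+1%:R^-1), (x ord0 i + k.+1%:R^-1)[.
  have : (x ord0 i - k.+1%:R^-1) < (x ord0 i + k.+1%:R^-1).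
    by rewrite ltrD2l gtrN// invr_gt0.
  by move=> /rat_in_itvoo[q ?]; exists q.
have [q hq] := choice qi.
exists (pickle (\row_i q i, k)) => //; rewrite /F pickleK.
have BU : B (\row_i q i) k `<=` U.
  move=> y By; apply: xeU; split => // a i; have -> : a = ord0 by exact: ord1.
  have := By i; rewrite /= in_itv/= mxE => /andP[h1 h2].
  have := hq i; rewrite in_itv/= => /andP[h3 h4].
  rewrite /ball/= ltr_norml; move: ke h1 h2 h3 h4.
  by move: (ratr _) (k.+1%:R^-1) => p d *; apply/andP; split; lra.
rewrite asboolT// => i /=; rewrite in_itv/= mxE.
have := hq i; rewrite in_itv/= => /andP[].
by move: (ratr _) (k.+1%:R^-1) => p d *; apply/andP; split; lra.
Qed.

Lemma continuous_measurable_rV (R : realType) n (U : set 'rV[R]_n) (f : 'rV[R]_n -> R) :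
  open U -> (forall x, U x -> {for x, continuous f}) -> measurable_fun U f.
Proof.
move=> oU cf; apply: (measurability _ (RGenOpens.measurableE R)).
move=> _ [_ [a [b ->] <-]]; apply: open_measurable_rV.
rewrite openE => x [Ux abfx]; apply: filterI; first exact: open_nbhs_nbhs.
by apply: (cf x Ux); apply: open_nbhs_nbhs; split => //; exact: interval_open.
Qed.

Lemma rVcons_addl (R : realType) n (s : R) (v : 'rV[R]_n) :
  rVcons (s, v) = rVcons (0, v) + s *: delta_mx ord0 ord0.
Proof.
apply/rowP => i; rewrite !mxE /=.
have [j ->|->] := unliftP ord0 i; first by rewrite eq_sym (negPf (neq_lift _ _)) /= mulr0 addr0.
by rewrite add0r mulr1.
Qed.

Lemma rVcons_addr (R : realType) n (s r : R) (v : 'rV[R]_n) j :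
  rVcons (s, v + r *: delta_mx ord0 j) = rVcons (s, v) + r *: delta_mx ord0 (lift ord0 j).
Proof.
apply/rowP => i; rewrite !mxE /=.
have [k ->|->] := unliftP ord0 i; last by rewrite (negPf (neq_lift _ _)) /= mulr0 addr0.
by rewrite !mxE (inj_eq lift_inj).
Qed.

Lemma measurable_rVcons_r (R : realType) n (s : R) :
  measurable_fun setT (fun v : 'rV[R]_n => rVcons (s, v)).
Proof.
apply: (measurableT_comp (@measurable_rVcons R n)).
by apply/measurable_fun_pairP; split => /=; [exact: measurable_cst|exact: measurable_id].
Qed.

(** Tonelli, by induction on n. The measure splits off coordinate 0: for i > 0 the induction
    hypothesis applies at fixed first coordinate; for i = 0 the order of integration is reversed,
    which is legitimate by uniqueness of the product measure. *)
Lemma lebesgue_rV_slice0 (R : realType) n (i : 'I_n) (A : set 'rV[R]_n) :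
  measurable A ->
  (forall x, (@lebesgue_measure R) [set s : R | A (x + s *: delta_mx ord0 i)] = 0%E) ->
  lebesgue_rV n A = 0%E.
Proof.
elim: n => [|n IH] in i A *; first by case: i.
move=> mA A0.
have mcA : measurable (@rVcons R n @^-1` A).
  by rewrite -[X in measurable X]setTI; exact: measurable_rVcons.
rewrite /= /rVprod /pushforward.
have [j ij|i0] := unliftP ord0 i.
  rewrite /product_measure1 integral0_eq// => s _ /=.
  apply: (IH j).
    rewrite (_ : xsection _ _ = (fun v : 'rV[R]_n => rVcons (s, v)) @^-1` A).
      by rewrite -[X in measurable X]setTI; exact: measurable_rVcons_r.
    by apply/seteqP; split => v; rewrite /xsection /= inE.
  move=> v; rewrite -[RHS](A0 (rVcons (s, v))); congr (lebesgue_measure _).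
  by apply/seteqP; split => r; rewrite /xsection /= inE /= rVcons_addr ij.
rewrite (_ : _ (_ @^-1` A) = ((@lebesgue_measure R) \x^ lebesgue_rV n)%E (@rVcons R n @^-1` A)).
  rewrite /product_measure2 integral0_eq// => v _ /=.
  rewrite -[RHS](A0 (rVcons (0, v))); congr (lebesgue_measure _).
  by apply/seteqP; split => r; rewrite /ysection /= inE /= (rVcons_addl r v) i0.
by apply: product_measure_unique => // B C mB mC; exact: product_measure2E.
Qed.

Lemma integrable_bounded_support (R : realType) n (g : 'rV[R]_n -> R) (N M : R) :
  measurable_fun setT g -> (forall x, `|g x| <= M) ->
  (forall (x : 'rV[R]_n) j, N < `|x ord0 j| -> g x = 0) ->
  (lebesgue_rV n).-integrable setT (EFin \o g).
Proof.
move=> mg gM g0.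
(* The maximum with 0 keeps the endpoints of the box ordered when N is negative. *)
pose N' := Num.max N 0.
pose B := [set x : 'rV[R]_n | forall i, (const_mx (- N') : 'rV[R]_n) ord0 i <= x ord0 i <= (const_mx N' : 'rV[R]_n) ord0 i].
have mB : measurable B.
  rewrite (_ : B = [set x : 'rV[R]_n | forall i, `[- N', N']%classic (x ord0 i)]).
    by apply: (@measurable_box R n (fun=> `[- N', N']%classic)) => i; exact: measurable_itv.
  by apply/seteqP; split => x /= h i; have := h i; rewrite !mxE in_itv.
have Boo : (lebesgue_rV n B < +oo)%E.
  rewrite lebesgue_rV_box ?ltry// => i; rewrite !mxE.
  by rewrite (le_trans _ (_ : 0 <= _)) ?oppr_le0// /N' le_max lexx orbT.
have -> : EFin \o g = (EFin \o g) \_ B.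
  apply/funext => x; rewrite patchE; case: ifPn => //= xB; congr EFin.
  apply: contra_notP (fun h => negP xB (mem_set h)) => /eqP gx i; rewrite !mxE -ler_norml.
  rewrite leNgt; apply/negP => xi; move/eqP: gx; apply; apply: (g0 _ i).
  by apply: le_lt_trans xi; rewrite /N' le_max lexx.
apply/(integrable_mkcond _ mB).1.
apply: measurable_bounded_integrable => //; first exact: measurable_funTS.
by exists M; split; [exact: num_real | move=> x Mx y _; exact: le_trans (gM y) (ltW Mx)].
Qed.

(** Signed counterpart of [lebesgue_rV_slice0]; boundedness and bounded support give the
    integrability that Fubini requires. *)
Lemma integral_slice0 (R : realType) n (i : 'I_n) (g : 'rV[R]_n -> R) (N M : R) :
  measurable_fun setT g -> (forall x, `|g x| <= M) ->
  (forall (x : 'rV[R]_n) j, N < `|x ord0 j| -> g x = 0) ->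
  (forall x, \int[@lebesgue_measure R]_s (g (x + s *: delta_mx ord0 i))%:E = 0)%E ->
  (\int[lebesgue_rV n]_x (g x)%:E = 0)%E.
Proof.
elim: n => [|n IH] in i g *; first by case: i.
move=> mg gM gN g0.
have mgc : measurable_fun setT (g \o @rVcons R n).
  by apply: measurableT_comp => //; exact: measurable_rVcons.
have ig := integrable_bounded_support mg gM gN.
have igc : ((@lebesgue_measure R) \x lebesgue_rV n)%E.-integrable setT (EFin \o (g \o @rVcons R n)).
  apply/integrableP; split; first exact/measurable_EFinP.
  move/integrableP: ig => [_].
  rewrite /= (ge0_integral_pushforward (@measurable_rVcons R n))//.
  by apply/measurable_EFinP; exact: measurableT_comp.
rewrite /= (integral_pushforward (@measurable_rVcons R n))//; last exact/measurable_EFinP.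
rewrite preimage_setT.
have [j ij|i0] := unliftP ord0 i.
  rewrite -(integral12_prod_meas1 igc) /fubini_F /= integral0_eq// => s _.
  apply: (IH j (fun v => g (rVcons (s, v)))).
  - by apply: measurableT_comp => //; exact: measurable_rVcons_r.
  - by move=> v; exact: gM.
  - by move=> v k kN; apply: (gN _ (lift ord0 k)); rewrite rVconsS.
  - move=> v; rewrite -[RHS](g0 (rVcons (s, v))); apply: eq_integral => r _.
    by rewrite rVcons_addr ij.
rewrite -(integral21_prod_meas1 igc) /fubini_G /= integral0_eq// => v _.
rewrite -[RHS](g0 (rVcons (0, v))); apply: eq_integral => r _.
by rewrite (rVcons_addl r v) i0.
Qed.

(** * Functions of class C^1 *)

(** The two difference quotients are the same function of h. This is the tool for restricting to
    lines and to slices of space-time. *)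
Lemma derive_affine (R : realType) (V V' W : normedModType R) (f : V -> W) (phi : V' -> V) (a w : V') (v : V) :
  (forall h : R, phi (h *: w + a) = h *: v + phi a) ->
  'D_w (fun z => f (phi z)) a = 'D_v f (phi a) /\
  (derivable (fun z => f (phi z)) a w <-> derivable f (phi a) v).
Proof.
move=> phiE; rewrite /derive /derivable.
rewrite (_ : (fun h => h^-1 *: (((fun z => f (phi z)) \o shift a) (h *: w) - f (phi a))) =
   (fun h => h^-1 *: ((f \o shift (phi a)) (h *: v) - f (phi a)))) //.
by apply/funext => h /=; rewrite phiE.
Qed.

Lemma is_derive_line (R : realType) (V W : normedModType R) (f : V -> W) (x v : V) (s : R) :
  derivable f (x + s *: v) v ->
  is_derive s 1 (fun r : R => f (x + r *: v)) ('D_v f (x + s *: v)).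
Proof.
move=> df; have [|dE dP] := @derive_affine R V R^o W f (fun r : R => x + r *: v) s 1 v.
  by move=> h; rewrite scalerDl addrCA -scalerA scale1r.
by split; [apply/dP|rewrite -dE].
Qed.

Lemma near_eq_differentiable (R : realType) (V W : normedModType R) (f g : V -> W) (x : V) :
  (\forall y \near x, f y = g y) -> differentiable f x -> differentiable g x.
Proof.
move=> fg df; have -> : g = f + (g - f) by rewrite addrC subrK.
apply: differentiableD => //.
have fgx : f x = g x by exact: nbhs_singleton fg.
have oE : (g - f) \o shift x = cst ((g - f) x) + (\0 : V -> W) +o_ 0 id.
  apply: eqaddoE; apply/eqaddoP => _/posnumP[e].
  have : \forall y \near (0 : V), f (y + x) = g (y + x).
    have : (y + x) @[y --> (0 : V)] --> x.
      by rewrite -[X in _ --> X]add0r; apply: cvgD; [exact: cvg_id|exact: cvg_cst].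
    by move=> /(_ _ fg).
  move=> fg0; near=> y.
  rewrite !fctE /= fgx subrr addr0 subr0.
  have -> : f (y + x) = g (y + x) by near: y.
  by rewrite subrr normr0 mulr_ge0.
apply/diff_locallyP; rewrite (diff_unique _ oE); last exact: cst_continuous.
by split => //; exact: cst_continuous.
Unshelve. all: by end_near. Qed.

Lemma Ck1_near (R : realType) (V : normedModType R) (U : set V) (f g : V -> R) :
  open U -> (forall x, U x -> f x = g x) -> Ck 1 U f -> Ck 1 U g.
Proof.
move=> oU fg [df cf].
have near_fg x : U x -> \forall y \near x, f y = g y.
  by move=> Ux; apply: filterS fg _; exact: open_nbhs_nbhs.
split=> [x Ux|v x Ux]; first exact: near_eq_differentiable (near_fg x Ux) (df x Ux).
have : \forall y \near x, 'D_v f y = 'D_v g y.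
  have : \forall y \near x, U y by exact: open_nbhs_nbhs.
  by apply: filterS => y Uy; apply: near_eq_derive; exact: near_fg.
move=> Dfg; rewrite /prop_for /continuous_at -(nbhs_singleton Dfg).
by apply: cvg_trans (cf v x Ux); exact: near_eq_cvg.
Qed.

Lemma Ck1_continuous (R : realType) (V : normedModType R) (U : set V) (f : V -> R) :
  Ck 1 U f -> forall x, U x -> {for x, continuous f}.
Proof. by move=> [df _] x Ux; apply: differentiable_continuous; exact: df. Qed.

Lemma Ck1_derivable (R : realType) (V : normedModType R) (U : set V) (f : V -> R) :
  Ck 1 U f -> forall x v, U x -> derivable f x v.
Proof. by move=> [df _] x v Ux; apply: diff_derivable; exact: df. Qed.

Arguments Ck1_derivable {R V U f} _ x v _.

Lemma Ck1_M (R : realType) (V : normedModType R) (U : set V) (f g : V -> R) :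
  open U -> Ck 1 U f -> Ck 1 U g -> Ck 1 U (fun x => f x * g x).
Proof.
move=> oU cf cg; have [df cdf] := cf; have [dg cdg] := cg.
split=> [x Ux|v x Ux]; first by apply: differentiableM; [exact: df|exact: dg].
have DE : \forall y \near x, f y * 'D_v g y + g y * 'D_v f y = 'D_v (fun x => f x * g x) y.
  have : \forall y \near x, U y by exact: open_nbhs_nbhs.
  apply: filterS => y Uy; have := @deriveM _ _ f g y v => ->//.
    exact: Ck1_derivable cf y v Uy.
  exact: Ck1_derivable cg y v Uy.
rewrite /prop_for /continuous_at -(nbhs_singleton DE).
apply: (@cvg_trans _ (((fun y => f y * 'D_v g y + g y * 'D_v f y) y) @[y --> x])).
  exact: near_eq_cvg.
apply: cvgD; apply: cvgM; [exact: Ck1_continuous cf _ Ux|exact: cdg|exact: Ck1_continuous cg _ Ux|exact: cdf].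
Qed.

(** Since f is only derivable in the direction v, the one-variable chain rule is applied on the line
    through x in that direction. *)
Lemma derive_comp1 (R : realType) (V : normedModType R) (f : V -> R) (h : R -> R) (x v : V) :
  derivable f x v -> derivable h (f x) 1 ->
  is_derive x v (fun y => h (f y)) (derive1 h (f x) * 'D_v f x).
Proof.
move=> df dh.
have [dE dP] : 'D_1 (fun s : R => f (x + s *: v)) 0 = 'D_v f (x + 0 *: v) /\
  (derivable (fun s : R => f (x + s *: v)) 0 1 <-> derivable f (x + 0 *: v) v).
  apply: (@derive_affine R V R^o R f (fun r : R => x + r *: v)).
  by move=> r; rewrite scalerDl addrCA -scalerA scale1r.
rewrite scale0r addr0 in dE dP.
have [dE' dP'] : 'D_1 (fun s : R => h (f (x + s *: v))) 0 = 'D_v (fun y => h (f y)) (x + 0 *: v) /\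
  (derivable (fun s : R => h (f (x + s *: v))) 0 1 <-> derivable (fun y => h (f y)) (x + 0 *: v) v).
  apply: (@derive_affine R V R^o R (fun y => h (f y)) (fun r : R => x + r *: v)).
  by move=> r; rewrite scalerDl addrCA -scalerA scale1r.
rewrite scale0r addr0 in dE' dP'.
have dfl : is_derive (0 : R) 1 (fun s : R => f (x + s *: v)) ('D_v f x).
  by split; [apply/dP|].
have dhl : is_derive (f (x + 0 *: v)) 1 h (derive1 h (f x)).
  by rewrite scale0r addr0; split; rewrite ?derive1E.
have := @is_derive1_comp _ h (fun s : R => f (x + s *: v)) 0 _ _ dhl dfl.
by move=> [/dP' d1 d2]; split => //; rewrite -dE' -d2.
Qed.

Lemma Ck1_comp (R : realType) (V : normedModType R) (U : set V) (f : V -> R) (h : R -> R) :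
  open U -> (forall s, derivable h s 1) -> continuous (derive1 h) ->
  Ck 1 U f -> Ck 1 U (fun x => h (f x)).
Proof.
move=> oU dh ch cf; have [df cdf] := cf.
split=> [x Ux|v x Ux].
  by apply: (@differentiable_comp _ _ _ _ f h); [exact: df|apply/derivable1_diffP/dh].
have DE : \forall y \near x, derive1 h (f y) * 'D_v f y = 'D_v (fun x => h (f x)) y.
  have : \forall y \near x, U y by exact: open_nbhs_nbhs.
  apply: filterS => y Uy; have [_ ->//] := derive_comp1 (Ck1_derivable cf y v Uy) (dh (f y)).
rewrite /prop_for /continuous_at -(nbhs_singleton DE).
apply: (@cvg_trans _ (((fun y => derive1 h (f y) * 'D_v f y) y) @[y --> x])).
  exact: near_eq_cvg.
apply: cvgM; last exact: cdf.
apply: (@continuous_comp _ _ _ f (derive1 h)); [exact: Ck1_continuous cf _ Ux|exact: ch].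
Qed.

(** [U] and the complement of [K] are open and cover the space; on the second set the extension is
    identically 0. *)
Lemma Ck1_ext0 (R : realType) (V : normedModType R) (U K : set V) (f : V -> R) :
  open U -> closed K -> K `<=` U -> (forall x, U x -> ~ K x -> f x = 0) ->
  Ck 1 U f -> Ck 1 setT (f \_ U).
Proof.
move=> oU cK KU f0 cf.
have cfU : Ck 1 U (f \_ U).
  by apply: Ck1_near cf => // x Ux; rewrite patchE mem_set.
have c0 : Ck 1 (~` K) (f \_ U).
  apply: (@Ck1_near _ _ _ (cst 0)); first exact: closed_openC.
    by move=> x Kx; rewrite patchE; case: ifPn => //; rewrite inE => Ux; rewrite f0.
  split=> [x _|v x _]; first exact: differentiable_cst.
  rewrite (_ : 'D_v (cst 0) = cst 0); first exact: cst_continuous.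
  by apply/funext => y; rewrite derive_cst.
split=> [x _|v x _]; have [Kx|Kx] := pselect (K x).
- by have [h _] := cfU; apply: h; exact: KU.
- by have [h _] := c0; apply: h.
- by have [_ h] := cfU; apply: h; exact: KU.
- by have [_ h] := c0; apply: h.
Qed.

(** * Truncation *)

(** The square of the positive part of r, written so that the derivative is [r + |r|], which is
    continuous across 0. *)
Definition pos2 (R : realType) (r : R) : R := r * (r + `|r|) / 2.

Lemma is_derive_conv (R : realType) (V W : normedModType R) (f : V -> W) (x v : V) (a b : W) :
  is_derive x v f a -> a = b -> is_derive x v f b.
Proof. by move=> ? <-. Qed.

Lemma is_derive_pos2 (R : realType) (x : R) : is_derive x 1 (@pos2 R) (x + `|x|).
Proof.
have [x0|x0|x0] := ltgtP x 0.
- apply: (@near_eq_is_derive _ _ _ (cst 0)).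
    have := lt_nbhsl x0; apply: filterS => y y0.
    by rewrite /pos2 ltr0_norm// subrr mulr0 mul0r.
  by rewrite ltr0_norm// subrr; exact: is_derive_cst.
- apply: (@near_eq_is_derive _ _ _ (fun y : R => y ^+ 2)).
    have := lt_nbhsr x0; apply: filterS => y y0.
    by rewrite /pos2 gtr0_norm//; field.
  by rewrite gtr0_norm//; apply: is_derive_eq; rewrite /GRing.scale/=; ring.
- rewrite x0 normr0 addr0.
  have n0 : (fun h : R => `|h|) @ 0^' --> `|0 : R|.
    by apply: cvg_within_filter; exact: norm_continuous.
  (* The difference quotient at 0 is (h + |h|) / 2, squeezed between - |h| and |h|. *)
  have lim0 : (h^-1 *: ((@pos2 R \o shift 0) (h *: 1) - pos2 0)) @[h --> 0^'] --> (0 : R).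
    apply: (@squeeze_cvgr _ _ _ _ (fun h : R => - `|h|) (fun h : R => `|h|)).
    + near=> h; rewrite /= /pos2 addr0 normr0 mul0r mul0r subr0 /GRing.scale/= mulr1.
      have h0 : h != 0 by near: h; exact: nbhs_dnbhs_neq.
      have -> : h^-1 * (h * (h + `|h|) / 2) = (h + `|h|) / 2 by field.
      by have := ler_norm h; have := ler_norm (- h); rewrite normrN => h1 h2; apply/andP; split; lra.
    + by have := cvgN n0; rewrite normr0 oppr0; exact.
    + by move: n0; rewrite normr0.
  by split; [apply/cvg_ex; exists 0; exact: lim0|apply/cvg_lim].
Unshelve. all: by end_near. Qed.

(* An odd C^1 truncation of the identity that vanishes on [-1, 1]. *)
Definition bump (R : realType) (s : R) : R := s * pos2 (s ^+ 2 - 1) / (s ^+ 4 + 1).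

Definition dbump (R : realType) (s : R) : R :=
  (pos2 (s ^+ 2 - 1) + 2 * s ^+ 2 * (s ^+ 2 - 1 + `|s ^+ 2 - 1|)) / (s ^+ 4 + 1)
  - 4 * s ^+ 4 * pos2 (s ^+ 2 - 1) / (s ^+ 4 + 1) / (s ^+ 4 + 1).

Lemma is_derive_bump (R : realType) (s : R) : is_derive s 1 (@bump R) (dbump s).
Proof.
have d0 : s ^+ 4 + 1 != 0 by rewrite gt_eqF// ltr_wpDl// -[4%N]/(2 * 2)%N exprM sqr_ge0.
have d1 : is_derive s 1 (fun t : R => pos2 (t ^+ 2 - 1)) (2 * s * (s ^+ 2 - 1 + `|s ^+ 2 - 1|)).
  have dq : is_derive s 1 (fun t : R => t ^+ 2 - 1) (2 * s).
    by apply: is_derive_eq; rewrite /GRing.scale/=; ring.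
  apply: (is_derive_conv (@is_derive1_comp _ (@pos2 R) (fun t => t ^+ 2 - 1) s _ _ (is_derive_pos2 (s ^+ 2 - 1)) dq)).
  by rewrite mulrC.
have d2 : is_derive s 1 (fun t : R => (t ^+ 4 + 1)^-1) (- (4 * s ^+ 3) / (s ^+ 4 + 1) ^+ 2).
  have dq : is_derive s 1 (fun t : R => t ^+ 4 + 1) (4 * s ^+ 3).
    by apply: is_derive_eq; rewrite /GRing.scale/=; ring.
  have [dq1 dq2] := dq; split; first exact: derivableV.
  by rewrite deriveV// dq2 /GRing.scale/= -exprVn; ring.
have d3 := is_deriveM (is_derive_id s 1) d1.
have d4 := is_deriveM d3 d2.
apply: (is_derive_conv d4).
by rewrite /dbump /GRing.scale/= !fctE; field.
Qed.

Lemma pos2_le0 (R : realType) (r : R) : r <= 0 -> pos2 r = 0.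
Proof. by move=> r0; rewrite /pos2 ler0_norm// subrr mulr0 mul0r. Qed.

Lemma pos2_ge0 (R : realType) (r : R) : 0 <= r -> pos2 r = r ^+ 2.
Proof. by move=> r0; rewrite /pos2 ger0_norm//; field. Qed.

Lemma bump0 (R : realType) (s : R) : s ^+ 2 <= 1 -> bump s = 0.
Proof. by move=> s1; rewrite /bump pos2_le0 ?subr_le0// mulr0 mul0r. Qed.

Lemma dbump0 (R : realType) (s : R) : s ^+ 2 <= 1 -> dbump s = 0.
Proof.
move=> s1; rewrite /dbump pos2_le0 ?subr_le0// ler0_norm ?subr_le0// subrr.
by rewrite !mulr0 !mul0r subr0 addr0 mul0r.
Qed.

(** For |s| > 1 the error is - 2 s^3 / (s^4 + 1), which is bounded; after the rescaling in [eta]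
    this becomes an error of order 1 / (k + 1). *)
Lemma bump_err (R : realType) (s : R) : `|bump s - s| <= 2.
Proof.
have [s1|s1] := leP (s ^+ 2) 1.
  rewrite bump0// sub0r normrN (@le_trans _ _ 1)//; last by rewrite ler1n.
  by rewrite -(@expr_le1 _ 2)// real_normK// num_real.
have p0 : 0 < s ^+ 4 + 1 by nra.
rewrite /bump pos2_ge0 ?subr_ge0 ?(ltW s1)//.
have -> : s * (s ^+ 2 - 1) ^+ 2 / (s ^+ 4 + 1) - s = - (2 * s ^+ 3) / (s ^+ 4 + 1).
  by field; rewrite gt_eqF.
have h1 : 0 <= s ^+ 2 * (s - 1) ^+ 2 by rewrite mulr_ge0 ?sqr_ge0.
have h2 : 0 <= s ^+ 2 * (s + 1) ^+ 2 by rewrite mulr_ge0 ?sqr_ge0.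
have h3 : 0 <= (s ^+ 2 - 1) ^+ 2 by rewrite sqr_ge0.
rewrite ler_norml; apply/andP; split.
  by rewrite ler_pdivlMr//; lra.
by rewrite ler_pdivrMr//; lra.
Qed.

Lemma bump_le (R : realType) (s : R) : `|bump s| <= `|s|.
Proof.
have [s1|s1] := leP (s ^+ 2) 1; first by rewrite bump0// normr0.
have p0 : 0 < s ^+ 4 + 1 by nra.
rewrite /bump pos2_ge0 ?subr_ge0 ?(ltW s1)// -mulrA normrM ler_piMr//.
rewrite ger0_norm ?divr_ge0 ?sqr_ge0 ?(ltW p0)// ler_pdivrMr//; nra.
Qed.

(** For |s| > 1 the derivative differs from 1 by (2 s^6 - 6 s^2) / (s^4 + 1)^2, which is of order
    s^-2. The weight [s ^+ 2] makes the bound usable at (k + 1) s with s fixed and k large. *)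
Lemma dbump_err (R : realType) (s : R) : `|dbump s - 1| * s ^+ 2 <= 6.
Proof.
have [s1|s1] := leP (s ^+ 2) 1.
  rewrite dbump0// sub0r normrN normr1 mul1r; lra.
have p0 : 0 < s ^+ 4 + 1 by nra.
have s1' : 0 <= s ^+ 2 - 1 by rewrite subr_ge0 ltW.
rewrite /dbump pos2_ge0// (ger0_norm s1').
set x := (X in `|X|).
have -> : x = (2 * s ^+ 6 - 6 * s ^+ 2) / (s ^+ 4 + 1) ^+ 2.
  by rewrite /x; field; rewrite gt_eqF.
have s2 : 0 <= s ^+ 2 by exact: sqr_ge0.
rewrite -[X in _ * X](ger0_norm s2) -normrM mulrAC.
have p2 : 0 < (s ^+ 4 + 1) ^+ 2 by rewrite exprn_gt0.
have e4 : s ^+ 4 = s ^+ 2 * s ^+ 2 by ring.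
have e6 : s ^+ 6 = s ^+ 2 * s ^+ 2 * s ^+ 2 by ring.
rewrite e4 e6 in p0 p2 *; move: (s ^+ 2) s1 s2 p0 p2 => y y1 y0 p0 p2.
rewrite ler_norml; apply/andP; split.
  rewrite ler_pdivlMr//; nra.
rewrite ler_pdivrMr//; nra.
Qed.

(** 7 = 6 + 1: once [s ^+ 2 > 1], [dbump_err] bounds the distance to 1 by 6. *)
Lemma dbump_le (R : realType) (s : R) : `|dbump s| <= 7.
Proof.
have [s1|s1] := leP (s ^+ 2) 1; first by rewrite dbump0// normr0.
have := dbump_err s; have := ler_normD (dbump s - 1) 1; rewrite subrK normr1.
have := normr_ge0 (dbump s - 1); nra.
Qed.

Lemma continuous_dbump (R : realType) : continuous (@dbump R).
Proof.
move=> s.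
have d0 : s ^+ 4 + 1 != 0 by rewrite gt_eqF// ltr_wpDl// -[4%N]/(2 * 2)%N exprM sqr_ge0.
have cX m : (fun t : R => t ^+ m) @ s --> s ^+ m by exact: exprn_continuous.
have c1 : (fun t : R => t ^+ 2 - 1) @ s --> s ^+ 2 - 1 by apply: cvgB => //; exact: cvg_cst.
have c2 : (fun t : R => pos2 (t ^+ 2 - 1)) @ s --> pos2 (s ^+ 2 - 1).
  by apply: cvgM; [apply: cvgM => //; apply: cvgD => //; exact: cvg_norm|exact: cvg_cst].
have c3 : (fun t : R => (t ^+ 4 + 1)^-1) @ s --> (s ^+ 4 + 1)^-1.
  by apply: cvgV => //; apply: cvgD => //; exact: cvg_cst.
rewrite /continuous_at /dbump; apply: cvgB.
  apply: cvgM => //; apply: cvgD => //; apply: cvgM; first by apply: cvgM => //; exact: cvg_cst.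
  by apply: cvgD => //; exact: cvg_norm.
apply: cvgM => //; apply: cvgM => //; apply: cvgM => //; apply: cvgM => //; exact: cvg_cst.
Qed.

(** Rescaling shrinks the interval on which [bump] vanishes to |s| <= 1 / (k + 1) and leaves the
    bound on the derivative unchanged. *)
Definition eta (R : realType) (k : nat) (s : R) : R := bump (k.+1%:R * s) / k.+1%:R.

Lemma is_derive_eta (R : realType) (k : nat) (s : R) :
  is_derive s 1 (@eta R k) (dbump (k.+1%:R * s)).
Proof.
have dl : is_derive s 1 (fun t : R => k.+1%:R * t) k.+1%:R.
  by apply: is_derive_eq; rewrite /GRing.scale/=; ring.
have := is_derive1_comp (is_derive_bump (k.+1%:R * s)) dl => dc.
have := is_deriveM dc (is_derive_cst (k.+1%:R^-1 : R) s 1) => dm.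
by apply: (is_derive_conv dm); rewrite /GRing.scale/= mulr0 add0r mulrC mulrK// unitfE pnatr_eq0.
Qed.

Lemma eta_le (R : realType) k (s : R) : `|eta k s| <= `|s|.
Proof.
rewrite /eta normrM normfV ler_pdivrMr ?normr_gt0 ?pnatr_eq0//.
by rewrite (le_trans (bump_le _))// normrM mulrC.
Qed.

Lemma eta_cvg (R : realType) (s : R) : eta k s @[k --> \oo] --> s.
Proof.
apply/cvgrPdist_le => /= e e0.
have := near_infty_natSinv_lt (PosNum (divr_gt0 e0 (ltr0n _ 2))) => /=.
apply: filterS => k ke; rewrite distrC /eta.
have -> : bump (k.+1%:R * s) / k.+1%:R - s = (bump (k.+1%:R * s) - k.+1%:R * s) * k.+1%:R^-1.
  by rewrite mulrBl [_ * s]mulrC mulfK// pnatr_eq0.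
rewrite normrM (ger0_norm (_ : 0 <= k.+1%:R^-1))//.
have := bump_err (k.+1%:R * s); have : 0 <= k.+1%:R^-1 :> R by rewrite invr_ge0.
by move: ke; move: (k.+1%:R^-1) (`|_|) => d x; nra.
Qed.

Lemma deta_cvg (R : realType) (s : R) : s != 0 -> dbump (k.+1%:R * s) @[k --> \oo] --> (1 : R).
Proof.
move=> s0; have s2 : 0 < s ^+ 2 by rewrite exprn_even_gt0.
apply/cvgrPdist_le => /= e e0.
have e' : 0 < e * s ^+ 2 / 6 by rewrite divr_gt0// mulr_gt0.
have := near_infty_natSinv_lt (PosNum e') => /=.
apply: filterS => k ke; rewrite distrC.
have := dbump_err (k.+1%:R * s); rewrite exprMn.
have k1 : 1 <= k.+1%:R :> R by rewrite ler1n.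
have k0 : 0 < k.+1%:R :> R by rewrite ltr0n.
move: ke; rewrite -[X in X < _]mul1r ltr_pdivrMr//.
move: (normr_ge0 (dbump (k.+1%:R * s) - 1)) k1 k0.
move: (k.+1%:R) (`|_|) => d x x0 d1 d0 h1 h2.
have : x * (d * s ^+ 2) <= x * (d ^+ 2 * s ^+ 2).
  by apply: ler_wpM2l => //; apply: ler_wpM2r; [exact: ltW|nra].
have h3 : 6 < e * (d * s ^+ 2) by lra.
have : 0 < d * s ^+ 2 by rewrite mulr_gt0.
move: (d * s ^+ 2) h3 => w; nra.
Qed.

Lemma eta_eq0 (R : realType) k (s : R) : `|s| <= k.+1%:R^-1 -> eta k s = 0.
Proof.
move=> sk; rewrite /eta bump0 ?mul0r// -real_normK ?num_real// expr_le1//.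
by rewrite normrM ger0_norm// mulrC -ler_pdivlMr ?ltr0n// mul1r.
Qed.

(** * Isolated zeros on a line *)

Lemma derive_neq0_isolated (R : realType) (f : R -> R) (s d : R) :
  is_derive s 1 f d -> f s = 0 -> d != 0 ->
  exists2 e : R, 0 < e & forall r, `|r - s| < e -> r != s -> f r != 0.
Proof.
move=> [df <-] fs0 d0.
have := @cvgr_neq0 _ _ _ _ _ _ _ df d0.
rewrite near_withinE => nb.
have nb' : nbhs (0 : R)
  (fun h => h != 0 -> h^-1 *: ((f \o shift s) (h *: 1) - f s) != 0) by apply: nb; typeclasses eauto.
have [e /= e0 he] := (@nbhs_ballP _ R _ _).1 nb'.
exists e => // r rs r_s.
have := he (r - s); rewrite /ball/= sub0r normrN => /(_ rs).
rewrite subr_eq0 => /(_ r_s); rewrite fs0 subr0 /GRing.scale/= mulr1 subrK.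
by apply: contra_neq => ->; rewrite mulr0.
Qed.

(** Each point is the only one of S in some interval with rational endpoints, so the chosen pair of
    endpoints determines the point. *)
Lemma isolated_countable (R : realType) (S : set R) :
  (forall s, S s -> exists2 e : R, 0 < e & forall r, S r -> `|r - s| < e -> r = s) ->
  countable S.
Proof.
move=> iso.
have pq s : exists w : rat * rat, S s -> (ratr w.1 < s < ratr w.2) /\
    forall r, S r -> ratr w.1 < r < ratr w.2 -> r = s.
  have [Ss|nS] := pselect (S s); last by exists (0, 0).
  have [e e0 he] := iso s Ss.
  have /rat_in_itvoo[p] : s - e < s by rewrite ltrBlDr ltrDl.
  have /rat_in_itvoo[q] : s < s + e by rewrite ltrDl.
  rewrite !in_itv/= => /andP[q1 q2] /andP[p1 p2]; exists (p, q) => _ /=; split; first by rewrite p2 q1.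
  move=> r Sr /andP[r1 r2]; apply: he => //; move: r1 r2 p1 q2.
  by move: (ratr p) (ratr q) => x y *; rewrite ltr_norml; apply/andP; split; lra.
have [f hf] := choice pq.
apply/countable_injP; exists (fun s => pickle (f s)) => s r.
rewrite !inE => Ss Sr /(pcan_inj pickleK) fE.
by have [_] := hf r Sr; apply => //; rewrite -fE; have [] := hf s Ss.
Qed.

(** * Integration by parts for functions vanishing at the boundary *)

Lemma measurable_eq0 (R : realType) n (U : set 'rV[R]_n) (f : 'rV[R]_n -> R) :
  measurable U -> measurable_fun U f -> measurable (U `&` [set x | f x = 0]).
Proof. by move=> mU mf; exact: (mf mU [set 0]). Qed.

Lemma zero_set_null (R : realType) n (Om : set 'rV[R]_n) (v : 'rV[R]_n -> R) (i : 'I_n) :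
  open Om -> Ck 1 Om v ->
  (lebesgue_rV n).-negligible [set x | [/\ Om x, v x = 0 & pd i v x != 0]].
Proof.
move=> oOm cv; have mOm := open_measurable_rV oOm.
have mv : measurable_fun Om v by apply: continuous_measurable_rV => //; exact: Ck1_continuous.
have mDv : measurable_fun Om (pd i v).
  by apply: continuous_measurable_rV => //; have [_] := cv; exact.
have mA : measurable [set x | [/\ Om x, v x = 0 & pd i v x != 0]].
  rewrite (_ : mkset _ = (Om `&` [set x | v x = 0]) `\` (Om `&` [set x | pd i v x = 0])).
    by apply: measurableD; exact: measurable_eq0.
  apply/seteqP; split => x /=.
    by move=> [Ox vx Dx]; split => // -[_ /eqP]; rewrite (negPf Dx).
  by move=> [[Ox vx] h]; split => //; apply/eqP => Dx; apply: h.
exists [set x | [/\ Om x, v x = 0 & pd i v x != 0]]; split => //.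
apply: (lebesgue_rV_slice0 (i := i)) => // x.
apply: countable_lebesgue_measure0; apply: isolated_countable => s /= [Oxs vxs Dxs].
have ds := is_derive_line (Ck1_derivable cv _ (delta_mx ord0 i) Oxs).
have [e e0 he] := derive_neq0_isolated ds vxs Dxs.
exists e => // r [_ vr _] rs; apply: contrapT => /eqP rs'.
by have := he r rs rs'; rewrite vr eqxx.
Qed.

Lemma compact_support_bounded (R : realType) n (K : set 'rV[R]_n) (f : 'rV[R]_n -> R) :
  compact K -> continuous f -> (forall x, ~ K x -> f x = 0) -> exists M, forall x, `|f x| <= M.
Proof.
move=> cK cf f0.
have /compact_bounded[M [_ hM]] : compact (f @` K).
  by apply: continuous_compact => //; exact: continuous_subspaceT.
have M1 : M < `|M| + 1 by rewrite ltr_pwDr// ler_norm.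
exists (`|M| + 1) => x; have [Kx|/f0 ->] := pselect (K x); last by rewrite normr0 addr_ge0.
by apply: hM M1 _ _; exists x.
Qed.

Lemma compact_box (R : realType) n (K : set 'rV[R]_n) :
  compact K -> exists N : R, forall (x : 'rV[R]_n) j, N < `|x ord0 j| -> ~ K x.
Proof.
move=> /compact_bounded[M [_ hM]]; exists (`|M| + 1) => x j xj Kx.
have M1 : M < `|M| + 1 by rewrite ltr_pwDr// ler_norm.
have h2 : `|x| <= `|M| + 1 by exact: hM.
have h1 : `|x ord0 j| <= `|x| by rewrite [leRHS]mx_normrE; apply: (le_bigmax _ _ (ord0, j)).
by move: xj; rewrite ltNge (le_trans h1 h2).
Qed.

Lemma pd_support (R : realType) n (Om : set 'rV[R]_n) (f : 'rV[R]_n -> R) i :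
  C1c Om f -> exists K, [/\ compact K, K `<=` Om, forall x, ~ K x -> f x = 0 &
    forall x, ~ K x -> pd i f x = 0].
Proof.
move=> [cf [K [cK KO f0]]]; exists K; split => // x Kx.
rewrite /pd (@near_eq_derive _ _ _ _ (cst 0)); first exact: derive_cst.
have oK : open (~` K) by apply: closed_openC; apply: compact_closed => //; exact: norm_hausdorff.
have : \forall y \near x, (~` K) y by exact: open_nbhs_nbhs.
by apply: filterS => y Ky; rewrite f0.
Qed.

(** Fubini reduces the claim to lines in direction i, where the fundamental theorem of calculus is
    applied between two points outside the support. *)
Lemma integral_pd0 (R : realType) n (Om : set 'rV[R]_n) (f : 'rV[R]_n -> R) i :
  C1c Om f -> (\int[lebesgue_rV n]_x (pd i f x)%:E = 0)%E.
Proof.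
move=> Cf; have [K [cK KO f0 Df0]] := pd_support i Cf.
have [cf _] := Cf.
have cDf : continuous (pd i f) by move=> x; have [_ h] := cf; exact: h.
have [M hM] := compact_support_bounded cK cDf Df0.
have [N hN] := compact_box cK.
have mDf : measurable_fun setT (pd i f).
  by apply: continuous_measurable_rV => [|x _]; [exact: openT|exact: cDf].
apply: (@integral_slice0 _ _ i _ N M) => //.
  by move=> x j /hN; exact: Df0.
move=> x; pose e : 'rV[R]_n := delta_mx ord0 i.
(* Chosen so that |s| >= L forces |x_i + s| > N, that is, a point outside the support. *)
pose L : R := `|N| + `|x ord0 i| + 1.
have L0 : 0 < L by rewrite /L ltr_wpDl// addr_ge0.
have out s : L <= `|s| -> ~ K (x + s *: e).
  move=> Ls; apply: (hN _ i); rewrite !mxE !eqxx mulr1.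
  have := ler_norm N; have := ler_normB (x ord0 i + s) (x ord0 i); rewrite addrAC subrr add0r.
  by move: Ls; rewrite /L; lra.
pose D : set R := `[- L, L]%classic.
pose g (s : R) : R := pd i f (x + s *: e).
have -> : (\int[@lebesgue_measure R]_s (g s)%:E = \int[@lebesgue_measure R]_(s in D) (g s)%:E)%E.
  rewrite [RHS]integral_mkcond; apply: eq_integral => s _.
  rewrite patchE; case: ifPn => // /negP sL; rewrite /g Df0//; apply: out.
  by rewrite leNgt; apply/negP => sl; apply: sL; apply/mem_set; rewrite /D/= in_itv/= -ler_norml ltW.
have cline : continuous (fun s : R => x + s *: e).
  by move=> s; apply: cvgD; [exact: cvg_cst|apply: cvgZr_tmp => //; exact: cvg_id].
have dline (s : R) : is_derive s 1 (fun r : R => f (x + r *: e)) (pd i f (x + s *: e)).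
  by apply: is_derive_line; exact: (Ck1_derivable cf).
have cfl : continuous (fun s : R => f (x + s *: e)).
  by move=> s; apply: differentiable_continuous; apply/derivable1_diffP; have [] := dline s.
rewrite (@continuous_FTC2 _ _ (fun s => f (x + s *: e))).
- rewrite (f0 (x + L *: e)); last by apply: out; exact: ler_norm.
  rewrite (f0 (x + (- L) *: e)); first by rewrite subee.
  by apply: out; rewrite normrN; exact: ler_norm.
- by rewrite gtrN.
- apply: continuous_subspaceT => s; apply: (@continuous_comp _ _ _ (fun s : R => x + s *: e) (pd i f)).
    exact: cline.
  exact: cDf.
- split; first by move=> s _; have [] := dline s.
    exact: (cvg_at_right_filter (cfl (- L))).
  exact: (cvg_at_left_filter (cfl L)).
- by move=> s _; rewrite derive1E; have [_ ->] := dline s.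
Qed.

Lemma restrict_integral (R : realType) n (Om : set 'rV[R]_n) (f : 'rV[R]_n -> R) :
  (forall x, ~ Om x -> f x = 0) ->
  (\int[lebesgue_rV n]_(x in Om) (f x)%:E = \int[lebesgue_rV n]_x (f x)%:E)%E.
Proof.
move=> f0; rewrite integral_mkcond; apply: eq_integral => x _.
by rewrite patchE; case: ifPn => // /negP xO; rewrite f0// => Ox; apply: xO; rewrite inE.
Qed.

Lemma C1c_ext0 (R : realType) n (Om K : set 'rV[R]_n) (f : 'rV[R]_n -> R) :
  open Om -> compact K -> K `<=` Om -> (forall x, Om x -> ~ K x -> f x = 0) ->
  Ck 1 Om f -> C1c Om (f \_ Om).
Proof.
move=> oO cK KO f0 cf; split.
  by apply: (@Ck1_ext0 _ _ _ K) => //; apply: compact_closed => //; exact: norm_hausdorff.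
exists K; split => // x Kx; rewrite patchE; case: ifPn => // /set_mem Ox; exact: f0.
Qed.

(** Zero boundary values expressed inside Om, without traces: v tends to 0 towards the boundary.
    This is exactly what makes every truncation [eta k (v x)] compactly supported in Om. *)
Definition vanishing (R : realType) n (Om : set 'rV[R]_n) (v : 'rV[R]_n -> R) :=
  forall e : R, 0 < e -> compact [set x | Om x /\ e <= `|v x|].

Lemma eta_C1c (R : realType) n (Om : set 'rV[R]_n) (v F : 'rV[R]_n -> R) k :
  open Om -> Ck 1 Om v -> vanishing Om v -> Ck 1 Om F ->
  C1c Om ((fun x => eta k (v x) * F x) \_ Om).
Proof.
move=> oO cv vv cF.
have k0 : 0 < k.+1%:R^-1 :> R by rewrite invr_gt0.
apply: (C1c_ext0 oO (vv _ k0)); first by move=> x [].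
  move=> x Ox /= h; rewrite eta_eq0 ?mul0r//.
  by rewrite leNgt; apply/negP => h'; apply: h; split => //; exact: ltW.
apply: (@Ck1_M R _ Om (fun x => eta k (v x)) F oO _ cF).
apply: (@Ck1_comp R _ Om v (@eta R k) oO _ _ cv).
  by move=> s; have [] := is_derive_eta k s.
have -> : derive1 (@eta R k) = (fun s => dbump (k.+1%:R * s)).
  by apply/funext => s; rewrite derive1E; have [_ ->] := is_derive_eta k s.
move=> s; apply: (@continuous_comp _ _ _ (fun s : R => k.+1%:R * s) (@dbump R)).
  by apply: cvgM; [exact: cvg_cst|exact: cvg_id].
exact: continuous_dbump.
Qed.

Lemma pd_eta (R : realType) n (Om : set 'rV[R]_n) (v F : 'rV[R]_n -> R) k i x :
  open Om -> Ck 1 Om v -> Ck 1 Om F -> Om x ->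
  pd i ((fun x => eta k (v x) * F x) \_ Om) x =
  eta k (v x) * pd i F x + dbump (k.+1%:R * v x) * (pd i v x * F x).
Proof.
move=> oO cv cF Ox.
rewrite /pd (@near_eq_derive _ _ _ _ (fun x => eta k (v x) * F x)); last first.
  have : \forall y \near x, Om y by exact: open_nbhs_nbhs.
  by apply: filterS => y Oy; rewrite patchE mem_set.
have dF := Ck1_derivable cF x (delta_mx ord0 i) Ox.
have dv := Ck1_derivable cv x (delta_mx ord0 i) Ox.
have de := derive_comp1 dv (@ex_derive _ _ _ _ _ _ _ (is_derive_eta k (v x))).
have [de1 de2] := de.
have := @deriveM _ _ (fun x => eta k (v x)) F x (delta_mx ord0 i) de1 dF => ->.
rewrite de2 /GRing.scale/= derive1E; have [_ ->] := is_derive_eta k (v x).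
by rewrite addrC; ring.
Qed.

Lemma Rdominated_cvg d (T : measurableType d) (R : realType)
    (mu : {measure set T -> \bar R}) (D : set T) (f_ : nat -> T -> R) (f g : T -> R) :
  measurable D -> (forall k, measurable_fun D (f_ k)) -> measurable_fun D f ->
  {ae mu, forall x, D x -> f_ k x @[k --> \oo] --> f x} ->
  mu.-integrable D (EFin \o g) -> (forall k x, D x -> `|f_ k x| <= g x) ->
  mu.-integrable D (EFin \o f) /\
  \int[mu]_(x in D) f_ k x @[k --> \oo] --> \int[mu]_(x in D) f x.
Proof.
move=> mD mf_ mf cf ig fg.
have [] := @dominated_convergence _ _ _ mu D mD (fun k => EFin \o f_ k) (EFin \o f) (EFin \o g).
- by move=> k; exact/measurable_EFinP.
- exact/measurable_EFinP.
- by apply: filterS cf => x h Dx; apply/cvg_EFin; [exact: nearW|exact: h].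
- exact: ig.
- by apply: aeW => x k Dx; rewrite /= lee_fin; exact: fg.
move=> if_ _ h; split => //.
by rewrite /Rintegral; apply: fine_cvg; rewrite fineK//; exact: integrable_fin_num.
Qed.

Lemma lebesgue_rV_bounded (R : realType) n (Om : set 'rV[R]_n) :
  measurable Om -> bounded_set Om -> (lebesgue_rV n Om < +oo)%E.
Proof.
move=> mOm [M [_ hM]].
have M1 : M < `|M| + 1 by rewrite ltr_pwDr// ler_norm.
pose N := `|M| + 1.
pose B := [set x : 'rV[R]_n | forall i, (const_mx (- N) : 'rV[R]_n) ord0 i <= x ord0 i <= (const_mx N : 'rV[R]_n) ord0 i].
have mB : measurable B.
  rewrite (_ : B = [set x : 'rV[R]_n | forall i, `[- N, N]%classic (x ord0 i)]).
    by apply: (@measurable_box R n (fun=> `[- N, N]%classic)) => i; exact: measurable_itv.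
  by apply/seteqP; split => x /= h i; have := h i; rewrite !mxE in_itv.
apply: (@le_lt_trans _ _ (lebesgue_rV n B)).
  apply: le_measure; rewrite ?inE// => x Ox i; rewrite !mxE -ler_norml.
  apply: le_trans (hM _ M1 x Ox).
  by rewrite [leRHS]mx_normrE; apply: (le_bigmax _ _ (ord0, i)).
rewrite lebesgue_rV_box ?ltry// => i; rewrite !mxE.
by rewrite ge0_cp// /N addr_ge0.
Qed.

Lemma integrable_bounded (R : realType) n (Om : set 'rV[R]_n) (f : 'rV[R]_n -> R) (M : R) :
  open Om -> bounded_set Om -> measurable_fun Om f -> (forall x, Om x -> `|f x| <= M) ->
  (lebesgue_rV n).-integrable Om (EFin \o f).
Proof.
move=> oO bO mf fM; have mO := open_measurable_rV oO.
apply: measurable_bounded_integrable => //; first exact: lebesgue_rV_bounded.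
by exists M; split; [exact: num_real|move=> x Mx y Oy; exact: le_trans (fM y Oy) (ltW Mx)].
Qed.

Lemma ae_grad0 (R : realType) n (Om : set 'rV[R]_n) (v : 'rV[R]_n -> R) :
  open Om -> Ck 1 Om v -> {ae lebesgue_rV n, forall x, Om x -> v x = 0 -> grad v x = 0}.
Proof.
move=> oO cv.
have : {ae lebesgue_rV n, forall x, forall i, Om x -> v x = 0 -> pd i v x = 0}.
  apply: filter_forall => i; have := zero_set_null i oO cv.
  apply: negligibleS => x /= h; apply: contrapT => h'; apply: h => Ox vx.
  by apply: contrapT => /eqP Dx; apply: h'.
by apply: filterS => x h Ox vx; apply/rowP => i; rewrite !mxE; exact: h.
Qed.

Lemma integrable_C1c (R : realType) n (Om : set 'rV[R]_n) (f : 'rV[R]_n -> R) i :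
  open Om -> C1c Om f ->
  (lebesgue_rV n).-integrable Om (EFin \o pd i f) /\
  (\int[lebesgue_rV n]_(x in Om) (pd i f x)%:E = 0)%E.
Proof.
move=> oO Cf; have mO := open_measurable_rV oO.
have [K [cK KO f0 Df0]] := pd_support i Cf; have [cf _] := Cf.
have cDf : continuous (pd i f) by move=> x; have [_ h] := cf; exact: h.
have [M hM] := compact_support_bounded cK cDf Df0.
have [N hN] := compact_box cK.
have mDf : measurable_fun setT (pd i f).
  by apply: continuous_measurable_rV => [|x _]; [exact: openT|exact: cDf].
split.
  apply: (@integrableS _ _ _ _ setT) => //.
  by apply: (@integrable_bounded_support _ _ _ N M) => // x j /hN; exact: Df0.
rewrite restrict_integral ?(integral_pd0 i Cf)// => x Ox.
by apply: Df0 => /KO.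
Qed.

Lemma C1c_bounded (R : realType) n (Om : set 'rV[R]_n) (f : 'rV[R]_n -> R) :
  C1c Om f -> [/\ continuous f, exists M, forall x, `|f x| <= M &
    forall i, continuous (pd i f) /\ exists M, forall x, `|pd i f x| <= M].
Proof.
move=> Cf; have [cf [K [cK KO f0]]] := Cf.
have ctf : continuous f by move=> x; exact: (Ck1_continuous cf).
split => //; first exact: compact_support_bounded cK ctf f0.
move=> i; have cDf : continuous (pd i f) by move=> x; have [_ h] := cf; exact: h.
split => //; have [K' [cK' _ _ Df0]] := pd_support i Cf.
exact: compact_support_bounded cK' cDf Df0.
Qed.

Lemma C1c_M (R : realType) n (Om : set 'rV[R]_n) (f g : 'rV[R]_n -> R) :
  C1c Om f -> C1c Om g -> C1c Om (fun x => f x * g x).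
Proof.
move=> [cf [K [cK KO f0]]] [cg _]; split; first exact: (Ck1_M openT).
by exists K; split => // x Kx; rewrite f0// mul0r.
Qed.

(** The classical gradient is the weak one because the partial derivatives of [f * phi] have
    integral 0; the approximating sequence is constant. *)
Lemma C1c_H10 (R : realType) n (Om : set 'rV[R]_n) (f : 'rV[R]_n -> R) :
  open Om -> bounded_set Om -> C1c Om f -> H10 Om f (grad f).
Proof.
move=> oO bO Cf; have mO := open_measurable_rV oO.
have [cf [M hM] Df] := C1c_bounded Cf.
have mcont (h : 'rV[R]_n -> R) : continuous h -> measurable_fun Om h.
  by move=> ch; apply: continuous_measurable_rV => // x _; exact: ch.
have L2b (h : 'rV[R]_n -> R) N : continuous h -> (forall x, `|h x| <= N) -> L2 Om h.
  move=> ch hN; split; first exact: mcont.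
  apply: (@integrable_bounded _ _ _ _ (N ^+ 2)) => //.
    by apply: measurable_funX; exact: mcont.
  move=> x _; rewrite normrX lerXn2r ?nnegrE//; exact: le_trans (hN x).
split; last first.
  exists (fun=> f); split => //.
  rewrite (_ : (fun=> _) = cst 0%E); first exact: cvg_cst.
  apply/funext => k; apply: integral0_eq => x Ox.
  by rewrite !subrr expr0n /sqn /dotv add0r big1// => i _; rewrite mxE mul0r.
split.
- exact: L2b cf hM.
- move=> i; have [cDf [N hN]] := Df i.
  have -> : (fun x => grad f x ord0 i) = pd i f by apply/funext => x; rewrite mxE.
  exact: L2b cDf hN.
- move=> phi i Cphi.
  have [cphi [P hP] Dphi] := C1c_bounded Cphi.
  have [cDf [N hN]] := Df i; have [cDphi [Q hQ]] := Dphi i.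
  have ib (h1 h2 : 'rV[R]_n -> R) N1 N2 : continuous h1 -> continuous h2 ->
      (forall x, `|h1 x| <= N1) -> (forall x, `|h2 x| <= N2) ->
      (lebesgue_rV n).-integrable Om (EFin \o (fun x => h1 x * h2 x)).
    move=> c1 c2 b1 b2; apply: (@integrable_bounded _ _ _ _ (N1 * N2)) => //.
      by apply: measurable_funM; exact: mcont.
    by move=> x _; rewrite normrM ler_pM.
  have [_ I0] := integrable_C1c i oO (C1c_M Cf Cphi).
  have : \int[lebesgue_rV n]_(x in Om) (f x * pd i phi x + pd i f x * phi x) = 0.
    rewrite /Rintegral -[RHS]/(fine 0%E) -I0; congr fine; apply: eq_integral => x _.
    congr EFin; have [[c1 _] [c2 _]] := (Cf, Cphi).
    have := @deriveM _ _ f phi x (delta_mx ord0 i) (Ck1_derivable c1 x _ I) (Ck1_derivable c2 x _ I).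
    by rewrite /pd => ->; rewrite /GRing.scale/= [_ * phi x]mulrC.
  rewrite RintegralD//; [|exact: ib cf cDphi hM hQ|exact: ib cDf cphi hN hP].
  move=> /eqP; rewrite addr_eq0 => /eqP ->; congr (- _).
  by apply: eq_Rintegral => x _; rewrite mxE.
Qed.

Lemma integrableRD d (T : measurableType d) (R : realType) (mu : {measure set T -> \bar R})
    (D : set T) (f g : T -> R) : measurable D ->
  mu.-integrable D (EFin \o f) -> mu.-integrable D (EFin \o g) ->
  mu.-integrable D (EFin \o (fun x => f x + g x)).
Proof. by move=> mD if_ ig; exact: (integrableD mD if_ ig). Qed.

Lemma integrableRB d (T : measurableType d) (R : realType) (mu : {measure set T -> \bar R})
    (D : set T) (f g : T -> R) : measurable D ->
  mu.-integrable D (EFin \o f) -> mu.-integrable D (EFin \o g) ->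
  mu.-integrable D (EFin \o (fun x => f x - g x)).
Proof. by move=> mD if_ ig; exact: (integrableB mD if_ ig). Qed.

Lemma integrableRZ d (T : measurableType d) (R : realType) (mu : {measure set T -> \bar R})
    (D : set T) (c : R) (f : T -> R) : measurable D ->
  mu.-integrable D (EFin \o f) -> mu.-integrable D (EFin \o (fun x => c * f x)).
Proof. by move=> mD if_; exact: (integrableZl mD c if_). Qed.

Lemma le_integrableR d (T : measurableType d) (R : realType) (mu : {measure set T -> \bar R})
    (D : set T) (f g : T -> R) : measurable D -> measurable_fun D f ->
  (forall x, D x -> `|f x| <= g x) ->
  mu.-integrable D (EFin \o g) -> mu.-integrable D (EFin \o f).
Proof.
move=> mD mf fg; apply: le_integrable => //; first exact/measurable_EFinP.
by move=> x Dx; rewrite /= lee_fin (le_trans (fg x Dx))// ler_norm.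
Qed.

Lemma Ck1_cst (R : realType) (V : normedModType R) (U : set V) (c : R) : Ck 1 U (cst c).
Proof.
split=> [x _|v x _]; first exact: differentiable_cst.
rewrite (_ : 'D_v (cst c) = cst 0); first exact: cvg_cst.
by apply/funext => y; rewrite derive_cst.
Qed.

Lemma sqnZ (R : realType) n (c : R) (p : 'rV[R]_n) : sqn (c *: p) = c ^+ 2 * sqn p.
Proof. by rewrite /sqn /dotv mulr_sumr; apply: eq_bigr => i _; rewrite !mxE; ring. Qed.

Lemma sqn_ge0 (R : realType) n (p : 'rV[R]_n) : 0 <= sqn p.
Proof. by apply: sumr_ge0 => i _; rewrite -expr2 sqr_ge0. Qed.

Lemma measurable_Ck1 (R : realType) n (Om : set 'rV[R]_n) (v : 'rV[R]_n -> R) :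
  open Om -> Ck 1 Om v -> measurable_fun Om v /\ forall i, measurable_fun Om (pd i v).
Proof.
move=> oO cv; split=> [|i]; apply: continuous_measurable_rV => //.
  exact: Ck1_continuous cv.
by have [_] := cv; exact.
Qed.

Lemma measurable_eta (R : realType) d (T : measurableType d) (D : set T) (v : T -> R) k :
  measurable D -> measurable_fun D v -> measurable_fun D (fun x => eta k (v x)) /\
  measurable_fun D (fun x => dbump (k.+1%:R * v x)).
Proof.
move=> mD mv; split.
  apply: (measurableT_comp (f := @eta R k)) => //; apply: continuous_measurable_fun => s.
  apply: differentiable_continuous; apply/derivable1_diffP.
  by have [] := is_derive_eta k s.
apply: (measurableT_comp (f := @dbump R)).
  by apply: continuous_measurable_fun; exact: continuous_dbump.
exact: measurable_funM.
Qed.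

Lemma measurable_dotv (R : realType) d (T : measurableType d) n (D : set T) (p q : T -> 'rV[R]_n) :
  (forall i, measurable_fun D (fun x => p x ord0 i)) ->
  (forall i, measurable_fun D (fun x => q x ord0 i)) ->
  measurable_fun D (fun x => dotv (p x) (q x)).
Proof. by move=> mp mq; apply: measurable_sum => i; exact: measurable_funM. Qed.

Lemma poincare_vanishing (R : realType) n (Om : set 'rV[R]_n) (l : R) (v : 'rV[R]_n -> R) :
  open Om -> bounded_set Om -> poincare_ineq Om l -> Ck 1 Om v -> vanishing Om v ->
  (lebesgue_rV n).-integrable Om (EFin \o (fun x => v x ^+ 2)) ->
  (lebesgue_rV n).-integrable Om (EFin \o (fun x => sqn (grad v x))) ->
  l * \int[lebesgue_rV n]_(x in Om) (v x ^+ 2) <=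
  \int[lebesgue_rV n]_(x in Om) (sqn (grad v x)).
Proof.
move=> oO bO pO cv vv iv iDv; have mO := open_measurable_rV oO.
have [mv mDv] := measurable_Ck1 oO cv.
have me k := measurable_eta k mO mv.
have mg : measurable_fun Om (fun x => sqn (grad v x)).
  by apply: measurable_dotv => i; under eq_fun do rewrite mxE; exact: mDv.
have [_ lim_a] : (lebesgue_rV n).-integrable Om (EFin \o (fun x => v x ^+ 2)) /\
  \int[lebesgue_rV n]_(x in Om) (eta k (v x) ^+ 2) @[k --> \oo] -->
  \int[lebesgue_rV n]_(x in Om) (v x ^+ 2).
  apply: (@Rdominated_cvg _ _ _ _ _ _ _ (fun x => v x ^+ 2)) => //.
  - by move=> k; apply: measurable_funX; have [] := me k.
  - exact: measurable_funX.
  - by apply: aeW => x _; rewrite expr2; under eq_fun do rewrite expr2; apply: cvgM; exact: eta_cvg.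
  - move=> k x _; rewrite normrX -(real_normK (num_real (v x))).
    by rewrite lerXn2r ?nnegrE//; exact: eta_le.
have [_ lim_b] : (lebesgue_rV n).-integrable Om (EFin \o (fun x => sqn (grad v x))) /\
  \int[lebesgue_rV n]_(x in Om) (dbump (k.+1%:R * v x) ^+ 2 * sqn (grad v x)) @[k --> \oo] -->
  \int[lebesgue_rV n]_(x in Om) (sqn (grad v x)).
  (* 49 is the square of the bound 7 on [dbump]. *)
  apply: (@Rdominated_cvg _ _ _ _ _ _ _ (fun x => 49 * sqn (grad v x))) => //.
  - by move=> k; apply: measurable_funM => //; apply: measurable_funX; have [] := me k.
  - apply: filterS (ae_grad0 oO cv) => x h Ox.
    have [vx|vx] := eqVneq (v x) 0.
      have -> : sqn (grad v x) = 0 by rewrite h// /sqn /dotv big1// => i _; rewrite mxE mul0r.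
      by under eq_fun do rewrite mulr0; exact: cvg_cst.
    have h1 : dbump (k.+1%:R * v x) * dbump (k.+1%:R * v x) * sqn (grad v x) @[k --> \oo] -->
        1 * 1 * sqn (grad v x).
      by apply: cvgM; [apply: cvgM; exact: deta_cvg|exact: cvg_cst].
    by under eq_fun do rewrite expr2; move: h1; rewrite !mul1r.
  - exact: integrableRZ.
  - move=> k x _; rewrite normrM (ger0_norm (sqn_ge0 _)) ler_wpM2r ?sqn_ge0// normrX.
    by have := dbump_le (k.+1%:R * v x); have := normr_ge0 (dbump (k.+1%:R * v x)); nra.
have lim_la : l * \int[lebesgue_rV n]_(x in Om) (eta k (v x) ^+ 2) @[k --> \oo] -->
    l * \int[lebesgue_rV n]_(x in Om) (v x ^+ 2).
  by apply: cvgM; [exact: cvg_cst|exact: lim_a].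
apply: (ler_cvg_to lim_la lim_b); apply: nearW => k.
(* Taking the factor F constantly 1 turns [eta_C1c] and [pd_eta] into statements about [eta k (v x)]
   alone. *)
have := pO _ _ (C1c_H10 oO bO (eta_C1c k oO cv vv (@Ck1_cst _ _ Om 1))).
have -> : (\int[lebesgue_rV n]_(x in Om) ((((fun x => eta k (v x) * cst 1 x) \_ Om) x) ^+ 2)%:E =
   (\int[lebesgue_rV n]_(x in Om) (eta k (v x) ^+ 2))%:E)%E.
  rewrite /Rintegral fineK.
    by apply: eq_integral => x xO; rewrite patchE xO mulr1.
  apply: integrable_fin_num => //; apply: (@le_integrable _ _ _ _ _ mO _ (EFin \o (fun x => v x ^+ 2))) => //.
    by apply/measurable_EFinP; apply: measurable_funX; have [] := me k.
  move=> x _; rewrite /= lee_fin normrX [leRHS]normrX.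
  by rewrite lerXn2r ?nnegrE//; exact: eta_le.
have -> : (\int[lebesgue_rV n]_(x in Om) (sqn (grad ((fun x => eta k (v x) * cst 1 x) \_ Om) x))%:E =
   (\int[lebesgue_rV n]_(x in Om) (dbump (k.+1%:R * v x) ^+ 2 * sqn (grad v x)))%:E)%E.
  rewrite /Rintegral fineK.
    apply: eq_integral => x /set_mem xO; congr EFin; rewrite -sqnZ; congr sqn.
    apply/rowP => i; rewrite !mxE (pd_eta _ _ oO cv (@Ck1_cst _ _ Om 1) xO) mulr1.
    by rewrite /pd derive_cst mulr0 add0r.
  apply: integrable_fin_num => //.
  apply: (@le_integrable _ _ _ _ _ mO _ (fun x => 49%:E * (EFin \o (fun x => sqn (grad v x))) x)%E).
  - apply/measurable_EFinP; apply: measurable_funM => //; apply: measurable_funX; have [] := me k => //.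
  - move=> x _; rewrite /= lee_fin normrM [leRHS]normrM ler_wpM2r//.
    rewrite normrX [leRHS]ger0_norm//.
    by have := dbump_le (k.+1%:R * v x); have := normr_ge0 (dbump (k.+1%:R * v x)); nra.
  - exact: integrableZl.
by rewrite -EFinM lee_fin.
Qed.

Lemma integral_by_parts (R : realType) n (Om : set 'rV[R]_n)
    (v : 'rV[R]_n -> R) (F : 'rV[R]_n -> 'rV[R]_n) :
  open Om -> Ck 1 Om v -> vanishing Om v -> (forall i, Ck 1 Om (fun x => F x ord0 i)) ->
  (lebesgue_rV n).-integrable Om (EFin \o (fun x => v x * div F x)) ->
  (lebesgue_rV n).-integrable Om (EFin \o (fun x => dotv (grad v x) (F x))) ->
  \int[lebesgue_rV n]_(x in Om) (v x * div F x) =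
  - \int[lebesgue_rV n]_(x in Om) (dotv (grad v x) (F x)).
Proof.
move=> oO cv vv cF i1 i2; have mO := open_measurable_rV oO.
have [mv mDv] := measurable_Ck1 oO cv.
have mF i := (measurable_Ck1 oO (cF i)).1.
have me k := measurable_eta k mO mv.
have mg : measurable_fun Om (fun x => dotv (grad v x) (F x)).
  by apply: measurable_dotv => // i; under eq_fun do rewrite mxE; exact: mDv.
have mdiv : measurable_fun Om (div F).
  by apply: measurable_sum => i; exact: (measurable_Ck1 oO (cF i)).2.
(* The divergence of eta_k(v) F, expanded by the product rule; it has integral 0 because that field
   is compactly supported. *)
pose f k x := eta k (v x) * div F x + dbump (k.+1%:R * v x) * dotv (grad v x) (F x).
have f0 k : \int[lebesgue_rV n]_(x in Om) f k x = 0.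
  pose h i := (fun x => eta k (v x) * F x ord0 i) \_ Om.
  have ih i := integrable_C1c i oO (eta_C1c k oO cv vv (cF i)).
  rewrite /Rintegral (_ : integral _ _ _ = 0%E)//.
  transitivity (\int[lebesgue_rV n]_(x in Om) (\sum_i (pd i (h i) x)%:E))%E.
    apply: eq_integral => x /set_mem xO; rewrite sumEFin; congr EFin.
    rewrite /f /div /dotv !mulr_sumr -big_split/=; apply: eq_bigr => i _.
    by rewrite (pd_eta _ _ oO cv (cF i) xO) mxE.
  rewrite integral_sum//; last by move=> i; have [] := ih i.
  by apply: big1 => i _; have [] := ih i.
have [_ lim_f] : (lebesgue_rV n).-integrable Om (EFin \o (fun x => v x * div F x + dotv (grad v x) (F x))) /\
  \int[lebesgue_rV n]_(x in Om) f k x @[k --> \oo] -->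
  \int[lebesgue_rV n]_(x in Om) (v x * div F x + dotv (grad v x) (F x)).
  apply: (@Rdominated_cvg _ _ _ _ _ _ _ (fun x => `|v x * div F x| + 7 * `|dotv (grad v x) (F x)|)) => //.
  - move=> k; have [m1 m2] := me k.
    by apply: measurable_funD; apply: measurable_funM.
  - by apply: measurable_funD => //; exact: measurable_funM.
  - apply: filterS (ae_grad0 oO cv) => x h Ox.
    apply: cvgD; first by apply: cvgM; [exact: eta_cvg|exact: cvg_cst].
    have [vx|vx] := eqVneq (v x) 0.
      have -> : dotv (grad v x) (F x) = 0 by rewrite h// /dotv big1// => i _; rewrite mxE mul0r.
      by under eq_fun do rewrite mulr0; exact: cvg_cst.
    rewrite -[X in _ --> X]mul1r.
    by apply: cvgM; [exact: deta_cvg|exact: cvg_cst].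
  - apply: integrableRD => //; first exact: (integrable_norm i1).
    by apply: integrableRZ => //; exact: (integrable_norm i2).
  - move=> k x _; rewrite /f (le_trans (ler_normD _ _))// lerD//.
      by rewrite normrM [leRHS]normrM ler_wpM2r//; exact: eta_le.
    by rewrite normrM ler_wpM2r//; exact: dbump_le.
have c0 : \int[lebesgue_rV n]_(x in Om) f k x @[k --> \oo] --> (0 : R).
  by under eq_fun do rewrite f0; exact: cvg_cst.
have E : \int[lebesgue_rV n]_(x in Om) (v x * div F x + dotv (grad v x) (F x)) = 0.
  by apply: (cvg_unique _ lim_f c0).
by rewrite RintegralD// in E; move/eqP: E; rewrite addr_eq0 => /eqP.
Qed.

(** * The decay rate *)

Lemma quad_form_ge0 (R : realFieldType) (p q k x y : R) :
  0 < p -> q ^+ 2 <= p * k -> 0 <= p * x ^+ 2 - 2 * q * x * y + k * y ^+ 2.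
Proof.
move=> p0 qpk; rewrite -(pmulr_rge0 _ p0).
have -> : p * (p * x ^+ 2 - 2 * q * x * y + k * y ^+ 2) =
  (p * x - q * y) ^+ 2 + (p * k - q ^+ 2) * y ^+ 2 by ring.
by rewrite addr_ge0 ?sqr_ge0// mulr_ge0 ?sqr_ge0// subr_ge0.
Qed.

(** In the variables of [decay_rate_ineq], y = 2 m / a, while c and r stand for the rate parameter c
    and the square root in beta, both divided by a; the equation for d is then the formula for beta.
    In the last claim d is replaced by a rational lower bound e, which eliminates the square
    root. *)
Lemma rate_core (R : realFieldType) (y c d r : R) :
  0 < y -> 1 <= c -> 0 <= r -> r ^+ 2 = c ^+ 2 + y ^+ 2 -> d * (y + 1) = y + 1 + c - r ->
  [/\ 0 < d, d <= 1 &
   d < 2^-1 -> 1 + 2 * d * (1 - 2 * d) * (c - 1) <= d ^+ 2 * (y ^+ 2 + 1)].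
Proof.
move=> y0 c1 r0 rE dE.
have cr : c <= r by rewrite -(@ler_sqr R) ?nnegrE; nra.
have ry : r <= y + c by rewrite -(@ler_sqr R) ?nnegrE; nra.
have y10 : 0 < y + 1 by lra.
have d0 : 0 < d by rewrite -(pmulr_lgt0 _ y10) dE; lra.
have d1 : d <= 1 by rewrite -(ler_pM2r y10) dE; lra.
split=> // d2.
pose q := y / (y + 1).
have qE : q * (y + 1) = y by rewrite /q divfK// gt_eqF.
have yc0 : 0 < y + c by lra.
(* From (y + c)^2 - r^2 = 2 y c and r <= y + c one gets y + c - r >= y c / (y + c). *)
have dl : c + q <= d * (y + c).
  rewrite -(ler_pM2r y10) -[d * _ * _]mulrAC dE mulrDl qE.
  have : (y + c - r) * (y + c + r) = 2 * y * c by ring: rE.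
  have h : 0 <= (y + c - r) * (y + c - r) by rewrite -expr2 sqr_ge0.
  by move=> h'; nra.
(* With d < 1 / 2, [dl] gives y > c + 2 q. *)
have h1 : y * (y - 1) > c * (y + 1).
  have : (c + q) * (y + 1) < (y + c) * (y + 1) / 2 by rewrite mulrAC ltr_pM2r//; nra.
  by rewrite mulrDl qE; nra.
(* As c >= 1, [h1] gives y^2 - 2 y - 1 > 0, so y > 1 + sqrt 2 > 12 / 5; then q >= 12 / 17 > 7 /
   10. *)
have y2 : 12 / 5 <= y by rewrite leNgt; apply/negP => ?; nra.
have q1 : q < 1 by rewrite /q ltr_pdivrMr//; lra.
have q7 : 7 / 10 <= q by rewrite /q ler_pdivlMr//; lra.
pose n := c - 1; have n0 : 0 <= n by rewrite /n subr_ge0.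
pose e := (c + q) / (y + c).
have eE : e * (y + c) = c + q by rewrite /e divfK// gt_eqF.
have ed : e <= d by rewrite /e ler_pdivrMr.
have e0 : 0 < e by rewrite /e divr_gt0//; lra.
(* The claim at e, multiplied by (y + c)^2. Sorted by powers of y, the leading coefficient is (c +
   q)^2 - 1 = (n + q) (c + q + 1); [k1] lets the quadratic term absorb the linear one, and [k2] is
   the sign of the constant term. *)
have key : (y + c) ^+ 2 <= (c + q) * ((c + q) * (y ^+ 2 + 1 + 4 * n) - 2 * n * (y + c)).
  have cE : c = 1 + n by rewrite /n; ring.
  have k1 : 2 * n * (c + q) + 2 * c <= y * ((n + q) * (c + q + 1)).
    have : 12 / 5 * ((n + 7 / 10) * (c + 7 / 10 + 1)) <= y * ((n + q) * (c + q + 1)).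
      apply: ler_pM => //; first by rewrite mulr_ge0; lra.
      by apply: ler_pM; lra.
    have nq : n * q <= n by rewrite ler_piMr// ltW.
    have n2 : 0 <= n ^+ 2 by exact: sqr_ge0.
    by rewrite cE; lra.
  have k2 : 0 <= (c + q) ^+ 2 * (1 + 4 * n) - 2 * n * c * (c + q) - c ^+ 2.
    have : c ^+ 2 <= (c + q) ^+ 2 by rewrite ler_sqr ?nnegrE; lra.
    have : n * (c * (c + q)) <= n * ((c + q) * (c + q)).
      by apply: ler_wpM2l => //; apply: ler_wpM2r; lra.
    have : 0 <= n * (c + q) ^+ 2 by rewrite mulr_ge0 ?sqr_ge0.
    by move=> *; lra.
  have k3 : y * (2 * n * (c + q) + 2 * c) <= y * (y * ((n + q) * (c + q + 1))).
    by rewrite ler_pM2l.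
  rewrite -subr_ge0.
  have -> : (c + q) * ((c + q) * (y ^+ 2 + 1 + 4 * n) - 2 * n * (y + c)) - (y + c) ^+ 2 =
    (y * (y * ((n + q) * (c + q + 1))) - y * (2 * n * (c + q) + 2 * c)) +
    ((c + q) ^+ 2 * (1 + 4 * n) - 2 * n * c * (c + q) - c ^+ 2).
    by rewrite cE; ring.
  by rewrite addr_ge0// subr_ge0.
have key' : 1 <= e * (e * (y ^+ 2 + 1 + 4 * n) - 2 * n).
  have yc2 : 0 < (y + c) ^+ 2 by rewrite exprn_gt0.
  rewrite -(ler_pM2r yc2) mul1r.
  have -> : e * (e * (y ^+ 2 + 1 + 4 * n) - 2 * n) * (y + c) ^+ 2 =
     (e * (y + c)) * ((e * (y + c)) * (y ^+ 2 + 1 + 4 * n) - 2 * n * (y + c)) by ring.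
  by rewrite eE.
have pos : 0 < e * (y ^+ 2 + 1 + 4 * n) - 2 * n.
  by rewrite -(pmulr_rgt0 _ e0) (lt_le_trans _ key').
(* Both factors are positive at e and increase from e to d. *)
have mono : e * (e * (y ^+ 2 + 1 + 4 * n) - 2 * n) <= d * (d * (y ^+ 2 + 1 + 4 * n) - 2 * n).
  apply: ler_pM => //; [exact: ltW|exact: ltW|].
  by rewrite lerD2r ler_wpM2r//; nra.
by move: (le_trans key' mono); rewrite -/n; nra.
Qed.

(** The difference r - c decreases in c, so the worst case is c = 1, where r becomes s. There d s >=
    1 follows from (y + 1 - s) (s - 1) >= 0. *)
Lemma rate_core1 (R : realFieldType) (y c d r s : R) :
  0 < y -> 1 <= c -> 0 <= r -> r ^+ 2 = c ^+ 2 + y ^+ 2 ->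
  0 <= s -> s ^+ 2 = 1 + y ^+ 2 -> d * (y + 1) = y + 1 + c - r ->
  1 <= d ^+ 2 * (y ^+ 2 + 1).
Proof.
move=> y0 c1 r0 rE s0 sE dE.
have s1 : 1 <= s by rewrite -(@ler_sqr R) ?nnegrE; nra.
have sy : s <= y + 1 by rewrite -(@ler_sqr R) ?nnegrE; nra.
have cr : 1 - s <= c - r.
  have cr : c <= r by rewrite -(@ler_sqr R) ?nnegrE; nra.
  have h1 : (r - c) * (r + c) = y ^+ 2 by ring: rE.
  have h2 : (s - 1) * (s + 1) = y ^+ 2 by ring: sE.
  have sr : s <= r by rewrite -(@ler_sqr R) ?nnegrE; nra.
  have : (r - c) * (s + 1) <= (r - c) * (r + c) by apply: ler_wpM2l; lra.
  rewrite h1 -h2 ler_pM2r; lra.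
have y10 : 0 < y + 1 by lra.
have ds : 1 <= d * s.
  rewrite -(ler_pM2r y10) mul1r mulrAC dE.
  have : (y + 1 + (1 - s)) * s <= (y + 1 + c - r) * s by apply: ler_wpM2r; lra.
  have : 0 <= (y + 1 - s) * (s - 1) by rewrite mulr_ge0; lra.
  nra.
have -> : d ^+ 2 * (y ^+ 2 + 1) = (d * s) ^+ 2 by rewrite exprMn sE addrC.
by rewrite expr_ge1//; lra.
Qed.

(* X, Y and P stand for u_t, w = u - ustar and |grad w|^2; D1, D2 for the Bregman
   distances of Phi, Psi between u and ustar, M1, M2 for their symmetrized versions. *)
Definition pointwise_decay (R : realType) (theta mu a lambda A beta : R) : Prop :=
  forall X Y P D1 M1 D2 M2 : R,
  0 <= P -> theta / 2 * P <= D1 -> theta / 2 * P <= M1 - D1 -> D1 <= P / (2 * theta) ->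
  0 <= D2 -> 0 <= M2 - D2 -> D2 <= mu / 2 * Y ^+ 2 ->
  - (a / 2) * X ^+ 2 - a / 2 * M1 - a / 2 * M2 +
  beta * (X ^+ 2 / 2 + D1 + D2 + a / 2 * X * Y + a ^+ 2 / 4 * Y ^+ 2) <=
  - A * (P - lambda * Y ^+ 2).

(* With m^2 = lambda theta, N = mu + lambda (theta^-1 - theta) and
   d = 1 - beta / a, negativity of the quadratic form in (X, Y) reduces to
   d^2 (4 m^2 / a^2 + 1) >= 1 + 2 d (1 - 2 d)^+ N / a^2. *)
Lemma decay_rate_ineq (R : realType) (lambda theta a mu : R) :
  0 < lambda -> 0 < theta -> theta <= 1 -> 0 < a -> 0 < mu ->
  let c := a + mu / a + 2 * lambda / a * (theta^-1 - theta) in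
  let beta := (a * Num.sqrt (c ^+ 2 + 4 * lambda * theta) - a * c) /
              (2 * Num.sqrt (lambda * theta) + a) in
  exists2 A : R, 0 <= A & pointwise_decay theta mu a lambda A beta.
Proof.
move=> l0 th0 th1 a0 mu0 c beta.
pose m := Num.sqrt (lambda * theta).
have lt0 : 0 < lambda * theta by exact: mulr_gt0.
have m0 : 0 < m by rewrite sqrtr_gt0.
have mE : m ^+ 2 = lambda * theta by rewrite sqr_sqrtr// ltW.
(* N collects the cost of using the upper bounds on D1 and D2 once beta > a / 2: mu itself, and
   lambda times the gap between the two Hessian bounds. *)
pose N := mu + lambda * (theta^-1 - theta).
have th1' : 1 <= theta^-1 by rewrite invf_ge1.
have tt : 0 <= theta^-1 - theta by lra.
have ltt : 0 <= lambda * (theta^-1 - theta) by rewrite mulr_ge0// ltW.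
have N0 : 0 < N by rewrite /N ltr_pwDl.
have aN : a != 0 by rewrite gt_eqF.
pose y := 2 * m / a; pose c' := c / a.
pose s := Num.sqrt (c ^+ 2 + 4 * lambda * theta).
pose r := s / a; pose d := 1 - beta / a.
have y0 : 0 < y by rewrite /y divr_gt0// mulr_gt0.
have yE : y ^+ 2 * a ^+ 2 = 4 * m ^+ 2 by rewrite /y; field.
have c'E : a ^+ 2 * (c' - 1) = N + lambda * (theta^-1 - theta).
  by rewrite /c' /c /N; field; rewrite gt_eqF.
have a20 : 0 < a ^+ 2 by rewrite exprn_gt0.
have c'N : N / a ^+ 2 <= c' - 1.
  by rewrite ler_pdivrMr// mulrC c'E lerDl.
have c'1 : 1 <= c' by rewrite -subr_ge0 (le_trans _ c'N)// divr_ge0// ltW.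
have r0 : 0 <= r by rewrite divr_ge0 ?sqrtr_ge0// ltW.
have rE : r ^+ 2 = c' ^+ 2 + y ^+ 2.
  rewrite /r /c' exprMn sqr_sqrtr; last first.
    by rewrite addr_ge0 ?sqr_ge0// -mulrA mulr_ge0// ltW.
  have -> : 4 * lambda * theta = y ^+ 2 * a ^+ 2 by rewrite yE mE mulrA.
  by field.
have ma0 : 2 * m + a != 0 by rewrite gt_eqF// addr_gt0// mulr_gt0.
have dE : d * (y + 1) = y + 1 + c' - r.
  by rewrite /d /beta -/s -/m /y /c' /r; field; rewrite aN.
have [d0 d1 dlt] := rate_core y0 c'1 r0 rE dE.
have y1 : 0 <= 1 + y ^+ 2 by rewrite addr_ge0// sqr_ge0.
have dge := rate_core1 y0 c'1 r0 rE (sqrtr_ge0 (1 + y ^+ 2)) (sqr_sqrtr y1) dE.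
have betaE : beta = a * (1 - d) by rewrite /d; field.
have mE' : m ^+ 2 = a ^+ 2 * y ^+ 2 / 4 by have := yE; lra.
(* A quarter of this form is what remains once the terms in P cancel: the left-hand side of the
   decay inequality has - a d / 2 at X^2 and a beta / 2 at X Y. *)
have quad K X Y : (1 - d) ^+ 2 <= 2 * d * K ->
    0 <= a * (2 * d * X ^+ 2 - 2 * (1 - d) * X * (a * Y) + K * (a * Y) ^+ 2).
  by move=> h; rewrite mulr_ge0 ?(ltW a0)//; apply: quad_form_ge0 => //; rewrite mulr_gt0.
(* d >= 1 / 2 means beta <= a / 2: then D1 and D2 enter with a nonpositive coefficient and their
   lower bounds are used. The witness for A is the resulting coefficient of - P. *)
have [d2|d2] := leP 2^-1 d.
  exists (a * d * theta / 2); first by rewrite divr_ge0// mulr_ge0 ?(ltW th0)// mulr_ge0 ?(ltW a0) ?(ltW d0).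
  move=> X Y P D1 M1 D2 M2 P0 hD1 hM1 _ hD2 hM2 _.
  have hK : (1 - d) ^+ 2 <= 2 * d * (d * y ^+ 2 / 2 - (1 - d)) by move: dge; lra.
  have := quad _ X Y hK; rewrite betaE.
  have -> : - (a * d * theta / 2) * (P - lambda * Y ^+ 2) =
    - (a * d * (theta / 2 * P)) + a * d / 2 * m ^+ 2 * Y ^+ 2 by rewrite mE; ring.
  rewrite mE'.
  have e1 : 0 <= a * (2 * d - 1) / 2 * (D1 - theta / 2 * P).
    by rewrite mulr_ge0 ?subr_ge0// divr_ge0// mulr_ge0 ?(ltW a0)//; lra.
  have e2 : 0 <= a / 2 * (M1 - D1 - theta / 2 * P) by rewrite mulr_ge0 ?subr_ge0// divr_ge0// ltW.
  have e3 : 0 <= a / 2 * (M2 - D2) by rewrite mulr_ge0// divr_ge0// ltW.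
  have e4 : 0 <= a * (2 * d - 1) / 2 * D2.
    by rewrite mulr_ge0// divr_ge0// mulr_ge0 ?(ltW a0)//; lra.
  by move=> e5; lra.
have {}dlt := dlt d2.
pose K := d * y ^+ 2 / 2 - (1 - 2 * d) * (N / a ^+ 2) - (1 - d).
have hK : (1 - d) ^+ 2 <= 2 * d * K.
  have : 2 * d * (1 - 2 * d) * (N / a ^+ 2) <= 2 * d * (1 - 2 * d) * (c' - 1).
    by apply: ler_wpM2l => //; rewrite mulr_ge0 ?mulr_ge0 ?(ltW d0)//; lra.
  by rewrite /K; move: dlt; move: (N / a ^+ 2) => z; lra.
have K0 : 0 <= K.
  by rewrite -(pmulr_rge0 _ (mulr_gt0 (ltr0n _ 2) d0)) (le_trans _ hK)// sqr_ge0.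
(* Here D1 and D2 enter with the coefficient beta - a / 2 >= 0 and are bounded from above. A is
   again the coefficient of - P; its sign is not evident from the formula and is read off from [AE],
   as K >= 0. *)
pose A := (a / 2 * theta - (beta - a / 2) / theta) / 2.
have AE : A * lambda * 4 = a ^+ 3 * K + beta * a ^+ 2 + (2 * beta - a) * mu.
  have -> : A * lambda * 4 = a * m ^+ 2 - (2 * beta - a) * (lambda / theta).
    by rewrite /A mE; field; rewrite gt_eqF.
  have -> : lambda / theta = m ^+ 2 + N - mu by rewrite mE /N; ring.
  have -> : a ^+ 3 * K = a ^+ 3 * (d * y ^+ 2 / 2 - (1 - d)) - a * (1 - 2 * d) * N.
    by rewrite /K; field.
  by rewrite mE' betaE; field.
have b0 : a / 2 <= beta by rewrite betaE; nra.
exists A.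
  rewrite -(pmulr_lge0 _ l0) -(pmulr_lge0 _ (ltr0n _ 4)) AE.
  have p1 : 0 <= a ^+ 3 * K by rewrite mulr_ge0 ?exprn_ge0 ?(ltW a0).
  have p2 : 0 <= beta * a ^+ 2 by rewrite mulr_ge0 ?exprn_ge0 ?(ltW a0)//; lra.
  have p3 : 0 <= (2 * beta - a) * mu by apply: mulr_ge0; [lra|exact: ltW].
  by rewrite !addr_ge0.
move=> X Y P D1 M1 D2 M2 P0 hD1 hM1 hD1' hD2 hM2 hD2'.
have e0 := quad K X Y hK.
have e1 : 0 <= (beta - a / 2) * (P / (2 * theta) - D1) by rewrite mulr_ge0 ?subr_ge0.
have e2 : 0 <= a / 2 * (M1 - D1 - theta / 2 * P) by rewrite mulr_ge0 ?subr_ge0// divr_ge0// ltW.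
have e3 : 0 <= a / 2 * (M2 - D2) by rewrite mulr_ge0// divr_ge0// ltW.
have e4 : 0 <= (beta - a / 2) * (mu / 2 * Y ^+ 2 - D2) by rewrite mulr_ge0 ?subr_ge0.
have -> : - A * (P - lambda * Y ^+ 2) = - A * P + (A * lambda * 4) / 4 * Y ^+ 2 by field.
rewrite AE.
have -> : - A * P = - (a / 2 * (theta / 2 * P)) + (beta - a / 2) * (P / (2 * theta)).
  by rewrite /A; field; rewrite gt_eqF.
move: e0 e1 e2 e3 e4; rewrite betaE; move: (P / (2 * theta)) K {hK K0 AE} => Q K.
by move=> *; lra.
Qed.

(** * Bregman distances *)

Lemma is_derive_le0 (R : realType) (g dg : R -> R) :
  (forall s : R, is_derive s 1 g (dg s)) -> (forall s, 0 <= s <= 1 -> dg s <= 0) ->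
  forall s t, 0 <= s -> s <= t -> t <= 1 -> g t <= g s.
Proof.
move=> dgE dg0 s t s0 st t1.
have cg : {within `[s, t], continuous g}.
  apply: continuous_subspaceT => r; apply: differentiable_continuous.
  by apply/derivable1_diffP; have [] := dgE r.
have [r /[!in_itv]/= /andP[sr rt] E] := MVT_segment st (fun r _ => dgE r) cg.
rewrite -subr_le0 E mulr_le0_ge0 ?subr_ge0//; apply: dg0.
by rewrite (le_trans s0 sr) (le_trans rt t1).
Qed.

Lemma is_deriveB_fun (R : realType) (V : normedModType R) (f g : V -> R) (x v : V) (df dg : R) :
  is_derive x v f df -> is_derive x v g dg -> is_derive x v (fun s => f s - g s) (df - dg).
Proof. by move=> hf hg; exact: is_deriveB. Qed.

Lemma is_deriveN_fun (R : realType) (V : normedModType R) (f : V -> R) (x v : V) (df : R) :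
  is_derive x v f df -> is_derive x v (fun s => - f s) (- df).
Proof. by move=> hf; exact: is_deriveN. Qed.

(** In place of a remainder integral, quadratics with second derivative B are compared with f: [g1],
    [g2] and [g3] are nonincreasing on [0, 1]. The third bound is the expansion about 1, needed for
    Bregman distances with exchanged arguments. *)
Lemma taylor2_le (R : realType) (f f1 f2 : R -> R) (B : R) :
  (forall s : R, is_derive s 1 f (f1 s)) -> (forall s : R, is_derive s 1 f1 (f2 s)) ->
  (forall s, 0 <= s <= 1 -> f2 s <= B) ->
  [/\ f1 1 - f1 0 <= B, f 1 - f 0 - f1 0 <= B / 2 & f1 1 - (f 1 - f 0) <= B / 2].
Proof.
move=> df df1 f2B.
have dl (c s : R) : is_derive s 1 (fun r : R => c * r) c.
  by apply: is_derive_eq; rewrite /GRing.scale/=; ring.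
have dq (s : R) : is_derive s 1 (fun r : R => B / 2 * r ^+ 2) (B * s).
  by apply: is_derive_eq; rewrite /GRing.scale/=; field.
have g1 (s : R) := is_deriveB_fun (df1 s) (dl B s).
have g2 (s : R) := is_deriveB_fun (is_deriveB_fun (df s) (dl (f1 0) s)) (dq s).
have g3 (s : R) := is_deriveB_fun (is_deriveB_fun (dl (f1 1) s) (df s))
  (is_deriveB_fun (dl B s) (dq s)).
have h1 s t : 0 <= s -> s <= t -> t <= 1 -> f1 t - B * t <= f1 s - B * s.
  by apply: (is_derive_le0 g1) => r r01; rewrite subr_le0; exact: f2B.
have a1 : f1 1 - f1 0 <= B.
  by have := h1 0 1 (lexx _) ler01 (lexx _); rewrite mulr1 mulr0 subr0; lra.
have a2 : f 1 - f1 0 * 1 - B / 2 * 1 ^+ 2 <= f 0 - f1 0 * 0 - B / 2 * 0 ^+ 2.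
  apply: (is_derive_le0 g2) => // s /andP[s0 s1].
  by have := h1 0 s (lexx _) s0 s1; rewrite mulr0 subr0; lra.
have a3 : f1 1 * 1 - f 1 - (B * 1 - B / 2 * 1 ^+ 2) <= f1 1 * 0 - f 0 - (B * 0 - B / 2 * 0 ^+ 2).
  apply: (is_derive_le0 g3) => // s /andP[s0 s1].
  by have := h1 s 1 s0 s1 (lexx _); rewrite mulr1; lra.
split => //.
  by move: a2; rewrite expr1n expr0n /=; lra.
by move: a3; rewrite expr1n expr0n /=; lra.
Qed.

Lemma taylor2_ge (R : realType) (f f1 f2 : R -> R) (A : R) :
  (forall s : R, is_derive s 1 f (f1 s)) -> (forall s : R, is_derive s 1 f1 (f2 s)) ->
  (forall s, 0 <= s <= 1 -> A <= f2 s) ->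
  [/\ A <= f1 1 - f1 0, A / 2 <= f 1 - f 0 - f1 0 & A / 2 <= f1 1 - (f 1 - f 0)].
Proof.
move=> df df1 f2A.
have n1 (s : R) := is_deriveN_fun (df s).
have n2 (s : R) := is_deriveN_fun (df1 s).
have n3 s : 0 <= s <= 1 -> - f2 s <= - A by move=> s01; rewrite lerN2; exact: f2A.
by have [h1 h2 h3] := taylor2_le n1 n2 n3; split; lra.
Qed.

Lemma derive_dotv (R : realType) n (f : 'rV[R]_n -> R) (x v : 'rV[R]_n) :
  differentiable f x -> 'D_v f x = dotv (grad f x) v.
Proof.
move=> df; rewrite deriveE// {1}(row_sum_delta v) linear_sum /dotv.
apply: eq_bigr => i _; rewrite linearZ/= mxE /pd deriveE//.
by rewrite /GRing.scale/= mulrC.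
Qed.

Lemma Ck2_differentiable_pd (R : realType) n (U : set 'rV[R]_n) (f : 'rV[R]_n -> R) x v :
  Ck 2 U f -> U x -> differentiable ('D_v f) x.
Proof. by move=> [_ /(_ v) [h _]] Ux; exact: h. Qed.

Lemma derive2_hess (R : realType) n (f : 'rV[R]_n -> R) (x v : 'rV[R]_n) :
  Ck 2 setT f -> 'D_v ('D_v f) x = (v *m hess f x *m v^T) ord0 ord0.
Proof.
move=> Cf; have [df _] := Cf.
have -> : 'D_v f = \sum_(j < n) (v ord0 j *: (pd j f : 'rV[R]_n -> R)).
  apply/funext => y; rewrite derive_dotv; last exact: df.
  by rewrite fct_sumE; apply: eq_bigr => j _; rewrite mxE mulrC.
have ddj j : differentiable (pd j f) x by exact: (Ck2_differentiable_pd _ Cf).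
rewrite derive_sum; last by move=> j; apply: derivableZ; exact: diff_derivable.
rewrite mxE; apply: eq_bigr => j _.
rewrite deriveZ; last exact: diff_derivable.
rewrite derive_dotv// /GRing.scale/= !mxE mulrC; congr (_ * _).
by rewrite /dotv; apply: eq_bigr => i _; rewrite !mxE mulrC.
Qed.

Lemma psd_le_scalar (R : realType) n (H : 'M[R]_n) (c : R) (v : 'rV[R]_n) :
  (psd_le c%:M H -> c * sqn v <= (v *m H *m v^T) ord0 ord0) /\
  (psd_le H c%:M -> (v *m H *m v^T) ord0 ord0 <= c * sqn v).
Proof.
have E : (v *m c%:M *m v^T) ord0 ord0 = c * sqn v.
  rewrite mul_mx_scalar -scalemxAl mxE mxE /sqn /dotv; congr (_ * _).
  by apply: eq_bigr => i _; rewrite mxE.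
by split=> /(_ v); rewrite mulmxBr mulmxBl mxE [X in _ + X]mxE E subr_ge0.
Qed.

Definition bregman (R : realType) n (f : 'rV[R]_n -> R) (p q : 'rV[R]_n) : R :=
  f p - f q - dotv (grad f q) (p - q).

Lemma dotvBl (R : realType) n (p q v : 'rV[R]_n) : dotv (p - q) v = dotv p v - dotv q v.
Proof. by rewrite /dotv -sumrB; apply: eq_bigr => i _; rewrite !mxE mulrBl. Qed.

Lemma dotvC (R : realType) n (p q : 'rV[R]_n) : dotv p q = dotv q p.
Proof. by apply: eq_bigr => i _; rewrite mulrC. Qed.

(** Second-order expansion on the segment from q to p. The second bound concerns the Bregman
    distance with exchanged arguments, since the two orders add up to the symmetrized form. *)
Lemma bregman_bounds (R : realType) n (f : 'rV[R]_n -> R) (theta : R) (p q : 'rV[R]_n) :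
  0 < theta -> Ck 2 setT f ->
  (forall x, psd_le theta%:M (hess f x) /\ psd_le (hess f x) (theta^-1)%:M) ->
  [/\ theta / 2 * sqn (p - q) <= bregman f p q,
      theta / 2 * sqn (p - q) <= dotv (grad f p - grad f q) (p - q) - bregman f p q,
      bregman f p q <= sqn (p - q) / (2 * theta) &
      dotv (grad f p - grad f q) (p - q) <= sqn (p - q) / theta].
Proof.
move=> th0 Cf psd; have [df ddf] := Cf.
pose v := p - q.
have d1 (s : R) : is_derive s 1 (fun r : R => f (q + r *: v)) ('D_v f (q + s *: v)).
  by apply: is_derive_line; apply: diff_derivable; exact: df.
have d2 (s : R) : is_derive s 1 (fun r : R => 'D_v f (q + r *: v)) ('D_v ('D_v f) (q + s *: v)).
  by apply: is_derive_line; apply: diff_derivable; exact: (Ck2_differentiable_pd _ Cf).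
have lo s : 0 <= s <= 1 -> theta * sqn v <= 'D_v ('D_v f) (q + s *: v).
  by move=> _; rewrite derive2_hess//; apply: (psd_le_scalar _ _ _).1; have [] := psd (q + s *: v).
have hi s : 0 <= s <= 1 -> 'D_v ('D_v f) (q + s *: v) <= theta^-1 * sqn v.
  by move=> _; rewrite derive2_hess//; apply: (psd_le_scalar _ _ _).2; have [] := psd (q + s *: v).
have [l1 l2 l3] := taylor2_ge d1 d2 lo; have [h1 h2 h3] := taylor2_le d1 d2 hi.
have e0 : q + 0 *: v = q by rewrite scale0r addr0.
have e1 : q + 1 *: v = p by rewrite scale1r /v addrC subrK.
have E2 : theta^-1 * sqn v / 2 = sqn v / (2 * theta) by field; rewrite gt_eqF.
rewrite e0 e1 E2 !derive_dotv ?[_ * sqn v]mulrC in l1 l2 l3 h1 h2 h3; try exact: df.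
rewrite /bregman -/v dotvBl; clear - l1 l2 l3 h1 h2 h3; rewrite -/v.
move: l1 l2 l3 h1 h2 h3; move: (dotv _ _) (dotv _ _) (f p) (f q) (sqn v) (sqn v / _).
by move=> *; split; lra.
Qed.

(** By convexity the difference quotients at z along z + h (y - z), with 0 < h < 1, lie below the
    increment f y - f z; let h decrease to 0. *)
Lemma convex_tangent (R : realType) (f : R -> R) (z y : R) :
  @convex_function R R^o setT f -> derivable f z 1 ->
  0 <= f y - f z - derive1 f z * (y - z).
Proof.
move=> cf df; pose v := y - z.
have dl : is_derive (0 : R) 1 (fun s : R => f (z + s *: v)) (v * derive1 f z).
  have d1 : is_derive (0 : R) 1 (fun s : R => z + s *: v) v.
    by apply: is_derive_eq; rewrite /GRing.scale/=; ring.
  have d2 : is_derive (z + 0 *: v) 1 f (derive1 f z).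
    by rewrite scale0r addr0 derive1E; exact: derivableP.
  by apply: (is_derive_conv (@is_derive1_comp _ f (fun s : R => z + s *: v) 0 _ _ d2 d1)); rewrite mulrC.
suff : v * derive1 f z <= f y - f z by rewrite /v; lra.
have [dv <-] := dl.
have dvr : h^-1 *: (((fun s : R => f (z + s *: v)) \o shift 0) (h *: 1) - f (z + 0 *: v)) @[h --> 0^'+] -->
   'D_1 (fun s : R => f (z + s *: v)) 0 by apply: cvg_dnbhs_at_right; exact: dv.
apply: (cvgr_to_le dvr); near=> h.
have h0 : 0 < h by near: h; exact: nbhs_right_gt.
have h1 : h < 1 by near: h; exact: nbhs_right_lt.
have cvx : f (h * y + (1 - h) * z) <= h * f y + (1 - h) * f z.
  by apply: (cf (Itv01 (ltW h0) (ltW h1)) y z); rewrite inE.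
rewrite /= addr0 /GRing.scale/= mulr1 mul0r addr0 ler_pdivrMl// /v.
have -> : z + h * (y - z) = h * y + (1 - h) * z by ring.
by rewrite lerBlDr (le_trans cvx)//; lra.
Unshelve. all: by end_near. Qed.

(** The tangent inequalities at z and at y give the two lower bounds; expansion with second
    derivative at most [mu] gives the upper ones. *)
Lemma convex_bregman_bounds (R : realType) (f : R -> R) (mu z y : R) :
  @convex_function R R^o setT f -> (forall s, derivable f s 1) ->
  (forall s, derivable (derive1 f) s 1) -> (forall s, derive1n 2 f s <= mu) ->
  let D := f y - f z - derive1 f z * (y - z) in
  let M := (derive1 f y - derive1 f z) * (y - z) in
  [/\ 0 <= D, 0 <= M - D, D <= mu / 2 * (y - z) ^+ 2 & M <= mu * (y - z) ^+ 2].
Proof.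
move=> cf df ddf fmu D M; pose v := y - z.
have t1 := convex_tangent y cf (df z); have t2 := convex_tangent z cf (df y).
have d1 (s : R) : is_derive s 1 (fun r : R => f (z + r *: v)) (derive1 f (z + s *: v) * v).
  have d1 : is_derive s 1 (fun s : R => z + s *: v) v.
    by apply: is_derive_eq; rewrite /GRing.scale/=; ring.
  have d2 : is_derive (z + s *: v) 1 f (derive1 f (z + s *: v)).
    by rewrite derive1E; exact: derivableP.
  exact: (@is_derive1_comp _ f (fun s : R => z + s *: v) s _ _ d2 d1).
have d2 (s : R) : is_derive s 1 (fun r : R => derive1 f (z + r *: v) * v) (derive1n 2 f (z + s *: v) * v ^+ 2).
  have d1' : is_derive s 1 (fun s : R => z + s *: v) v.
    by apply: is_derive_eq; rewrite /GRing.scale/=; ring.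
  have d2 : is_derive (z + s *: v) 1 (derive1 f) (derive1n 2 f (z + s *: v)).
    by rewrite derive1nS derive1n1 derive1E; exact: derivableP.
  have d3 := @is_derive1_comp _ (derive1 f) (fun s : R => z + s *: v) s _ _ d2 d1'.
  have d4 := is_deriveM d3 (is_derive_cst v s 1).
  by apply: (is_derive_conv d4); rewrite /GRing.scale/=; ring.
have hi (s : R) : 0 <= s <= 1 -> derive1n 2 f (z + s *: v) * v ^+ 2 <= mu * v ^+ 2.
  by move=> _; rewrite ler_wpM2r ?sqr_ge0.
have [h1 h2 h3] := taylor2_le d1 d2 hi.
have e0 : z + 0 *: v = z by rewrite scale0r addr0.
have e1 : z + 1 *: v = y by rewrite scale1r /v addrC subrK.
rewrite e0 e1 in h1 h2 h3.
by rewrite /D /M -/v; split; [exact: t1|move: t2; rewrite /v; lra|lra|rewrite /v; move: h1; rewrite /v; lra].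
Qed.

(** * Chain rules and symmetry of second derivatives *)

(** L is the linear part of phi. The derivative of f o phi along w is (D_(L w) f) o phi, again of
    the same shape, which drives the induction. *)
Lemma Ck_affine (R : realType) (V V' : normedModType R) (phi : V' -> V) (L : V' -> V) k
    (U : set V) (f : V -> R) :
  (forall y, differentiable phi y) ->
  (forall (h : R) y w, phi (h *: w + y) = h *: L w + phi y) ->
  Ck k U f -> Ck k (phi @^-1` U) (fun y => f (phi y)).
Proof.
move=> dphi phiE; elim: k => [|k IH] in f *.
  move=> cf x Ux; apply: (@continuous_comp _ _ _ phi f); last exact: cf.
  exact: differentiable_continuous.
move=> [df cf]; split=> [x Ux|w].
  by apply: (@differentiable_comp _ _ _ _ phi f); [exact: dphi|exact: df].
have -> : 'D_w (fun y => f (phi y)) = (fun y => ('D_(L w) f) (phi y)).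
  by apply/funext => y; have [] := @derive_affine R V V' R f phi y w (L w) (fun h => phiE h y w).
by apply: (IH ('D_(L w) f)); exact: cf.
Qed.

Lemma Ck_le (R : realType) (V : normedModType R) (U W : set V) k (f : V -> R) :
  W `<=` U -> Ck k U f -> Ck k W f.
Proof.
move=> WU; elim: k => [|k IH] in f *; first by move=> cf x /WU; exact: cf.
by move=> [df cf]; split=> [x /WU|v]; [exact: df|apply: IH; exact: cf].
Qed.

Lemma CkS (R : realType) (V : normedModType R) (U : set V) k (f : V -> R) :
  Ck k.+1 U f -> Ck k U f.
Proof.
elim: k => [|k IH] in f *; first by move=> [df _] x Ux; apply: differentiable_continuous; exact: df.
by move=> [df cf]; split => // v; apply: IH; exact: cf.
Qed.

Lemma Ck_slice1 (R : realType) (V W : normedModType R) k (A : set V) (B : set W) (f : V * W -> R) (b : W) :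
  B b -> Ck k (A `*` B) f -> Ck k A (fun x => f (x, b)).
Proof.
move=> Bb cf; apply: (@Ck_le _ _ ((fun x => (x, b)) @^-1` (A `*` B))); first by move=> x Ax; split.
apply: (@Ck_affine _ _ _ (fun x => (x, b)) (fun v => (v, 0)) k (A `*` B) f) => [y|h y w|]; last by [].
  by apply: (@differentiable_pair R V V W (fun x => x) (fun=> b)); [exact: ex_diff|exact: differentiable_cst].
by rewrite /GRing.scale/= /GRing.add/=/add_pair/= scaler0 add0r.
Qed.

Lemma Ck_slice2 (R : realType) (V W : normedModType R) k (A : set V) (B : set W) (f : V * W -> R) (a : V) :
  A a -> Ck k (A `*` B) f -> Ck k B (fun x => f (a, x)).
Proof.
move=> Aa cf; apply: (@Ck_le _ _ ((fun x => (a, x)) @^-1` (A `*` B))); first by move=> x Bx; split.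
apply: (@Ck_affine _ _ _ (fun x => (a, x)) (fun v => (0, v)) k (A `*` B) f) => [y|h y w|]; last by [].
  by apply: (@differentiable_pair R W V W (fun=> a) (fun x => x)); [exact: differentiable_cst|exact: ex_diff].
by rewrite /GRing.scale/= /GRing.add/=/add_pair/= scaler0 add0r.
Qed.

Lemma derive_slice1 (R : realType) (V W : normedModType R) (f : V * W -> R) (a v : V) (b : W) :
  'D_v (fun x => f (x, b)) a = 'D_(v, 0) f (a, b).
Proof.
have [] // := @derive_affine R _ V R f (fun x => (x, b)) a v (v, 0).
by move=> h; rewrite /GRing.scale/= /GRing.add/=/add_pair/= scaler0 add0r.
Qed.

Lemma derive_slice2 (R : realType) (V W : normedModType R) (f : V * W -> R) (a : V) (b w : W) :
  'D_w (fun x => f (a, x)) b = 'D_(0, w) f (a, b).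
Proof.
have [] // := @derive_affine R _ W R f (fun x => (a, x)) b w (0, w).
by move=> h; rewrite /GRing.scale/= /GRing.add/=/add_pair/= scaler0 add0r.
Qed.

Lemma MVT_line (R : realType) (V : normedModType R) (f : V -> R) (x v : V) (h : R) :
  0 < h -> (forall s, 0 <= s <= h -> derivable f (x + s *: v) v) ->
  exists2 s, 0 < s < h & f (x + h *: v) - f x = h * 'D_v f (x + s *: v).
Proof.
move=> h0 df.
have dl s : 0 <= s <= h -> is_derive s 1 (fun r : R => f (x + r *: v)) ('D_v f (x + s *: v)).
  by move=> /df; exact: is_derive_line.
have [|s|s /[!in_itv]/= sh E] := @MVT _ (fun r : R => f (x + r *: v)) (fun s => 'D_v f (x + s *: v)) 0 h h0.
- by move=> s; rewrite in_itv/= => /andP[s0 sh]; apply: dl; rewrite !ltW.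
- apply: derivable_within_continuous => r; rewrite in_itv/= => rh.
  by have [] := dl r rh.
by exists s => //; move: E; rewrite scale0r addr0 subr0 mulrC.
Qed.

Lemma continuous_near_dist (R : realType) (V : normedModType R) (f : V -> R) (x : V) (e : R) :
  {for x, continuous f} -> 0 < e -> exists2 r : R, 0 < r & forall y, `|x - y| < r -> `|f x - f y| < e.
Proof.
move=> cf e0; have /cvgrPdist_lt/(_ _ e0) := cf.
by rewrite -nbhs_nearE => /nbhs_ballP[r /= r0 h]; exists r => // y xy; apply: h; rewrite -ball_normE.
Qed.

(* Both mixed derivatives are limits of the same second difference quotient. *)
Lemma schwarz (R : realType) (V : normedModType R) (U : set V) (f : V -> R) (x v w : V) :
  open U -> Ck 2 U f -> U x -> 'D_v ('D_w f) x = 'D_w ('D_v f) x.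
Proof.
move=> oU Cf Ux.
have [df ddf] := Cf.
(* Quantified over both directions, because it is applied to (v, w) and to (w, v), which share their
   second difference. *)
have mixed : forall (v w : V) (e : R), 0 < e -> exists2 r : R, 0 < r & forall h, 0 < h -> h < r ->
    `|(f (x + h *: v + h *: w) - f (x + h *: v) - (f (x + h *: w) - f x)) / h ^+ 2 - 'D_w ('D_v f) x| < e.
  move=> {}v {}w e e0.
  have [_ cD] := ddf v.
  have [r1 r10 hr1] := continuous_near_dist (cD w x Ux) e0.
  have /nbhs_ballP[r2 /= r20 hr2] : nbhs x U by exact: open_nbhs_nbhs.
  pose M := `|v| + `|w| + 1.
  have M0 : 0 < M by rewrite /M ltr_wpDl// addr_ge0.
  pose r := Num.min r1 r2 / M.
  have r0 : 0 < r by rewrite divr_gt0// lt_min r10.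
  exists r => // h h0 hr.
  have near_x s t : 0 <= s <= h -> 0 <= t <= h -> `|x - (x + s *: v + t *: w)| < Num.min r1 r2.
    move=> /andP[s0 sh] /andP[t0 th].
    rewrite -addrA opprD addrA subrr add0r normrN.
    have : `|s *: v + t *: w| <= h * M.
      rewrite (le_trans (ler_normD _ _))// !normrZ !ger0_norm// /M.
      by have := normr_ge0 v; have := normr_ge0 w; nra.
    move=> /le_lt_trans; apply; by rewrite -ltr_pdivlMr.
  have inU s t : 0 <= s <= h -> 0 <= t <= h -> U (x + s *: v + t *: w).
    move=> sh th; apply: hr2; rewrite -ball_normE /=.
    by rewrite (lt_le_trans (near_x s t sh th))// ge_min lexx orbT.
  have h0h : 0 <= h <= h by rewrite lexx ltW.
  have h00 : 0 <= (0 : R) <= h by rewrite lexx ltW.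
  have dg s : 0 <= s <= h -> is_derive s 1 (fun s => f (x + h *: w + s *: v) - f (x + s *: v))
      ('D_v f (x + h *: w + s *: v) - 'D_v f (x + s *: v)).
    move=> sh; apply: is_deriveB; apply: is_derive_line; apply: diff_derivable; apply: df.
      by rewrite addrAC; exact: inU.
    by have := inU s 0 sh h00; rewrite scale0r addr0.
  have [|s|s /[!in_itv]/= /andP[s0 sh] E] := @MVT _ (fun s => f (x + h *: w + s *: v) - f (x + s *: v))
     (fun s => 'D_v f (x + h *: w + s *: v) - 'D_v f (x + s *: v)) 0 h h0.
  - by move=> s; rewrite in_itv/= => /andP[s0 sh]; apply: dg; rewrite !ltW.
  - apply: derivable_within_continuous => r'; rewrite in_itv/= => rh.
    by have [] := dg r' rh.
  have sh' : 0 <= s <= h by rewrite !ltW.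
  have [|t /andP[t0 th] E'] := @MVT_line _ _ ('D_v f) (x + s *: v) w h h0.
    move=> t th; have [dd _] := ddf v; apply: diff_derivable; apply: dd; exact: inU.
  have th' : 0 <= t <= h by rewrite !ltW.
  have -> : (f (x + h *: v + h *: w) - f (x + h *: v) - (f (x + h *: w) - f x)) / h ^+ 2 =
      'D_w ('D_v f) (x + s *: v + t *: w).
    move: E; rewrite !scale0r !addr0 subr0 [x + h *: w + h *: v]addrAC [x + h *: w + s *: v]addrAC E'.
    by move=> ->; field; rewrite gt_eqF.
  by rewrite distrC; apply: hr1; rewrite (lt_le_trans (near_x s t sh' th'))// ge_min lexx.
apply/eqP; rewrite -subr_eq0 -normr_le0; apply/ler_addgt0Pr => e e0; rewrite add0r.
have e20 : 0 < e / 2 by rewrite divr_gt0.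
have [r1 r10 h1] := mixed v w _ e20; have [r2 r20 h2] := mixed w v _ e20.
pose h := Num.min r1 r2 / 2.
have m0 : 0 < Num.min r1 r2 by rewrite lt_min r10.
have h0 : 0 < h by rewrite divr_gt0.
have hm : h < Num.min r1 r2 by rewrite /h ltr_pdivrMr// mulr_natr mulr2n ltrDl.
have hr1 : h < r1 by rewrite (lt_le_trans hm)// ge_min lexx.
have hr2 : h < r2 by rewrite (lt_le_trans hm)// ge_min lexx orbT.
have := h1 h h0 hr1; have := h2 h h0 hr2.
have -> : f (x + h *: w + h *: v) - f (x + h *: w) - (f (x + h *: v) - f x) =
   f (x + h *: v + h *: w) - f (x + h *: v) - (f (x + h *: w) - f x).
  by rewrite [x + h *: w + h *: v]addrAC; ring.
move: (_ / h ^+ 2) ('D_v ('D_w f) x) ('D_w ('D_v f) x) => q A B.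
by rewrite !ltr_norml => /andP[a1 a2] /andP[b1 b2]; rewrite ler_norml; apply/andP; split; lra.
Qed.

Lemma differentiable_rV (R : realType) (V : normedModType R) n (G : V -> 'rV[R]_n) (x : V) :
  (forall i, differentiable (fun y => G y ord0 i) x) -> differentiable G x.
Proof.
move=> dG; have -> : G = \sum_(i < n) (fun y => G y ord0 i *: (delta_mx ord0 i : 'rV[R]_n)).
  by apply/funext => y; rewrite fct_sumE [LHS]row_sum_delta.
by apply: differentiable_sum => i; apply: differentiableZl.
Qed.

Lemma derive_rV (R : realType) (V : normedModType R) n (G : V -> 'rV[R]_n) (x v : V) :
  (forall i, differentiable (fun y => G y ord0 i) x) ->
  'D_v G x = \row_i 'D_v (fun y => G y ord0 i) x.
Proof.
move=> dG; rewrite derive_mx; last by apply: diff_derivable; exact: differentiable_rV.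
by apply/matrixP => a i; rewrite !mxE; have -> : a = ord0 by exact: ord1.
Qed.

Lemma derive_comp (R : realType) (V W : normedModType R) (phi : V -> W) (f : W -> R) (x v : V) :
  differentiable phi x -> differentiable f (phi x) ->
  'D_v (fun y => f (phi y)) x = 'D_('D_v phi x) f (phi x).
Proof.
move=> dphi df; rewrite deriveE; last exact: (@differentiable_comp _ _ _ _ phi f).
by rewrite (@diff_comp _ _ _ _ phi f)//= deriveE// deriveE.
Qed.

Lemma derive_graph (R : realType) n (g : 'rV[R]_n * 'rV[R]_n -> R) (G : 'rV[R]_n -> 'rV[R]_n)
    (y v : 'rV[R]_n) :
  (forall i, differentiable (fun y => G y ord0 i) y) -> differentiable g (y, G y) ->
  'D_v (fun y => g (y, G y)) y = 'D_(v, 0) g (y, G y) +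
    \sum_i 'D_v (fun y => G y ord0 i) y * 'D_(0, delta_mx ord0 i) g (y, G y).
Proof.
move=> dG dg; have dG' := differentiable_rV dG.
have dp : differentiable (fun y => (y, G y)) y by apply: differentiable_pair.
rewrite (@derive_comp _ _ _ (fun y => (y, G y)) g)//.
have -> : 'D_v (fun y => (y, G y)) y = (v, 'D_v G y).
  rewrite deriveE//; have := @diff_pair _ _ _ _ (fun y => y) G y => /(_ ex_diff dG') ->.
  congr pair; last by rewrite -deriveE.
  by rewrite -(@deriveE _ _ _ (fun y => y)); [exact: derive_id|exact: ex_diff].
rewrite derive_rV// deriveE//.
have -> : (v, \row_i 'D_v (fun y0 => G y0 ord0 i) y) =
  (v, 0) + \sum_i 'D_v (fun y => G y ord0 i) y *: ((0 : 'rV[R]_n), (delta_mx ord0 i : 'rV[R]_n)).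
  have -> : \sum_i 'D_v (fun y => G y ord0 i) y *: ((0 : 'rV[R]_n), (delta_mx ord0 i : 'rV[R]_n)) =
     (0, \row_i 'D_v (fun y0 => G y0 ord0 i) y).
    rewrite [X in (_, X)]row_sum_delta.
    apply: (big_ind2 (fun (p : 'rV[R]_n * 'rV[R]_n) q => p = (0, q))) => //.
      by move=> p q p' q' -> ->; rewrite /GRing.add/=/add_pair/= add0r.
    by move=> i _; rewrite mxE; apply: injective_projections => //=; exact: scaler0.
  by rewrite /GRing.add/=/add_pair/= addr0 add0r.
rewrite linearD linear_sum /= -deriveE//; congr (_ + _); apply: eq_bigr => i _.
by rewrite linearZ/= -deriveE.
Qed.

Lemma cvg_sumr (R : realType) (T I : Type) (F : set_system T) (FF : Filter F) (r : seq I)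
    (f : I -> T -> R) (l : I -> R) :
  (forall i, f i z @[z --> F] --> l i) -> \sum_(i <- r) f i z @[z --> F] --> \sum_(i <- r) l i.
Proof.
move=> fl; elim: r => [|i r IH].
  by under eq_fun do rewrite big_nil; rewrite big_nil; exact: cvg_cst.
by under eq_fun do rewrite big_cons; rewrite big_cons; apply: cvgD.
Qed.

(** For the flux y -> grad_p Phi(y, grad z(y)) with z of class C^2, where y enters twice. The
    formula of [derive_graph] is continuous term by term. *)
Lemma Ck1_graph (R : realType) n (Om : set 'rV[R]_n) (g : 'rV[R]_n * 'rV[R]_n -> R)
    (G : 'rV[R]_n -> 'rV[R]_n) :
  open Om -> Ck 1 (Om `*` setT) g -> (forall i, Ck 1 Om (fun y => G y ord0 i)) ->
  Ck 1 Om (fun y => g (y, G y)).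
Proof.
move=> oO [dg cg] cG.
have dGi y i : Om y -> differentiable (fun y => G y ord0 i) y by move=> Oy; have [h _] := cG i; exact: h.
have dG y : Om y -> differentiable (fun y => (y, G y)) y.
  by move=> Oy; apply: differentiable_pair => //; apply: differentiable_rV => i; exact: dGi.
split=> [y Oy|v y Oy].
  by apply: (@differentiable_comp _ _ _ _ (fun y => (y, G y)) g); [exact: dG|exact: dg].
have DE : \forall z \near y, 'D_(v, 0) g (z, G z) +
    \sum_i 'D_v (fun y => G y ord0 i) z * 'D_(0, delta_mx ord0 i) g (z, G z) =
    'D_v (fun y => g (y, G y)) z.
  have : \forall z \near y, Om z by exact: open_nbhs_nbhs.
  by apply: filterS => z Oz; rewrite derive_graph// => [i|]; [exact: dGi|exact: dg].
have cc (w : 'rV[R]_n * 'rV[R]_n) : 'D_w g (z, G z) @[z --> y] --> 'D_w g (y, G y).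
  apply: (@continuous_comp _ _ _ (fun z => (z, G z)) ('D_w g)).
    by apply: differentiable_continuous; exact: dG.
  exact: cg.
rewrite /prop_for /continuous_at -(nbhs_singleton DE).
apply: (@cvg_trans _ ((fun z => 'D_(v, 0) g (z, G z) +
    \sum_i 'D_v (fun y => G y ord0 i) z * 'D_(0, delta_mx ord0 i) g (z, G z)) @ y)).
  exact: (near_eq_cvg DE).
have c2 : (fun z => \sum_i 'D_v (fun y => G y ord0 i) z * 'D_(0, delta_mx ord0 i) g (z, G z)) @ y -->
    \sum_i 'D_v (fun y => G y ord0 i) y * 'D_(0, delta_mx ord0 i) g (y, G y).
  apply: (cvg_sumr (nbhs_filter y)) => i.
  by apply: cvgM; [have [_ h] := cG i; exact: h|exact: cc].
exact: cvgD (cc (v, 0)) c2.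
Qed.

Lemma is_derive_curve (R : realType) n (f : 'rV[R]_n -> R) (G : R -> 'rV[R]_n) (t : R) :
  (forall i, derivable (fun s => G s ord0 i) t 1) -> differentiable f (G t) ->
  is_derive t 1 (fun s => f (G s)) (dotv (grad f (G t)) (\row_i 'D_1 (fun s => G s ord0 i) t)).
Proof.
move=> dGi df; have dG i : differentiable (fun s => G s ord0 i) t by apply/derivable1_diffP.
have dG' := differentiable_rV dG.
split; first by apply/derivable1_diffP; exact: (@differentiable_comp _ _ _ _ G f).
by rewrite (@derive_comp _ _ _ G f)// derive_rV// derive_dotv.
Qed.

(** * Compactness of the closed domain and of bounded space-time cylinders *)

Lemma compact_closure_bounded (R : realType) n (Om : set 'rV[R]_n) :
  bounded_set Om -> compact (closure Om).
Proof.
move=> [M [_ hM]]; have M1 : M < `|M| + 1 by rewrite ltr_pwDr// ler_norm.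
have sub : closure Om `<=` [set x : 'rV[R]_n | `|x| <= `|M| + 1].
  have cl : closed [set x : 'rV[R]_n | `|x| <= `|M| + 1].
    apply: (@preimage_closed _ _ (fun x : 'rV[R]_n => `|x|) [set y | y <= `|M| + 1]); last exact: closed_le.
    by move=> x _; exact: norm_continuous.
  by rewrite closureE; apply: smallest_sub => // x Ox; exact: hM.
apply: bounded_closed_compact; last exact: closed_closure.
exists (`|M| + 1); split; [exact: num_real|move=> x Mx y /sub yM].
exact: le_trans yM (ltW Mx).
Qed.

Lemma closure_cylinder (R : realType) (V : normedModType R) (Om : set V) (x : V) (t : R) :
  closure Om x -> 0 <= t -> closure (Om `*` [set s : R | 0 < s]) (x, t).
Proof.
move=> Ox t0 B /nbhs_ballP[e /= e0 eB].
have [y [Oy xy]] := Ox _ (nbhsx_ballx x e e0).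
exists (y, t + e / 2); split; first by split => //=; rewrite ltr_wpDl// divr_gt0.
apply: eB; split => //=.
rewrite -ball_normE /= opprD addrA subrr add0r normrN gtr0_norm ?divr_gt0//.
by rewrite ltr_pdivrMr// mulr_natr mulr2n ltrDl.
Qed.

Lemma bounded_cylinder (R : realType) n (Om : set 'rV[R]_n) (F : 'rV[R]_n * R -> R) (T : R) :
  bounded_set Om -> {within closure (Om `*` [set t : R | 0 < t]), continuous F} ->
  exists M, forall x t, closure Om x -> 0 <= t <= T -> `|F (x, t)| <= M.
Proof.
move=> bO cF; pose K := closure Om `*` `[0, T]%classic.
have cK : compact K by apply: compact_setX; [exact: compact_closure_bounded|exact: segment_compact].
have KQ : K `<=` closure (Om `*` [set t : R | 0 < t]).
  by move=> [x t] [/= Ox]; rewrite in_itv/= => /andP[t0 _]; exact: closure_cylinder.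
have /compact_bounded[M [_ hM]] : compact (F @` K).
  by apply: continuous_compact => //; exact: continuous_subspaceW KQ cF.
have M1 : M < `|M| + 1 by rewrite ltr_pwDr// ler_norm.
exists (`|M| + 1) => x t Ox t01; apply: (hM _ M1); exists (x, t) => //.
Qed.

Lemma within_continuous_dist (R : realType) (V : normedModType R) (A : set V) (F : V -> R) (x : V) (e : R) :
  {within A, continuous F} -> A x -> 0 < e ->
  exists2 r : R, 0 < r & forall y, A y -> `|x - y| < r -> `|F x - F y| < e.
Proof.
move=> /subspace_continuousP cF Ax e0.
have /cvgrPdist_lt/(_ _ e0) := cF x Ax.
rewrite near_withinE -nbhs_nearE => /nbhs_ballP[r /= r0 h].
by exists r => // y Ay xy; apply: h => //; rewrite -ball_normE.
Qed.

(** As h is 0 on the boundary, the set where |v| >= e is also the set where |h| >= e in the compact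
    closure, and there it is closed. *)
Lemma vanishing_closure (R : realType) n (Om : set 'rV[R]_n) (v h : 'rV[R]_n -> R) :
  open Om -> bounded_set Om -> {within closure Om, continuous h} ->
  (forall x, Om x -> v x = h x) -> (forall x, bdry Om x -> h x = 0) -> vanishing Om v.
Proof.
move=> oO bO ch vh h0 e e0.
have cO := compact_closure_bounded bO.
have -> : [set x | Om x /\ e <= `|v x|] = [set x | closure Om x /\ e <= `|h x|].
  apply/seteqP; split => x /= [Ox ex].
    by split; [exact: subset_closure|rewrite -vh].
  have [Ox'|Ox'] := pselect (Om x); first by rewrite vh.
  move: ex; rewrite h0 ?normr0 ?leNgt ?e0//; split => //.
  by move: oO; rewrite openE => oO /interior_subset.
apply: (subclosed_compact _ cO) => [|x []//].
move=> x clx; have Ox : closure Om x.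
  have : closure (closure Om) x by apply: closureS clx => y [].
  by rewrite -(closure_id _).1//; exact: closed_closure.
split => //; rewrite leNgt; apply/negP => hx.
have ex : 0 < e - `|h x| by rewrite subr_gt0.
have [r r0 hr] := within_continuous_dist ch Ox ex.
have [y [[Oy ey] xy]] := clx _ (nbhsx_ballx x r r0).
have := hr y Oy; rewrite -ball_normE /= in xy => /(_ xy).
have := ler_normB (h x) (h x - h y); rewrite opprB addrC subrK.
by move: ey; lra.
Qed.

Record energy_data (R : realType) n (Om : set 'rV[R]_n) (Phi : 'rV[R]_n -> 'rV[R]_n -> R)
    (Psi : 'rV[R]_n -> R -> R) (theta mu : R) : Prop := EnergyData {
  dom_open : open Om;
  dom_bounded : bounded_set Om;
  Phi_C2 : Ck 2 (Om `*` setT) (fun q : 'rV[R]_n * 'rV[R]_n => Phi q.1 q.2);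
  Psi_C2 : Ck 2 (Om `*` setT) (fun q : 'rV[R]_n * R => Psi q.1 q.2);
  Psi_convex : forall x, Om x -> @convex_function R R^o setT (Psi x);
  theta_gt0 : 0 < theta;
  Phi_hess : forall x p, Om x ->
    psd_le theta%:M (hess (Phi x) p) /\ psd_le (hess (Phi x) p) (theta^-1)%:M;
  Psi_zz : forall x z, Om x -> derive1n 2 (Psi x) z <= mu }.

(** * Estimates at a fixed time *)

Definition flux (R : realType) n (Phi : 'rV[R]_n -> 'rV[R]_n -> R) (z : 'rV[R]_n -> R)
  (y : 'rV[R]_n) : 'rV[R]_n := grad (Phi y) (grad z y).

Definition bregman1 (R : realType) (f : R -> R) (y z : R) : R :=
  f y - f z - derive1 f z * (y - z).

Lemma Ck1_B (R : realType) (V : normedModType R) (U : set V) (f g : V -> R) :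
  open U -> Ck 1 U f -> Ck 1 U g -> Ck 1 U (fun x => f x - g x).
Proof.
move=> oU cf cg; have [df cdf] := cf; have [dg cdg] := cg.
split=> [x Ux|v x Ux]; first by apply: differentiableB; [exact: df|exact: dg].
have DE : \forall y \near x, 'D_v f y - 'D_v g y = 'D_v (fun x => f x - g x) y.
  have : \forall y \near x, U y by exact: open_nbhs_nbhs.
  apply: filterS => y Uy.
  by have := @deriveB _ _ _ f g y v (Ck1_derivable cf y v Uy) (Ck1_derivable cg y v Uy) => ->.
rewrite /prop_for /continuous_at -(nbhs_singleton DE).
apply: (@cvg_trans _ (((fun y => 'D_v f y - 'D_v g y) y) @[y --> x])).
  exact: near_eq_cvg.
by apply: cvgB; [exact: cdf|exact: cdg].
Qed.

Lemma pd_B (R : realType) n (U : set 'rV[R]_n) (f g : 'rV[R]_n -> R) i x :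
  Ck 1 U f -> Ck 1 U g -> U x -> pd i (fun x => f x - g x) x = pd i f x - pd i g x.
Proof.
move=> cf cg Ux.
exact: (@deriveB _ _ _ f g x _ (Ck1_derivable cf x _ Ux) (Ck1_derivable cg x _ Ux)).
Qed.

Lemma grad_B (R : realType) n (U : set 'rV[R]_n) (f g : 'rV[R]_n -> R) x :
  Ck 1 U f -> Ck 1 U g -> U x -> grad (fun x => f x - g x) x = grad f x - grad g x.
Proof. by move=> cf cg Ux; apply/rowP => i; rewrite !mxE (pd_B i cf cg Ux). Qed.

Lemma flux_Ck1 (R : realType) n (Om : set 'rV[R]_n) Phi Psi (theta mu : R) (z : 'rV[R]_n -> R) i :
  energy_data Om Phi Psi theta mu -> Ck 2 Om z -> Ck 1 Om (fun y => flux Phi z y ord0 i).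
Proof.
move=> S cz; have oO := dom_open S.
have -> : (fun y => flux Phi z y ord0 i) =
  (fun y => ('D_(0, delta_mx ord0 i) (fun q : 'rV[R]_n * 'rV[R]_n => Phi q.1 q.2)) (y, grad z y)).
  apply/funext => y; rewrite /flux mxE /pd.
  by rewrite -(derive_slice2 (fun q : 'rV[R]_n * 'rV[R]_n => Phi q.1 q.2) y (grad z y) (delta_mx ord0 i)).
apply: (@Ck1_graph _ _ Om ('D_(0, delta_mx ord0 i) (fun q : 'rV[R]_n * 'rV[R]_n => Phi q.1 q.2)) (grad z) oO).
  by have [_ h] := Phi_C2 S; exact: h.
move=> j; rewrite (_ : (fun y => grad z y ord0 j) = pd j z); last by apply/funext => y; rewrite mxE.
by have [_ h] := cz; exact: h.
Qed.

Lemma Phi_grad_Ck1 (R : realType) n (Om : set 'rV[R]_n) Phi Psi (theta mu : R) (z : 'rV[R]_n -> R) :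
  energy_data Om Phi Psi theta mu -> Ck 2 Om z -> Ck 1 Om (fun y => Phi y (grad z y)).
Proof.
move=> S cz; have oO := dom_open S.
apply: (@Ck1_graph _ _ _ (fun q : 'rV[R]_n * 'rV[R]_n => Phi q.1 q.2)) => //.
  by apply: CkS; exact: Phi_C2 S.
move=> j; rewrite (_ : (fun y => grad z y ord0 j) = pd j z); last by apply/funext => y; rewrite mxE.
by have [_ h] := cz; exact: h.
Qed.

Lemma Phi_slice (R : realType) n (Om : set 'rV[R]_n) Phi Psi (theta mu : R) x :
  energy_data Om Phi Psi theta mu -> Om x -> Ck 2 setT (Phi x).
Proof. by move=> S Ox; exact: (Ck_slice2 Ox (Phi_C2 S)). Qed.

Lemma Psi_slice (R : realType) n (Om : set 'rV[R]_n) Phi Psi (theta mu : R) x :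
  energy_data Om Phi Psi theta mu -> Om x ->
  (forall s, derivable (Psi x) s 1) /\ (forall s, derivable (derive1 (Psi x)) s 1).
Proof.
move=> S Ox; have [d1 d2] : Ck 2 setT (Psi x : R -> R) by exact: (Ck_slice2 Ox (Psi_C2 S)).
split=> s; first by apply: diff_derivable; exact: d1.
rewrite (_ : derive1 (Psi x) = 'D_1 (Psi x)); last by apply/funext => r; rewrite derive1E.
by have [h _] := d2 1; apply: diff_derivable; exact: h.
Qed.

Lemma Psi_continuous (R : realType) n (Om : set 'rV[R]_n) Phi Psi (theta mu : R)
    (z : 'rV[R]_n -> R) x :
  energy_data Om Phi Psi theta mu -> Ck 1 Om z -> Om x ->
  {for x, continuous (fun y => Psi y (z y))} /\
  {for x, continuous (fun y => derive1 (Psi y) (z y))}.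
Proof.
move=> S cz Ox; have cp : {for x, continuous (fun y => (y, z y))}.
  apply: differentiable_continuous; apply: (@differentiable_pair _ _ _ _ (fun y => y) z).
    exact: ex_diff.
  by have [h _] := cz; exact: h.
split.
  apply: (@continuous_comp _ _ _ (fun y => (y, z y)) (fun q : 'rV[R]_n * R => Psi q.1 q.2)) => //.
  by apply: (Ck1_continuous (CkS (Psi_C2 S))); split.
have -> : (fun y => derive1 (Psi y) (z y)) =
  (fun y => ('D_(0, 1) (fun q : 'rV[R]_n * R => Psi q.1 q.2)) (y, z y)).
  apply/funext => y; rewrite derive1E.
  by rewrite -(derive_slice2 (fun q : 'rV[R]_n * R => Psi q.1 q.2) y (z y) (1 : R)).
apply: (@continuous_comp _ _ _ (fun y => (y, z y)) ('D_(0, 1) (fun q : 'rV[R]_n * R => Psi q.1 q.2))) => //.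
by have [_ h] := Psi_C2 S; apply: (Ck1_continuous (h (0, 1))); split.
Qed.

Lemma Phi_bounds (R : realType) n (Om : set 'rV[R]_n) Phi Psi (theta mu : R) x p q :
  energy_data Om Phi Psi theta mu -> Om x ->
  [/\ theta / 2 * sqn (p - q) <= bregman (Phi x) p q,
      theta / 2 * sqn (p - q) <= dotv (grad (Phi x) p - grad (Phi x) q) (p - q) - bregman (Phi x) p q,
      bregman (Phi x) p q <= sqn (p - q) / (2 * theta) &
      dotv (grad (Phi x) p - grad (Phi x) q) (p - q) <= sqn (p - q) / theta].
Proof.
move=> S Ox; apply: bregman_bounds; [exact: theta_gt0 S|exact: Phi_slice S Ox|].
by move=> y; exact: (Phi_hess S).
Qed.

Lemma Psi_bounds (R : realType) n (Om : set 'rV[R]_n) Phi Psi (theta mu : R) x y z :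
  energy_data Om Phi Psi theta mu -> Om x ->
  [/\ 0 <= bregman1 (Psi x) y z,
      0 <= (derive1 (Psi x) y - derive1 (Psi x) z) * (y - z) - bregman1 (Psi x) y z,
      bregman1 (Psi x) y z <= mu / 2 * (y - z) ^+ 2 &
      (derive1 (Psi x) y - derive1 (Psi x) z) * (y - z) <= mu * (y - z) ^+ 2].
Proof.
move=> S Ox; have [d1 d2] := Psi_slice S Ox.
exact: (@convex_bregman_bounds R (Psi x) mu z y (Psi_convex S Ox) d1 d2 (fun s => Psi_zz S s Ox)).
Qed.

Lemma sqn_le (R : realType) n (p : 'rV[R]_n) (M : R) :
  (forall i, `|p ord0 i| <= M) -> sqn p <= n%:R * M ^+ 2.
Proof.
move=> pM; rewrite /sqn /dotv.
rewrite (_ : n%:R * M ^+ 2 = \sum_(i < n) M ^+ 2); last by rewrite sumr_const card_ord mulr_natl.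
apply: ler_sum => i _; rewrite -expr2 -real_normK ?num_real// lerXn2r ?nnegrE//.
exact: le_trans (pM i).
Qed.

(** What the fixed-time estimates require of z = u(., t) for t > 0. The bounds on w and grad w make
    all Bregman terms bounded, while Phi and Psi along z are merely integrable. *)
Record admissible (R : realType) n (Om : set 'rV[R]_n) (Phi : 'rV[R]_n -> 'rV[R]_n -> R)
    (Psi : 'rV[R]_n -> R -> R) (ustar z : 'rV[R]_n -> R) (M : R) : Prop := Admissible {
  adm_C2 : Ck 2 Om z;
  adm_energy : finite_energy Om Phi Psi z;
  adm_vanishing : vanishing Om (fun x => z x - ustar x);
  adm_bound : forall x, Om x -> `|z x - ustar x| <= M;
  adm_pd_bound : forall x i, Om x -> `|pd i z x - pd i ustar x| <= M }.

Section Static.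
Variables (R : realType) (n : nat) (Om : set 'rV[R]_n) (Phi : 'rV[R]_n -> 'rV[R]_n -> R).
Variables (Psi : 'rV[R]_n -> R -> R) (ustar : 'rV[R]_n -> R) (theta mu : R).
Hypothesis S : energy_data Om Phi Psi theta mu.
Hypothesis cs : Ck 2 Om ustar.
Hypothesis fes : finite_energy Om Phi Psi ustar.
Hypothesis steady : forall x, Om x -> gradE Phi Psi ustar x = 0.
Local Notation leb := (lebesgue_rV n).
Let oO := dom_open S.
Let mO : measurable Om := open_measurable_rV oO.

Definition D1 z x := bregman (Phi x) (grad z x) (grad ustar x).
Definition D2 z x := bregman1 (Psi x) (z x) (ustar x).
Definition M1 z x :=
  dotv (flux Phi z x - flux Phi ustar x) (grad z x - grad ustar x).
Definition M2 (z : 'rV[R]_n -> R) x :=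
  (derive1 (Psi x) (z x) - derive1 (Psi x) (ustar x)) * (z x - ustar x).

Lemma measurable_static z : Ck 2 Om z ->
  [/\ measurable_fun Om z, forall i, measurable_fun Om (pd i z),
   forall i, measurable_fun Om (fun x => flux Phi z x ord0 i),
   measurable_fun Om (fun x => Phi x (grad z x)) &
   measurable_fun Om (fun x => Psi x (z x)) /\ measurable_fun Om (fun x => derive1 (Psi x) (z x))].
Proof.
move=> cz; have cz1 := CkS cz; have [mz mDz] := measurable_Ck1 oO cz1.
split => //.
- by move=> i; have [] := measurable_Ck1 oO (flux_Ck1 i S cz).
- by have [] := measurable_Ck1 oO (Phi_grad_Ck1 S cz).
split; apply: continuous_measurable_rV => // x Ox; by have [] := Psi_continuous S cz1 Ox.
Qed.

Lemma measurable_breg z : Ck 2 Om z ->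
  [/\ measurable_fun Om (D1 z), measurable_fun Om (D2 z),
   measurable_fun Om (M1 z), measurable_fun Om (M2 z) &
   measurable_fun Om (fun x => sqn (grad z x - grad ustar x))].
Proof.
move=> cz; have [mz mDz mFz mPz [mSz mdSz]] := measurable_static cz.
have [ms mDs mFs mPs [mSs mdSs]] := measurable_static cs.
have md i : measurable_fun Om (fun x => (grad z x - grad ustar x) ord0 i).
  rewrite (_ : (fun x => _) = (fun x => pd i z x - pd i ustar x)); last first.
    by apply/funext => x; rewrite !mxE.
  exact: measurable_funB (mDz i) (mDs i).
have mf i : measurable_fun Om (fun x => (flux Phi z x - flux Phi ustar x) ord0 i).
  rewrite (_ : (fun x => _) = (fun x => flux Phi z x ord0 i - flux Phi ustar x ord0 i)); last first.
    by apply/funext => x; rewrite mxE [X in _ + X]mxE.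
  exact: measurable_funB (mFz i) (mFs i).
split.
- exact: (measurable_funB (measurable_funB mPz mPs) (measurable_dotv mFs md)).
- exact: (measurable_funB (measurable_funB mSz mSs) (measurable_funM mdSs (measurable_funB mz ms))).
- exact: (measurable_dotv mf md).
- exact: (measurable_funM (measurable_funB mdSz mdSs) (measurable_funB mz ms)).
- exact: (measurable_dotv md md).
Qed.

End Static.

(** Integrability is asked of f and g as rewritten by the caller: the equation supplies for the
    divergence an expression that is known to be integrable, whereas second derivatives near the
    boundary are not under control. *)
Lemma integral_by_parts0 (R : realType) n (Om : set 'rV[R]_n)
    (v : 'rV[R]_n -> R) (F : 'rV[R]_n -> 'rV[R]_n) (f g : 'rV[R]_n -> R) :
  open Om -> Ck 1 Om v -> vanishing Om v -> (forall i, Ck 1 Om (fun x => F x ord0 i)) ->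
  (forall x, Om x -> f x = v x * div F x) -> (forall x, Om x -> g x = dotv (grad v x) (F x)) ->
  (lebesgue_rV n).-integrable Om (EFin \o f) -> (lebesgue_rV n).-integrable Om (EFin \o g) ->
  \int[lebesgue_rV n]_(x in Om) (f x + g x) = 0.
Proof.
move=> oO cv vv cF fE gE if_ ig; have mO := open_measurable_rV oO.
have i1 : (lebesgue_rV n).-integrable Om (EFin \o (fun x => v x * div F x)).
  by apply: eq_integrable if_ => // x /set_mem Ox; rewrite /= fE.
have i2 : (lebesgue_rV n).-integrable Om (EFin \o (fun x => dotv (grad v x) (F x))).
  by apply: eq_integrable ig => // x /set_mem Ox; rewrite /= gE.
rewrite RintegralD// (@eq_Rintegral _ _ _ _ _ (fun x => v x * div F x) f); last first.
  by move=> x /set_mem Ox; rewrite fE.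
rewrite (@eq_Rintegral _ _ _ _ _ (fun x => dotv (grad v x) (F x)) g); last first.
  by move=> x /set_mem Ox; rewrite gE.
by rewrite integral_by_parts// addNr.
Qed.

Section Static.
Variables (R : realType) (n : nat) (Om : set 'rV[R]_n) (Phi : 'rV[R]_n -> 'rV[R]_n -> R).
Variables (Psi : 'rV[R]_n -> R -> R) (ustar : 'rV[R]_n -> R) (theta mu : R).
Hypothesis S : energy_data Om Phi Psi theta mu.
Hypothesis cs : Ck 2 Om ustar.
Hypothesis fes : finite_energy Om Phi Psi ustar.
Hypothesis steady : forall x, Om x -> gradE Phi Psi ustar x = 0.
Hypothesis mu0 : 0 < mu.
Local Notation leb := (lebesgue_rV n).
Let oO := dom_open S.
Let bO := dom_bounded S.
Let mO : measurable Om := open_measurable_rV oO.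
Let th0 := theta_gt0 S.

Lemma sqn_grad_le z M x : admissible Om Phi Psi ustar z M -> Om x ->
  sqn (grad z x - grad ustar x) <= n%:R * M ^+ 2.
Proof.
by move=> Az Ox; apply: sqn_le => i; rewrite !mxE; exact: adm_pd_bound Az _ _ Ox.
Qed.

Lemma sq_le z M x : admissible Om Phi Psi ustar z M -> Om x -> (z x - ustar x) ^+ 2 <= M ^+ 2.
Proof.
move=> Az Ox; have h := adm_bound Az Ox.
by rewrite -real_normK ?num_real// lerXn2r ?nnegrE// (le_trans _ h).
Qed.

(** The upper Bregman bounds turn the bounds on w and grad w into bounds on the integrands, and Om
    has finite measure. *)
Lemma integrable_breg z M : admissible Om Phi Psi ustar z M ->
  [/\ leb.-integrable Om (EFin \o D1 Phi ustar z), leb.-integrable Om (EFin \o D2 Psi ustar z),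
   leb.-integrable Om (EFin \o M1 Phi ustar z), leb.-integrable Om (EFin \o M2 Psi ustar z) &
   leb.-integrable Om (EFin \o (fun x => sqn (grad z x - grad ustar x))) /\
   leb.-integrable Om (EFin \o (fun x => (z x - ustar x) ^+ 2))].
Proof.
move=> Az; have cz := adm_C2 Az.
have [mD1 mD2 mM1 mM2 mg] := measurable_breg S cs cz.
have [mz _ _ _ _] := measurable_static S cz; have [ms _ _ _ _] := measurable_static S cs.
have gN := sqn_grad_le Az; have wN := sq_le Az.
split; [| | | |split].
- apply: (@integrable_bounded _ _ _ _ (n%:R * M ^+ 2 / (2 * theta)) oO bO mD1) => x Ox.
  have [h1 _ h3 _] := Phi_bounds (grad z x) (grad ustar x) S Ox.
  rewrite ger0_norm; last by apply: le_trans h1; rewrite mulr_ge0 ?sqn_ge0 ?divr_ge0// ltW.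
  by apply: le_trans h3 _; rewrite ler_wpM2r ?gN// invr_ge0 mulr_ge0// ltW.
- apply: (@integrable_bounded _ _ _ _ (mu / 2 * M ^+ 2) oO bO mD2) => x Ox.
  have [h1 _ h3 _] := Psi_bounds (z x) (ustar x) S Ox.
  rewrite ger0_norm//; apply: le_trans h3 _.
  by rewrite ler_wpM2l ?wN// divr_ge0// ltW.
- apply: (@integrable_bounded _ _ _ _ (n%:R * M ^+ 2 / theta) oO bO mM1) => x Ox.
  have [h1 h2 _ h4] := Phi_bounds (grad z x) (grad ustar x) S Ox.
  have h0 : 0 <= theta / 2 * sqn (grad z x - grad ustar x) by rewrite mulr_ge0 ?sqn_ge0 ?divr_ge0// ltW.
  rewrite ger0_norm; last by rewrite /M1 /flux; move: h0 h1 h2; lra.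
  by apply: le_trans h4 _; rewrite ler_wpM2r ?gN// invr_ge0 ltW.
- apply: (@integrable_bounded _ _ _ _ (mu * M ^+ 2) oO bO mM2) => x Ox.
  have [h1 h2 _ h4] := Psi_bounds (z x) (ustar x) S Ox.
  rewrite ger0_norm; last by rewrite /M2; move: h1 h2; lra.
  by apply: le_trans h4 _; rewrite ler_wpM2l ?wN// ltW.
- apply: (@integrable_bounded _ _ _ _ (n%:R * M ^+ 2) oO bO mg) => x Ox.
  by rewrite ger0_norm ?sqn_ge0// gN.
- apply: (@integrable_bounded _ _ _ _ (M ^+ 2) oO bO) => [|x Ox].
    by apply: measurable_funX; exact: measurable_funB mz ms.
  by rewrite ger0_norm ?sqr_ge0// wN.
Qed.

Lemma Ck1_diff z : Ck 2 Om z -> Ck 1 Om (fun x => z x - ustar x).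
Proof. by move=> cz; apply: Ck1_B => //; exact: CkS. Qed.

Lemma grad_diff z x : Ck 2 Om z -> Om x ->
  grad (fun x => z x - ustar x) x = grad z x - grad ustar x.
Proof. by move=> cz Ox; apply: grad_B Ox; exact: CkS. Qed.

Lemma div_flux_steady x : Om x -> div (flux Phi ustar) x = derive1 (Psi x) (ustar x).
Proof. by move=> Ox; have := steady Ox; rewrite /gradE => /eqP; rewrite subr_eq0 => /eqP <-. Qed.

(** The first-order parts of the energy difference, grad_p Phi(., grad ustar) . grad w and Psi_z(.,
    ustar) w, have total integral 0: this is the steady equation tested with w. *)
Lemma energy_bregman z M : admissible Om Phi Psi ustar z M ->
  \int[leb]_(x in Om) (Phi x (grad z x) + Psi x (z x)) -
  \int[leb]_(x in Om) (Phi x (grad ustar x) + Psi x (ustar x)) =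
  \int[leb]_(x in Om) (D1 Phi ustar z x + D2 Psi ustar z x).
Proof.
move=> Az; have cz := adm_C2 Az.
have [iD1 iD2 _ _ _] := integrable_breg Az.
have [iPz iSz] := adm_energy Az; have [iPs iSs] := fes.
(* Written as remainders, the first-order parts inherit integrability from finite energy and from D1
   and D2, not from any estimate of the flux. *)
pose A x := Phi x (grad z x) - Phi x (grad ustar x) - D1 Phi ustar z x.
pose B x := Psi x (z x) - Psi x (ustar x) - D2 Psi ustar z x.
have iA : leb.-integrable Om (EFin \o A).
  by apply: (integrableRB mO) => //; exact: (integrableRB mO).
have iB : leb.-integrable Om (EFin \o B).
  by apply: (integrableRB mO) => //; exact: (integrableRB mO).
have AB0 : \int[leb]_(x in Om) (B x + A x) = 0.
  apply: (@integral_by_parts0 _ _ _ (fun x => z x - ustar x) (flux Phi ustar)) => //.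
  - exact: Ck1_diff.
  - exact: adm_vanishing Az.
  - by move=> i; exact: flux_Ck1 S cs.
  - by move=> x Ox; rewrite div_flux_steady// /B /D2 /bregman1; ring.
  - by move=> x Ox; rewrite grad_diff// /A /D1 /bregman dotvC /flux; ring.
rewrite -RintegralB//; [|exact: (integrableRD mO)|exact: (integrableRD mO)].
rewrite -[RHS]addr0 -AB0 -RintegralD//; [|exact: (integrableRD mO)|exact: (integrableRD mO)].
by apply: eq_Rintegral => x _; rewrite /A /B; ring.
Qed.

Lemma poincare_static (lambda : R) z M : poincare_ineq Om lambda ->
  admissible Om Phi Psi ustar z M ->
  lambda * \int[leb]_(x in Om) ((z x - ustar x) ^+ 2) <=
  \int[leb]_(x in Om) (sqn (grad z x - grad ustar x)).
Proof.
move=> pO Az; have cz := adm_C2 Az; have [_ _ _ _ [ig iw]] := integrable_breg Az.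
have -> : \int[leb]_(x in Om) (sqn (grad z x - grad ustar x)) =
    \int[leb]_(x in Om) (sqn (grad (fun x => z x - ustar x) x)).
  by apply: eq_Rintegral => x /set_mem Ox; rewrite grad_diff.
apply: (poincare_vanishing oO bO pO (Ck1_diff cz) (adm_vanishing Az) iw).
by apply: eq_integrable ig => // x /set_mem Ox; rewrite /= grad_diff.
Qed.

Lemma div_flux z (a : R) (p q : 'rV[R]_n -> R) x :
  q x + a * p x = - gradE Phi Psi z x ->
  div (flux Phi z) x = q x + a * p x + derive1 (Psi x) (z x).
Proof. by rewrite /gradE => ->; rewrite opprB subrK. Qed.

Lemma div_fluxB z x : Ck 2 Om z -> Om x ->
  div (fun x => flux Phi z x - flux Phi ustar x) x = div (flux Phi z) x - div (flux Phi ustar) x.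
Proof.
move=> cz Ox; rewrite /div -sumrB; apply: eq_bigr => i _.
rewrite -(pd_B i (flux_Ck1 i S cz) (flux_Ck1 i S cs) Ox); congr (pd i _ x).
by apply/funext => y; rewrite mxE [X in _ + X]mxE.
Qed.

(** p and q stand for u_t and u_tt, so the first integrand is the time derivative of the Lyapunov
    density. Removing the equation tested with p ([E1]) and a / 2 times the difference of the two
    equations tested with w ([E2]) leaves an integrand to which [pointwise_decay] applies. *)
Lemma static_decay (lambda a A beta : R) z (p q : 'rV[R]_n -> R) M :
  poincare_ineq Om lambda -> 0 < a -> 0 <= A ->
  pointwise_decay theta mu a lambda A beta ->
  admissible Om Phi Psi ustar z M ->
  (forall x, Om x -> q x + a * p x = - gradE Phi Psi z x) ->
  Ck 1 Om p -> vanishing Om p -> (forall x, Om x -> `|p x| <= M) ->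
  leb.-integrable Om (EFin \o q) ->
  leb.-integrable Om (EFin \o (fun x => dotv (flux Phi z x) (grad p x))) ->
  leb.-integrable Om (EFin \o (fun x => derive1 (Psi x) (z x) * p x)) ->
  let J := \int[leb]_(x in Om) (p x ^+ 2 / 2 + (D1 Phi ustar z x + D2 Psi ustar z x) +
     a / 2 * (p x * (z x - ustar x)) + a ^+ 2 / 4 * (z x - ustar x) ^+ 2) in
  \int[leb]_(x in Om) (p x * q x + (dotv (flux Phi z x) (grad p x) + derive1 (Psi x) (z x) * p x) +
     a / 2 * (p x ^+ 2 + (z x - ustar x) * q x) + a ^+ 2 / 2 * ((z x - ustar x) * p x)) <=
  - beta * J /\
  theta / 2 * \int[leb]_(x in Om) (sqn (grad z x - grad ustar x)) <= J.
Proof.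
move=> pO a0 A0 rate Az pde cp vp pM iq iF iP J; have cz := adm_C2 Az.
have [iD1 iD2 iM1 iM2 [ig iw2]] := integrable_breg Az.
have [mz _ _ _ _] := measurable_static S cz; have [ms _ _ _ _] := measurable_static S cs.
have mw : measurable_fun Om (fun x => z x - ustar x) by exact: measurable_funB.
have [mp _] := measurable_Ck1 oO cp.
have mq : measurable_fun Om q by apply/measurable_EFinP; exact: measurable_int iq.
have pM2 x : Om x -> `|p x ^+ 2| <= M ^+ 2.
  by move=> Ox; rewrite normrX lerXn2r ?nnegrE ?pM// (le_trans _ (pM x Ox)).
have ip2 : leb.-integrable Om (EFin \o (fun x => p x ^+ 2)).
  by apply: (integrable_bounded oO bO _ pM2); exact: measurable_funX.
have iwp : leb.-integrable Om (EFin \o (fun x => (z x - ustar x) * p x)).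
  apply: (@integrable_bounded _ _ _ _ (M * M) oO bO) => [|x Ox]; first exact: measurable_funM.
  by rewrite normrM; apply: ler_pM => //; [exact: (adm_bound Az Ox)|exact: pM].
have inq : leb.-integrable Om (EFin \o (fun x => M * `|q x|)).
  by apply: (integrableRZ _ mO); exact: integrable_norm iq.
have ipq : leb.-integrable Om (EFin \o (fun x => p x * q x)).
  apply: (le_integrableR mO _ _ inq) => [|x Ox]; first exact: measurable_funM.
  by rewrite normrM ler_wpM2r// pM.
have iwq : leb.-integrable Om (EFin \o (fun x => (z x - ustar x) * q x)).
  apply: (le_integrableR mO _ _ inq) => [|x Ox]; first exact: measurable_funM.
  by rewrite normrM ler_wpM2r//; exact: (adm_bound Az Ox).
(* [f1] is p times the divergence of the flux, and [f2] is w times the difference of the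
   divergences, both with the divergences eliminated through the equations. *)
pose f1 x := p x * q x + a * p x ^+ 2 + derive1 (Psi x) (z x) * p x.
pose f2 x := (z x - ustar x) * q x + a * ((z x - ustar x) * p x) + M2 Psi ustar z x.
have if1 : leb.-integrable Om (EFin \o f1).
  by apply: (integrableRD mO) => //; apply: (integrableRD mO) => //; exact: (integrableRZ _ mO).
have if2 : leb.-integrable Om (EFin \o f2).
  by apply: (integrableRD mO) => //; apply: (integrableRD mO) => //; exact: (integrableRZ _ mO).
have E1 : \int[leb]_(x in Om) (f1 x + dotv (flux Phi z x) (grad p x)) = 0.
  apply: (@integral_by_parts0 _ _ _ p (flux Phi z) _ _ oO cp vp _ _ _ if1 iF).
  - by move=> i; exact: flux_Ck1 S cz.
  - by move=> x Ox; rewrite (div_flux (pde x Ox)) /f1; ring.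
  - by move=> x Ox; exact: dotvC.
have E2 : \int[leb]_(x in Om) (f2 x + M1 Phi ustar z x) = 0.
  apply: (@integral_by_parts0 _ _ _ (fun x => z x - ustar x)
    (fun x => flux Phi z x - flux Phi ustar x) _ _ oO (Ck1_diff cz) (adm_vanishing Az) _ _ _ if2 iM1).
  - move=> i; rewrite (_ : (fun x => _) = (fun x => flux Phi z x ord0 i - flux Phi ustar x ord0 i)).
      exact: (Ck1_B oO (flux_Ck1 i S cz) (flux_Ck1 i S cs)).
    by apply/funext => x; rewrite mxE [X in _ + X]mxE.
  - move=> x Ox; rewrite (div_fluxB cz Ox) (div_flux (pde x Ox)) (div_flux_steady Ox) /f2 /M2.
    by move: (derive1 _ _) (derive1 _ _) => ? ?; ring.
  - by move=> x Ox; rewrite (grad_diff cz Ox) /M1; exact: dotvC.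
pose j x := p x ^+ 2 / 2 + (D1 Phi ustar z x + D2 Psi ustar z x) +
     a / 2 * (p x * (z x - ustar x)) + a ^+ 2 / 4 * (z x - ustar x) ^+ 2.
have ij : leb.-integrable Om (EFin \o j).
  apply: (integrableRD mO); last exact: (integrableRZ _ mO).
  apply: (integrableRD mO); last first.
    by apply: (integrableRZ _ mO); apply: eq_integrable iwp => // x _; rewrite /= mulrC.
  apply: (integrableRD mO); last exact: (integrableRD mO).
  by apply: eq_integrable (integrableRZ 2^-1 mO ip2) => // x _; rewrite /= mulrC.
(* The derivative integrand equals tg + r, where r is the combination of [E1] and [E2] with integral
   0; the products w p and w q cancel in tg. *)
pose tg x := - (a / 2) * p x ^+ 2 - a / 2 * M1 Phi ustar z x - a / 2 * M2 Psi ustar z x.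
have itg : leb.-integrable Om (EFin \o tg).
  exact: (integrableRB mO (integrableRB mO (integrableRZ _ mO ip2) (integrableRZ _ mO iM1)) (integrableRZ _ mO iM2)).
pose r x := (f1 x + dotv (flux Phi z x) (grad p x)) + a / 2 * (f2 x + M1 Phi ustar z x).
have i1 : leb.-integrable Om (EFin \o (fun x => f1 x + dotv (flux Phi z x) (grad p x))) by exact: (integrableRD mO if1 iF).
have i2 : leb.-integrable Om (EFin \o (fun x => f2 x + M1 Phi ustar z x)) by exact: (integrableRD mO if2 iM1).
have i2' := integrableRZ (a / 2) mO i2.
have ir : leb.-integrable Om (EFin \o r) by exact: (integrableRD mO).
have r0 : \int[leb]_(x in Om) r x = 0.
  by rewrite RintegralD// E1 add0r RintegralZl// E2 mulr0.
have bnd x : Om x ->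
    [/\ 0 <= sqn (grad z x - grad ustar x),
    theta / 2 * sqn (grad z x - grad ustar x) <= D1 Phi ustar z x,
    0 <= D2 Psi ustar z x & tg x + beta * j x <=
      - A * (sqn (grad z x - grad ustar x) - lambda * (z x - ustar x) ^+ 2)].
  move=> Ox; have g0 := sqn_ge0 (grad z x - grad ustar x).
  have [h1 h2 h3 _] := Phi_bounds (grad z x) (grad ustar x) S Ox.
  have [k1 k2 k3 _] := Psi_bounds (z x) (ustar x) S Ox.
  split => //; have := rate (p x) (z x - ustar x) _ _ _ _ _ g0 h1 h2 h3 k1 k2 k3.
  apply: le_trans; rewrite le_eqVlt; apply/orP; left; apply/eqP.
  by rewrite /tg /j /M1 /M2 /D1 /D2 /flux; ring.
split.
  rewrite -subr_ge0 mulNr -opprD oppr_ge0 addrC.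
  rewrite (@eq_Rintegral _ _ _ leb Om (fun x => tg x + r x)); last first.
    by move=> x _; rewrite /tg /r /f1 /f2; field.
  rewrite RintegralD// r0 addr0 -/j -RintegralZl// -RintegralD//; last exact: (integrableRZ _ mO).
  have i3 : leb.-integrable Om (EFin \o (fun x => sqn (grad z x - grad ustar x) - lambda * (z x - ustar x) ^+ 2)).
    by apply: (integrableRB mO) => //; exact: (integrableRZ _ mO).
  apply: (@le_trans _ _ (\int[leb]_(x in Om) (- A * (sqn (grad z x - grad ustar x) - lambda * (z x - ustar x) ^+ 2)))).
    apply: le_Rintegral => //.
    - by apply: (integrableRD mO) => //; exact: (integrableRZ _ mO).
    - exact: (integrableRZ _ mO).
    - by move=> x Ox; have [] := bnd x Ox.
  have -> := @RintegralZl _ _ _ leb Om _ (- A) mO i3.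
  rewrite mulNr oppr_le0; apply: mulr_ge0 => //.
  have -> := @RintegralB _ _ _ leb Om _ _ mO ig (integrableRZ lambda mO iw2).
  have -> := @RintegralZl _ _ _ leb Om _ lambda mO iw2.
  by rewrite subr_ge0; exact: (poincare_static pO Az).
have <- := @RintegralZl _ _ _ leb Om _ (theta / 2) mO ig.
apply: (le_Rintegral mO (integrableRZ _ mO ig) ij).
move=> x Ox; have [g0 h1 h2 _] := bnd x Ox; rewrite -/(j x) /j.
have := sqr_ge0 (p x + a / 2 * (z x - ustar x)); have := sqr_ge0 (z x - ustar x).
have := sqr_ge0 (p x).
move: h1 h2; move: (D1 _ _ _ _) (D2 _ _ _ _) (sqn _) (z x - ustar x) (p x) => d1 d2 s w y h1 h2 e1 e2 e3.
have e4 : 0 <= a ^+ 2 * w ^+ 2 by rewrite mulr_ge0// sqr_ge0.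
by lra.
Qed.

End Static.

(** * Regularity of the space-time extension *)

Lemma within_comp (R : realType) (V V' : normedModType R) (A : set V) (B : set V') (F : V -> R) (phi : V' -> V) :
  continuous phi -> (forall x, B x -> A (phi x)) -> {within A, continuous F} ->
  {within B, continuous (fun x => F (phi x))}.
Proof.
move=> cphi BA /subspace_continuousP cF; apply/subspace_continuousP => x Bx W nW.
have := cF _ (BA x Bx) W nW; rewrite /nbhs /= /within /= => h.
have := cphi x _ h; rewrite /nbhs /=.
by apply: filterS => y /= AW By; apply: AW; exact: BA.
Qed.

Lemma continuous_pairl (R : realType) (V W : normedModType R) (b : W) :
  continuous (fun x : V => (x, b)).
Proof. by move=> x; apply: cvg_pair; [exact: cvg_id|exact: cvg_cst]. Qed.

Lemma continuous_pairr (R : realType) (V W : normedModType R) (a : V) :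
  continuous (fun x : W => (a, x)).
Proof. by move=> x; apply: cvg_pair; [exact: cvg_cst|exact: cvg_id]. Qed.

Section SpaceTime.
Variables (R : realType) (n : nat) (Om : set 'rV[R]_n) (u : 'rV[R]_n -> R -> R).
Let U := fun q : 'rV[R]_n * R => u q.1 q.2.
Let Q := Om `*` [set t : R | 0 < t].
Hypothesis oO : open Om.
Hypothesis bO : bounded_set Om.
Hypothesis CU : Ck 2 Q U.
Hypothesis CcU : C1_closure Q U.

Lemma open_cylinder : open Q.
Proof.
rewrite openE => -[x t] [/= Ox t0].
exists (Om, [set t : R | 0 < t]) => //; split; apply: open_nbhs_nbhs => //; split => //.
Qed.

Lemma utE x t : derive1 (u x) t = 'D_(0, 1) U (x, t).
Proof. by rewrite derive1E -(derive_slice2 U). Qed.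

Lemma utfE x : derive1 (u x) = (fun t => ('D_(0, 1) U) (x, t)).
Proof. by apply/funext => t; exact: utE. Qed.

Lemma uttE x t : derive1n 2 (u x) t = 'D_(0, 1) ('D_(0, 1) U) (x, t).
Proof. by rewrite derive1nS derive1n1 utfE derive1E (derive_slice2 ('D_(0, 1) U)). Qed.

Lemma uxE i x t : pd i (u ^~ t) x = 'D_(delta_mx ord0 i, 0) U (x, t).
Proof. by rewrite /pd -(derive_slice1 U). Qed.

Lemma uxtE i x t : pd i (fun y => derive1 (u y) t) x = 'D_(delta_mx ord0 i, 0) ('D_(0, 1) U) (x, t).
Proof.
rewrite /pd (_ : (fun y => _) = (fun y => ('D_(0, 1) U) (y, t))); last by apply/funext => y; exact: utE.
by rewrite -(derive_slice1 ('D_(0, 1) U)).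
Qed.

Lemma slice_C2 t : 0 < t -> Ck 2 Om (u ^~ t).
Proof. by move=> t0; exact: (@Ck_slice1 _ _ _ 2 Om _ U t t0 CU). Qed.

Lemma slice_ut_C1 t : 0 < t -> Ck 1 Om (fun y => derive1 (u y) t).
Proof.
move=> t0; rewrite (_ : (fun y => _) = (fun y => ('D_(0, 1) U) (y, t))); last by apply/funext => y; exact: utE.
by apply: (@Ck_slice1 _ _ _ 1 Om _ ('D_(0, 1) U) t t0); have [_ h] := CU; exact: h.
Qed.

Lemma slice_utt_continuous t x : 0 < t -> Om x -> {for x, continuous (fun y => derive1n 2 (u y) t)}.
Proof.
move=> t0 Ox; rewrite (_ : (fun y => _) = (fun y => ('D_(0, 1) ('D_(0, 1) U)) (y, t))); last by apply/funext => y; exact: uttE.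
have h : Ck 0 Q ('D_(0, 1) ('D_(0, 1) U)) by have [_ h] := CU; have [_] := h (0, 1); exact.
exact: (@Ck_slice1 _ _ _ 0 Om _ ('D_(0, 1) ('D_(0, 1) U)) t t0 h x Ox).
Qed.

Lemma time_derivatives x (t : R) : Om x -> 0 < t ->
  [/\ is_derive t 1 (u x) (derive1 (u x) t),
      is_derive t 1 (derive1 (u x)) (derive1n 2 (u x) t) &
      forall i, is_derive t 1 (fun s => pd i (u ^~ s) x) (pd i (fun y => derive1 (u y) t) x)].
Proof.
move=> Ox t0.
have tline (f : 'rV[R]_n * R -> R) : Ck 1 Q f -> is_derive t 1 (fun s : R => f (x, s)) ('D_(0, 1) f (x, t)).
  move=> cf; have Cf : Ck 1 [set t : R | 0 < t] (fun s => f (x, s)) by exact: (@Ck_slice2 _ _ _ 1 Om _ f x Ox cf).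
  by split; [exact: (Ck1_derivable Cf)|exact: derive_slice2].
have [_ CD] := CU.
split.
- by rewrite utE; apply: tline; exact: CkS.
- by rewrite uttE utfE; apply: tline; exact: CD.
- move=> i; rewrite uxtE (schwarz _ _ open_cylinder CU); last by split.
  rewrite (_ : (fun s => _) = (fun s => ('D_(delta_mx ord0 i, 0) U) (x, s))).
    by apply: tline; exact: CD.
  by apply/funext => s; exact: uxE.
Qed.

(** Values of derivatives at t = 0 and on the lateral boundary are accessible only through this
    continuous extension F. *)
Lemma extension v : exists F : 'rV[R]_n * R -> R, {within closure Q, continuous F} /\
  forall x t, Om x -> 0 < t -> F (x, t) = 'D_v U (x, t).
Proof.
have [_ _ /(_ v)[F [cF FE]]] := CcU; exists F; split => // x t Ox t0.
by apply: FE; split.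
Qed.

Lemma ext_slice (F : 'rV[R]_n * R -> R) t : 0 <= t -> {within closure Q, continuous F} ->
  {within closure Om, continuous (fun x => F (x, t))}.
Proof.
move=> t0; apply: within_comp; first exact: continuous_pairl.
by move=> x Ox; exact: closure_cylinder.
Qed.

Lemma ext_time (F : 'rV[R]_n * R -> R) x : closure Om x -> {within closure Q, continuous F} ->
  {within [set t : R | 0 <= t], continuous (fun t => F (x, t))}.
Proof.
move=> Ox; apply: within_comp; first exact: continuous_pairr.
by move=> t t0; exact: closure_cylinder.
Qed.

Lemma cU : {within closure Q, continuous U}. Proof. by have [] := CcU. Qed.

(** The times 1 / (k + 1) replace the one-sided limit at 0, so that dominated convergence for
    sequences applies. *)
Lemma natSinv_cvg0 (F : R -> R) : {within [set t : R | 0 <= t], continuous F} ->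
  F (k.+1%:R^-1) @[k --> \oo] --> F 0.
Proof.
move=> cF; apply/cvgrPdist_lt => e e0.
have [r r0 hr] := within_continuous_dist cF (lexx (0 : R)) e0.
have := near_infty_natSinv_lt (PosNum r0) => /=.
apply: filterS => k kr; apply: hr; first by rewrite /= invr_ge0.
by rewrite sub0r normrN ger0_norm ?invr_ge0.
Qed.

Lemma MVT_time x t h : Om x -> 0 <= t -> 0 < h ->
  exists2 s, t < s < t + h & u x (t + h) - u x t = h * derive1 (u x) s.
Proof.
move=> Ox t0 h0.
have tth : t < t + h by rewrite ltrDl.
have [|s|s /[!in_itv]/= sI E] := @MVT _ (u x) (derive1 (u x)) t (t + h) tth.
- move=> s; rewrite in_itv/= => /andP[ts _].
  by have [] := time_derivatives Ox (le_lt_trans t0 ts).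
- apply: (continuous_subspaceW _ (ext_time (subset_closure Ox) cU)).
  by move=> r /=; rewrite in_itv/= => /andP[tr _]; exact: le_trans t0 tr.
by exists s => //; rewrite E addrC addKr mulrC.
Qed.

(** By the mean value theorem the quotient at h is u_t at some time s < h, and F is continuous down
    to t = 0. *)
Lemma ut_initial F x (l : R) : {within closure Q, continuous F} ->
  (forall x t, Om x -> 0 < t -> F (x, t) = derive1 (u x) t) -> Om x ->
  h^-1 * (u x h - u x 0) @[h --> 0^'+] --> l -> F (x, 0) = l.
Proof.
move=> cF FE Ox /cvgrPdist_lt ul.
apply/eqP; rewrite -subr_eq0 -normr_le0; apply/ler_addgt0Pr => e e0; rewrite add0r.
have e2 : 0 < e / 2 by rewrite divr_gt0.
have [r r0 hr] := within_continuous_dist (ext_time (subset_closure Ox) cF) (lexx (0 : R)) e2.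
near (0 : R)^'+ => h.
have h0 : 0 < h by near: h; exact: nbhs_right_gt.
have hr' : h < r by near: h; exact: nbhs_right_lt.
have hl : `|l - h^-1 * (u x h - u x 0)| < e / 2 by near: h; exact: ul.
have [s /andP[s0 sh] E] := MVT_time Ox (lexx 0) h0.
rewrite add0r in sh E.
have := hr s (ltW s0); rewrite sub0r normrN gtr0_norm// => /(_ (lt_trans sh hr')).
rewrite (FE x s Ox s0); move: hl; rewrite E mulrA mulVf ?gt_eqF// mul1r.
move: (derive1 _ _) (F _) => A B.
by rewrite !ltr_norml ler_norml => /andP[a1 a2] /andP[b1 b2]; apply/andP; split; lra.
Unshelve. all: by end_near. Qed.

(** At the boundary point u is constant in time, so at interior points y near x the increment of u
    over [t, t + h] is small. The mean value theorem yields a small u_t at some (y, s) near (x, t),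
    and continuity of F carries this to the boundary. *)
Lemma ut_boundary F x t : {within closure Q, continuous F} ->
  (forall x t, Om x -> 0 < t -> F (x, t) = derive1 (u x) t) ->
  closure Om x -> 0 < t -> (forall s, 0 <= s -> u x s = u x 0) -> F (x, t) = 0.
Proof.
move=> cF FE Ox t0 ux.
apply/eqP; rewrite -normr_le0; apply/ler_addgt0Pr => e e0; rewrite add0r.
have e4 : 0 < e / 4 by rewrite divr_gt0.
have cl := closure_cylinder Ox (ltW t0).
have [r r0 hr] := within_continuous_dist cF cl e4.
(* h comes first and keeps all times within the continuity radius of F. Only then is y taken so
   close to x that both errors in the increment are below e / 4 * h, whence |u_t| <= e / 2. *)
pose h := r / 2; have h0 : 0 < h by rewrite divr_gt0.
have hr' : h < r by rewrite /h ltr_pdivrMr// mulr_natr mulr2n ltrDl.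
have eh : 0 < e / 4 * h by rewrite mulr_gt0.
have [r1 r10 h1] := within_continuous_dist cU cl eh.
have th0 : 0 <= t + h by rewrite addr_ge0// ltW.
have [r2 r20 h2] := within_continuous_dist cU (closure_cylinder Ox th0) eh.
pose d := Num.min h (Num.min r1 r2).
have d0 : 0 < d by rewrite !lt_min h0 r10.
have [y [Oy]] := Ox _ (nbhsx_ballx x d d0); rewrite -ball_normE /= !lt_min => /and3P[y0 y1 y2].
have [s /andP[s1 s2] E] := MVT_time Oy (ltW t0) h0.
have pd (b c : R) : `|(x, b) - (y, c)| = Num.max `|x - y| `|b - c| by [].
have a1 := h1 (y, t) (closure_cylinder (subset_closure Oy) (ltW t0)).
have a2 := h2 (y, t + h) (closure_cylinder (subset_closure Oy) th0).
have a3 := hr (y, s) (closure_cylinder (subset_closure Oy) (ltW (lt_trans t0 s1))).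
rewrite !pd !subrr normr0 !gt_max in a1 a2 a3.
have {}a1 := a1 _; have {}a1 : `|U (x, t) - U (y, t)| < e / 4 * h by apply: a1; rewrite y1 r10.
have {}a2 : `|U (x, t + h) - U (y, t + h)| < e / 4 * h by apply: a2; rewrite y2 r20.
have {}a3 : `|F (x, t) - F (y, s)| < e / 4.
  apply: a3; rewrite (lt_trans y0 hr') /= ltr_norml; apply/andP; split; lra.
rewrite /U /= ux ?(ltW t0)// in a1; rewrite /U /= ux// in a2.
have s0 := lt_trans t0 s1.
rewrite (FE y s Oy s0) in a3.
have b : `|derive1 (u y) s| <= e / 2.
  rewrite -(ler_pM2l h0) -[X in X * `|_|](gtr0_norm h0) -normrM -E.
  move: a1 a2; rewrite !ltr_norml ler_norml => /andP[c1 c2] /andP[c3 c4]; apply/andP; split; lra.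
have := ler_normD (F (x, t) - derive1 (u y) s) (derive1 (u y) s); rewrite subrK.
by move: a3 b; lra.
Qed.

(** [C1_closure] extends the space derivatives to t = 0 but does not identify them with derivatives
    of u(., 0). The difference quotient is compared with F at the times 1 / (k + 1), uniformly in k,
    before k tends to infinity. *)
Lemma ux_initial F x v : {within closure Q, continuous F} ->
  (forall x t, Om x -> 0 < t -> F (x, t) = 'D_(v, 0) U (x, t)) -> Om x ->
  is_derive x v (u ^~ 0) (F (x, 0)).
Proof.
move=> cF FE Ox.
suff dF : h^-1 *: (((u ^~ 0) \o shift x) (h *: v) - u x 0) @[h --> 0^'] --> F (x, 0).
  by split; [apply/cvg_ex; exists (F (x, 0)); exact: dF|exact/cvg_lim].
apply/cvgrPdist_le => /= e e0.
have clx : closure Q (x, 0) by apply: closure_cylinder => //; exact: subset_closure.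
have [r r0 hr] := within_continuous_dist cF clx e0.
have /nbhs_ballP[r2 /= r20 hr2] : nbhs x Om by exact: open_nbhs_nbhs.
pose m := Num.min r r2; have m0 : 0 < m by rewrite lt_min r0.
pose L := `|v| + 1; have L0 : 0 < L by rewrite ltr_wpDl.
near=> h.
have h0 : h != 0 by near: h; exact: nbhs_dnbhs_neq.
have hm : `|h| < m / L.
  by near: h; apply: dnbhs0_lt; rewrite divr_gt0.
have nb s : 0 <= s <= 1 -> `|x - (x + s *: (h *: v))| < m.
  move=> /andP[s0 s1]; rewrite opprD addrA subrr add0r normrN !normrZ (ger0_norm s0).
  apply: (@le_lt_trans _ _ (`|h| * L)); last by rewrite -ltr_pdivlMr.
  rewrite mulrCA ler_wpM2l// /L; have := normr_ge0 v; nra.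
have inO s : 0 <= s <= 1 -> Om (x + s *: (h *: v)).
  by move=> /nb sm; apply: hr2; rewrite -ball_normE /= (lt_le_trans sm)// ge_min lexx orbT.
have key k : k.+1%:R^-1 < r -> `|u (x + h *: v) k.+1%:R^-1 - u x k.+1%:R^-1 - h * F (x, 0)| <= `|h| * e.
  move=> kr; pose t : R := k.+1%:R^-1; have t0 : 0 < t by rewrite invr_gt0.
  have Ct := CkS (slice_C2 t0).
  (* Parametrized over [0, 1] in the direction h v, because h may be negative. *)
  have [|s /andP[s0 s1]] := @MVT_line _ _ (u ^~ t) x (h *: v) 1 ltr01.
    by move=> s s01; apply: (Ck1_derivable Ct); exact: inO.
  have s01 : 0 <= s <= 1 by rewrite !ltW.
  rewrite scale1r mul1r => ->.
  have ds : differentiable (u ^~ t) (x + s *: (h *: v)) by have [d _] := Ct; apply: d; exact: inO.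
  rewrite deriveE// linearZ/= -deriveE// (derive_slice1 U) -FE//; last exact: inO.
  rewrite /GRing.scale/= -mulrBr normrM ler_wpM2l// distrC ltW//; apply: hr.
    by apply: closure_cylinder; [apply: subset_closure; exact: inO|exact: ltW].
  have -> : `|(x, 0) - (x + s *: (h *: v), t)| = Num.max `|x - (x + s *: (h *: v))| `|0 - t| by [].
  rewrite gt_max sub0r normrN (gtr0_norm t0) kr andbT.
  by rewrite (lt_le_trans (nb s s01))// ge_min lexx.
have h1 : 0 <= (1 : R) <= 1 by rewrite ler01 lexx.
have Oh : Om (x + h *: v) by have := inO 1 h1; rewrite scale1r.
have lim : `|u (x + h *: v) k.+1%:R^-1 - u x k.+1%:R^-1 - h * F (x, 0)| @[k --> \oo] -->
    `|u (x + h *: v) 0 - u x 0 - h * F (x, 0)|.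
  apply: cvg_norm; apply: cvgB; last exact: cvg_cst.
  apply: cvgB.
    exact: (natSinv_cvg0 (ext_time (subset_closure Oh) cU)).
  exact: (natSinv_cvg0 (ext_time (subset_closure Ox) cU)).
have le : `|u (x + h *: v) 0 - u x 0 - h * F (x, 0)| <= `|h| * e.
  apply: (cvgr_to_le lim); have := near_infty_natSinv_lt (PosNum r0) => /=.
  by apply: filterS => k; exact: key.
rewrite distrC [h *: v + x]addrC /GRing.scale/=.
have hn : 0 < `|h| by rewrite normr_gt0.
rewrite -(ler_pM2l hn) -normrM mulrBr mulrA mulfV// mul1r.
exact: le.
Unshelve. all: by end_near. Qed.

End SpaceTime.

(** * Decay of the Lyapunov functional *)

Lemma is_deriveD_fun (R : realType) (V : normedModType R) (f g : V -> R) (x v : V) (df dg : R) :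
  is_derive x v f df -> is_derive x v g dg -> is_derive x v (fun s => f s + g s) (df + dg).
Proof. by move=> hf hg; exact: is_deriveD. Qed.

Lemma is_deriveM_fun (R : realType) (V : normedModType R) (f g : V -> R) (x v : V) (df dg : R) :
  is_derive x v f df -> is_derive x v g dg -> is_derive x v (fun s => f s * g s) (f x * dg + g x * df).
Proof. by move=> hf hg; exact: is_deriveM. Qed.

Lemma is_deriveZ_fun (R : realType) (V : normedModType R) (f : V -> R) (c : R) (x v : V) (df : R) :
  is_derive x v f df -> is_derive x v (fun s => c * f s) (c * df).
Proof. by move=> hf; exact: is_deriveZ. Qed.

Lemma bounded_closure (R : realType) n (Om : set 'rV[R]_n) (f : 'rV[R]_n -> R) :
  bounded_set Om -> {within closure Om, continuous f} -> exists M, forall x, Om x -> `|f x| <= M.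
Proof.
move=> bO cf.
have /compact_bounded[M [_ hM]] : compact (f @` closure Om).
  by apply: continuous_compact => //; exact: compact_closure_bounded.
have M1 : M < `|M| + 1 by rewrite ltr_pwDr// ler_norm.
by exists (`|M| + 1) => x Ox; apply: (hM _ M1); exists x => //; exact: subset_closure.
Qed.

Lemma cvg_rV (R : realType) n (f : nat -> 'rV[R]_n) (l : 'rV[R]_n) :
  (forall i, f k ord0 i @[k --> \oo] --> l ord0 i) -> f k @[k --> \oo] --> l.
Proof.
move=> fl; have fE k : f k = \sum_i f k ord0 i *: (delta_mx ord0 i : 'rV[R]_n) by exact: row_sum_delta.
have gen (s : seq 'I_n) : \sum_(i <- s) f k ord0 i *: (delta_mx ord0 i : 'rV[R]_n) @[k --> \oo] -->
    \sum_(i <- s) l ord0 i *: (delta_mx ord0 i : 'rV[R]_n).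
  elim: s => [|i s IH].
    by under eq_fun do rewrite big_nil; rewrite big_nil; exact: cvg_cst.
  under eq_fun do rewrite big_cons; rewrite big_cons; apply: cvgD; last exact: IH.
  by apply: cvgZr_tmp; exact: fl.
by rewrite (row_sum_delta l); under eq_fun do rewrite fE; exact: gen.
Qed.

Lemma cvg_dotv (R : realType) n (c : 'rV[R]_n) (f : nat -> 'rV[R]_n) (l : 'rV[R]_n) :
  (forall i, f k ord0 i @[k --> \oo] --> l ord0 i) -> dotv c (f k) @[k --> \oo] --> dotv c l.
Proof.
move=> fl; apply: cvg_sumr => i; apply: cvgM; [exact: cvg_cst|exact: fl].
Qed.

Lemma cvg_sqn (R : realType) n (f : nat -> 'rV[R]_n) (l : 'rV[R]_n) :
  (forall i, f k ord0 i @[k --> \oo] --> l ord0 i) -> sqn (f k) @[k --> \oo] --> sqn l.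
Proof. by move=> fl; apply: cvg_sumr => i; apply: cvgM; exact: fl. Qed.

Section Dynamic.
Variables (R : realType) (n : nat) (Om : set 'rV[R]_n) (Phi : 'rV[R]_n -> 'rV[R]_n -> R).
Variables (Psi : 'rV[R]_n -> R -> R) (g ustar : 'rV[R]_n -> R) (theta mu a : R).
Variable u : 'rV[R]_n -> R -> R.
Hypothesis S : energy_data Om Phi Psi theta mu.
Hypothesis st : steady_state Om Phi Psi g ustar.
Hypothesis mu0 : 0 < mu.
Hypothesis a0 : 0 < a.
Hypothesis wr : wave_regular Om Phi Psi u.
Hypothesis dw : damped_wave Om Phi Psi a g u.
Local Notation leb := (lebesgue_rV n).
Let U := fun q : 'rV[R]_n * R => u q.1 q.2.
Let Q := Om `*` [set t : R | 0 < t].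
Let oO : open Om := dom_open S.
Let bO : bounded_set Om := dom_bounded S.
Let mO : measurable Om := open_measurable_rV oO.
Let CU : Ck 2 Q U. Proof. by have [] := wr. Qed.
Let CcU : C1_closure Q U. Proof. by have [] := wr. Qed.
Let cs : Ck 2 Om ustar. Proof. by have [] := st. Qed.
Let fes : finite_energy Om Phi Psi ustar. Proof. by have [] := st. Qed.
Let steady : forall x, Om x -> gradE Phi Psi ustar x = 0. Proof. by have [] := st. Qed.

(** The bound on u_t is restricted to t > 0: [derive1] at 0 is a two-sided derivative and involves
    negative times, about which nothing is known. *)
Definition bounded_upto (T M : R) : Prop :=
  forall x t, Om x -> 0 <= t <= T -> [/\ `|u x t - ustar x| <= M,
    forall i, `|pd i (u ^~ t) x - pd i ustar x| <= M & 0 < t -> `|derive1 (u x) t| <= M].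

Lemma uniform_bounds (T : R) : exists2 M : R, 0 <= M & bounded_upto T M.
Proof.
have [_ [css dss Dss] _ _ _] := st.
have [M1 hM1] := bounded_cylinder T bO (cU CcU).
have [M2 hM2] := bounded_closure bO css.
have [F [cF FE]] := extension CcU (0, 1).
have [M3 hM3] := bounded_cylinder T bO cF.
have hi i : exists M, forall x t, Om x -> 0 <= t <= T -> `|pd i (u ^~ t) x| <= M.
  have [Fi [cFi FiE]] := extension CcU (delta_mx ord0 i, 0).
  have [M hM] := bounded_cylinder T bO cFi.
  (* At t = 0 the extension is identified with the derivative of the slice by [ux_initial]. *)
  exists M => x t Ox /andP[]; rewrite le_eqVlt => /orP[/eqP <-|t0] tT.
    have [_] := ux_initial oO CU CcU cFi FiE Ox; rewrite /pd => ->; apply: hM; first exact: subset_closure.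
    by rewrite lexx.
  rewrite uxE -FiE//; apply: hM; first exact: subset_closure.
  by rewrite ltW.
have hs i : exists M, forall x, Om x -> `|pd i ustar x| <= M.
  have [Fi [cFi FiE]] := Dss (delta_mx ord0 i); have [M hM] := bounded_closure bO cFi.
  by exists M => x Ox; rewrite /pd -FiE//; exact: hM.
have [N1 hN1] := choice hi; have [N2 hN2] := choice hs.
pose N := \sum_i (`|N1 i| + `|N2 i|).
have N0 : 0 <= N by apply: sumr_ge0 => i _; rewrite addr_ge0.
exists (`|M1| + `|M2| + `|M3| + N); first by rewrite !addr_ge0.
move=> x t Ox t0T; have clx := subset_closure Ox.
have := ler_norm M1; have := ler_norm M2; have := ler_norm M3.
have := normr_ge0 M1; have := normr_ge0 M2; have := normr_ge0 M3 => e1 e2 e3 e4 e5 e6.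
split.
- rewrite (le_trans (ler_normB _ _))//; have := hM1 x t clx t0T; have := hM2 x Ox.
  by rewrite /U /=; lra.
- move=> i; rewrite (le_trans (ler_normB _ _))//; have := hN1 i x t Ox t0T; have := hN2 i x Ox.
  have : `|N1 i| + `|N2 i| <= N.
    rewrite /N (bigD1 i)//= lerDl; apply: sumr_ge0 => j _; exact: addr_ge0.
  have := ler_norm (N1 i); have := ler_norm (N2 i).
  by lra.
- move=> t0; have := hM3 x t clx t0T; rewrite FE// -(utE u) => h.
  by lra.
Qed.

Lemma w_vanishing t : 0 <= t -> vanishing Om (fun x => u x t - ustar x).
Proof.
move=> t0; have [_ [css _ _] _ _ bs] := st; have [_ bu] := dw.
apply: (@vanishing_closure _ _ Om _ (fun x => u x t - ustar x) oO bO) => //.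
  have cu := ext_slice t0 (cU CcU).
  by move=> x; apply: cvgB; [exact: cu|exact: css].
by move=> x bx; rewrite bu// bs// subrr.
Qed.

Lemma ut_vanishing t : 0 < t -> vanishing Om (fun x => derive1 (u x) t).
Proof.
move=> t0; have [_ bu] := dw; have [F [cF FE]] := extension CcU (0, 1).
have FE' x s : Om x -> 0 < s -> F (x, s) = derive1 (u x) s by move=> Ox s0; rewrite FE// -(utE u).
apply: (@vanishing_closure _ _ Om _ (fun x => F (x, t)) oO bO).
- exact: (ext_slice (ltW t0) cF).
- by move=> x Ox; rewrite FE'.
- move=> x bx; apply: (ut_boundary oO CU CcU cF FE') => //; first by have [] := bx.
  by move=> s s0; rewrite !bu.
Qed.

Lemma admissible_slice (T M t : R) :
  bounded_upto T M ->
  0 < t <= T -> admissible Om Phi Psi ustar (u ^~ t) M.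
Proof.
move=> hM /andP[t0 tT]; have t0T : 0 <= t <= T by rewrite ltW.
have [_ _ fe _ _] := wr.
split.
- exact: (slice_C2 CU t0).
- by apply: fe; exact: ltW.
- by apply: w_vanishing; exact: ltW.
- by move=> x Ox; have [] := hM x t Ox t0T.
- by move=> x i Ox; have [_ + _] := hM x t Ox t0T; exact.
Qed.

Definition J_density s x := derive1 (u x) s ^+ 2 / 2 +
  (Phi x (grad (u ^~ s) x) + Psi x (u x s)) +
  a / 2 * (derive1 (u x) s * (u x s - ustar x)) + a ^+ 2 / 4 * (u x s - ustar x) ^+ 2.

Definition dJ_density s x := derive1 (u x) s * derive1n 2 (u x) s +
  (dotv (flux Phi (u ^~ s) x) (grad (fun y => derive1 (u y) s) x) +
   derive1 (Psi x) (u x s) * derive1 (u x) s) +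
  a / 2 * (derive1 (u x) s ^+ 2 + (u x s - ustar x) * derive1n 2 (u x) s) +
  a ^+ 2 / 2 * ((u x s - ustar x) * derive1 (u x) s).

Lemma is_derive_J_density x (s : R) : Om x -> 0 < s ->
  is_derive s 1 (fun r => J_density r x) (dJ_density s x).
Proof.
move=> Ox s0; have [d1 d2 d3] := time_derivatives oO CU Ox s0.
have [dPsi _] := Psi_slice S Ox; have [dPhi _] := Phi_slice S Ox.
have dw' : is_derive s 1 (fun r => u x r - ustar x) (derive1 (u x) s).
  by apply: (is_derive_conv (is_deriveB_fun d1 (is_derive_cst (ustar x) s 1))); rewrite subr0.
have e1 := is_deriveM_fun d2 d2.
have e2 : is_derive s 1 (fun r => Phi x (grad (u ^~ r) x))
    (dotv (flux Phi (u ^~ s) x) (grad (fun y => derive1 (u y) s) x)).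
  have di i : (fun r => grad (u ^~ r) x ord0 i) = (fun r => pd i (u ^~ r) x).
    by apply/funext => r; rewrite mxE.
  apply: (is_derive_conv (@is_derive_curve _ _ (Phi x) (fun r => grad (u ^~ r) x) s _ _)).
  - by move=> i; rewrite di; have [] := d3 i.
  - exact: dPhi.
  - rewrite /flux; congr dotv; apply/rowP => i; rewrite !mxE di.
    by have [_ ->] := d3 i.
have e3 : is_derive s 1 (fun r => Psi x (u x r)) (derive1 (Psi x) (u x s) * derive1 (u x) s).
  have dP : is_derive (u x s) 1 (Psi x) (derive1 (Psi x) (u x s)).
    by rewrite derive1E; exact: derivableP.
  exact: (@is_derive1_comp _ (Psi x) (u x) s _ _ dP d1).
have e4 := is_deriveM_fun d2 dw'; have e5 := is_deriveM_fun dw' dw'.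
have := is_deriveD_fun (is_deriveD_fun (is_deriveD_fun (is_deriveZ_fun 2^-1 e1) (is_deriveD_fun e2 e3))
  (is_deriveZ_fun (a / 2) e4)) (is_deriveZ_fun (a ^+ 2 / 4) e5) => e.
have -> : (fun r => J_density r x) = (fun s => 2^-1 * (derive1 (u x) s * derive1 (u x) s) +
  (Phi x (grad (u ^~ s) x) + Psi x (u x s)) + a / 2 * (derive1 (u x) s * (u x s - ustar x)) +
  a ^+ 2 / 4 * ((u x s - ustar x) * (u x s - ustar x))).
  by apply/funext => r; rewrite /J_density !expr2 [_ / 2 in LHS]mulrC.
apply: (is_derive_conv e); rewrite /dJ_density.
move: (dotv _ _) (derive1 (Psi x) _) (derive1 _ _) (derive1n _ _ _) (u x s - _) => b1 b2 b3 b4 b5.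
by field.
Qed.

Lemma integrable_J_parts (T M s : R) :
  bounded_upto T M ->
  0 < s <= T ->
  [/\ leb.-integrable Om (EFin \o (fun x => derive1 (u x) s ^+ 2 / 2)),
   leb.-integrable Om (EFin \o (fun x => Phi x (grad (u ^~ s) x) + Psi x (u x s))),
   leb.-integrable Om (EFin \o (fun x => a / 2 * (derive1 (u x) s * (u x s - ustar x)))) &
   leb.-integrable Om (EFin \o (fun x => a ^+ 2 / 4 * (u x s - ustar x) ^+ 2))].
Proof.
move=> hM sT; have Az := admissible_slice hM sT; have /andP[s0 s1] := sT.
have s0T : 0 <= s <= T by rewrite ltW.
have cz := adm_C2 Az; have [iPz iSz] := adm_energy Az.
have [mz _ _ _ _] := measurable_static S cz; have [ms _ _ _ _] := measurable_static S cs.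
have [mp _] := measurable_Ck1 oO (slice_ut_C1 CU s0).
have pM x : Om x -> `|derive1 (u x) s| <= M by move=> Ox; have [_ _ h] := hM x s Ox s0T; exact: h.
have wM x : Om x -> `|u x s - ustar x| <= M by move=> Ox; have [] := hM x s Ox s0T.
split.
- apply: (@integrable_bounded _ _ _ _ (M * M * 2^-1) oO bO) => [|x Ox].
    by apply: measurable_funM => //; exact: measurable_funX.
  by rewrite normrM (ger0_norm (_ : 0 <= 2^-1))// ler_wpM2r// expr2 normrM ler_pM// pM.
- exact: (integrableRD mO iPz iSz).
- apply: (integrableRZ _ mO); apply: (@integrable_bounded _ _ _ _ (M * M) oO bO) => [|x Ox].
    by apply: measurable_funM => //; exact: measurable_funB.
  by rewrite normrM ler_pM// ?pM// wM.
- apply: (integrableRZ _ mO); apply: (@integrable_bounded _ _ _ _ (M * M) oO bO) => [|x Ox].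
    by apply: measurable_funX; exact: measurable_funB.
  by rewrite expr2 normrM ler_pM// wM.
Qed.

(** Differentiation under the integral on ]0, t + 1[, where [uniform_bounds] and the local
    domination assumptions provide one integrable majorant. *)
Lemma is_derive_J (t : R) : 0 < t ->
  is_derive t 1 (fun s => \int[leb]_(x in Om) J_density s x) (\int[leb]_(x in Om) dJ_density t x).
Proof.
move=> t0; pose T := t + 1; have tT : t < T by rewrite ltrDl.
have [M M0 hM] := uniform_bounds T.
have [_ _ _ ld1 [ld2 ld3]] := wr.
have [h1 [i1 b1]] := ld1 T; have [h2 [i2 b2]] := ld2 T; have [h3 [i3 b3]] := ld3 T.
(* Term by term from [dJ_density]: u_t and w are bounded by M, u_tt by h1 and the two energy terms
   by h2 and h3. Absolute values make G nonnegative. *)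
pose G x := M * `|h1 x| + (`|h2 x| + `|h3 x|) + a / 2 * (M * M + M * `|h1 x|) + a ^+ 2 / 2 * (M * M).
have G0 x : 0 <= G x.
  by rewrite /G !addr_ge0// ?mulr_ge0// ?addr_ge0// ?mulr_ge0 ?divr_ge0 ?sqr_ge0// ltW.
have ic (c : R) : leb.-integrable Om (EFin \o (fun=> c)).
  by apply: (@integrable_bounded _ _ _ _ `|c| oO bO) => //; exact: measurable_cst.
have n1 := integrable_norm i1; have n2 := integrable_norm i2; have n3 := integrable_norm i3.
have iG : leb.-integrable Om (EFin \o G).
  exact: (integrableRD mO (integrableRD mO (integrableRD mO (integrableRZ M mO n1) (integrableRD mO n2 n3))
    (integrableRZ (a / 2) mO (integrableRD mO (ic (M * M)) (integrableRZ M mO n1)))) (ic (a ^+ 2 / 2 * (M * M)))).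
have tI : `]0, T[%classic t by rewrite /= in_itv/= t0.
have intf s : `]0, T[%classic s -> leb.-integrable Om (EFin \o J_density s).
  rewrite /= in_itv/= => /andP[s0 sT]; have sT' : 0 < s <= T by rewrite s0 ltW.
  have [p1 p2 p3 p4] := integrable_J_parts hM sT'.
  exact: (integrableRD mO (integrableRD mO (integrableRD mO p1 p2) p3) p4).
have der s x : `]0, T[%classic s -> Om x -> derivable (J_density ^~ x) s 1.
  by rewrite /= in_itv/= => /andP[s0 _] Ox; have [] := is_derive_J_density Ox s0.
have d1E s x : `]0, T[%classic s -> Om x -> derive1 (J_density ^~ x) s = dJ_density s x.
  by rewrite /= in_itv/= => /andP[s0 _] Ox; rewrite derive1E; have [_ ->] := is_derive_J_density Ox s0.
have Gub s x : `]0, T[%classic s -> Om x -> `|partial1of2 J_density s x| <= G x.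
  move=> sI Ox; rewrite /partial1of2 d1E//; move: sI; rewrite /= in_itv/= => /andP[s0 sT].
  have s0T : 0 <= s <= T by rewrite !ltW.
  have sIT : 0 < s < T by rewrite s0.
  have [wM _ /(_ s0) pM] := hM x s Ox s0T.
  have q1 := le_trans (b1 x s Ox sIT) (ler_norm _).
  have q2 := le_trans (b2 x s Ox sIT) (ler_norm _).
  have q3 := le_trans (b3 x s Ox sIT) (ler_norm _).
  rewrite /dJ_density /G.
  have a2 : 0 <= a / 2 by rewrite divr_ge0// ltW.
  have a3 : 0 <= a ^+ 2 / 2 by rewrite divr_ge0// sqr_ge0.
  apply: le_trans (ler_normD _ _) _; apply: lerD; last first.
    by rewrite normrM (ger0_norm a3); apply: ler_wpM2l => //; rewrite normrM; apply: ler_pM.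
  apply: le_trans (ler_normD _ _) _; apply: lerD; last first.
    rewrite normrM (ger0_norm a2); apply: ler_wpM2l => //.
    apply: le_trans (ler_normD _ _) _; apply: lerD; first by rewrite expr2 normrM; apply: ler_pM.
    by rewrite normrM; apply: ler_pM.
  apply: le_trans (ler_normD _ _) _; apply: lerD; first by rewrite normrM; apply: ler_pM.
  by apply: le_trans (ler_normD _ _) _; exact: lerD.
split; first exact: (derivable_under_integral mO tI intf der G0 iG Gub).
rewrite -derive1E (differentiation_under_integral mO tI intf der G0 iG Gub).
by apply: eq_Rintegral => x /set_mem Ox; rewrite /partial1of2 d1E.
Qed.

Definition J_bregman s := \int[leb]_(x in Om) (derive1 (u x) s ^+ 2 / 2 +
  (D1 Phi ustar (u ^~ s) x + D2 Psi ustar (u ^~ s) x) +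
  a / 2 * (derive1 (u x) s * (u x s - ustar x)) + a ^+ 2 / 4 * (u x s - ustar x) ^+ 2).

Lemma J_bregmanE t : 0 < t -> J_bregman t = \int[leb]_(x in Om) J_density t x -
  \int[leb]_(x in Om) (Phi x (grad ustar x) + Psi x (ustar x)).
Proof.
move=> t0; have [M M0 hM] := uniform_bounds t.
have tt : 0 < t <= t by rewrite t0 lexx.
have [p1 p2 p3 p4] := integrable_J_parts hM tt.
have Az := admissible_slice hM tt.
have [iD1 iD2 _ _ _] := integrable_breg S cs mu0 Az.
have iD := integrableRD mO iD1 iD2.
have splitI (f1 f2 f3 f4 : 'rV[R]_n -> R) : leb.-integrable Om (EFin \o f1) ->
    leb.-integrable Om (EFin \o f2) -> leb.-integrable Om (EFin \o f3) ->
    leb.-integrable Om (EFin \o f4) ->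
    \int[leb]_(x in Om) (f1 x + f2 x + f3 x + f4 x) = \int[leb]_(x in Om) f1 x +
    \int[leb]_(x in Om) f2 x + \int[leb]_(x in Om) f3 x + \int[leb]_(x in Om) f4 x.
  move=> i1 i2 i3 i4.
  have i12 := integrableRD mO i1 i2; have i123 := integrableRD mO i12 i3.
  have -> := @RintegralD _ _ _ leb Om _ _ mO i123 i4.
  have -> := @RintegralD _ _ _ leb Om _ _ mO i12 i3.
  by have -> := @RintegralD _ _ _ leb Om _ _ mO i1 i2.
have -> := splitI _ _ _ _ p1 p2 p3 p4; rewrite /J_bregman.
have -> := splitI _ _ _ _ p1 iD p3 p4.
have <- := energy_bregman S cs fes steady mu0 Az.
by ring.
Qed.

Lemma dissipation (lambda A beta : R) t :
  poincare_ineq Om lambda -> 0 <= A ->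
  pointwise_decay theta mu a lambda A beta -> 0 < t ->
  \int[leb]_(x in Om) dJ_density t x <= - beta * J_bregman t /\
  theta / 2 * \int[leb]_(x in Om) (sqn (grad (u ^~ t) x - grad ustar x)) <= J_bregman t.
Proof.
move=> pO A0 rate t0; have [M M0 hM] := uniform_bounds t.
have tt : 0 < t <= t by rewrite t0 lexx.
have tt' : 0 <= t <= t by rewrite (ltW t0) lexx.
have Az := admissible_slice hM tt; have cz := adm_C2 Az.
have cp := slice_ut_C1 CU t0.
have [mz mDz mF _ [_ mPs]] := measurable_static S cz.
have [mp mDp] := measurable_Ck1 oO cp.
have mq : measurable_fun Om (fun x => derive1n 2 (u x) t).
  by apply: continuous_measurable_rV => // x Ox; exact: (slice_utt_continuous CU).
have [_ _ _ ld1 [ld2 ld3]] := wr.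
have [h1 [i1 b1]] := ld1 (t + 1); have [h2 [i2 b2]] := ld2 (t + 1); have [h3 [i3 b3]] := ld3 (t + 1).
have t1 : 0 < t < t + 1 by rewrite t0 /= ltrDl ltr01.
apply: (@static_decay _ _ _ _ _ _ _ _ S cs steady mu0 lambda a A beta (u ^~ t)
   (fun x => derive1 (u x) t) (fun x => derive1n 2 (u x) t) M pO a0 A0 rate Az).
- by move=> x Ox; have [h _] := dw; exact: h.
- exact: cp.
- exact: ut_vanishing.
- by move=> x Ox; have [_ _ h] := hM x t Ox tt'; exact: h.
- by apply: (le_integrableR mO mq _ i1) => x Ox; exact: b1.
- apply: (le_integrableR mO _ _ i2) => [|x Ox]; last exact: b2.
  apply: measurable_dotv => i; first exact: mF.
  have -> : (fun x => grad (fun y => derive1 (u y) t) x ord0 i) = pd i (fun y => derive1 (u y) t).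
    by apply/funext => x; rewrite mxE.
  exact: mDp.
- apply: (le_integrableR mO _ _ i3) => [|x Ox]; last exact: b3.
  exact: measurable_funM mPs mp.
Qed.

(** Monotonicity after multiplication by the integrating factor exp(beta r). The starting time s
    stays positive, where the functional is known to be differentiable. *)
Lemma J_bregman_decay (lambda A beta : R) s t :
  poincare_ineq Om lambda -> 0 <= A ->
  pointwise_decay theta mu a lambda A beta -> 0 < s -> s <= t ->
  J_bregman t * expR (beta * t) <= J_bregman s * expR (beta * s).
Proof.
move=> pO A0 rate s0 st'; have t0 := lt_le_trans s0 st'.
pose c0 := \int[leb]_(x in Om) (Phi x (grad ustar x) + Psi x (ustar x)).
pose E r := (\int[leb]_(x in Om) J_density r x - c0) * expR (beta * r).
pose dE r := (\int[leb]_(x in Om) J_density r x - c0) * (beta * expR (beta * r)) +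
  expR (beta * r) * (\int[leb]_(x in Om) dJ_density r x).
have dEP (r : R) : 0 < r -> is_derive r 1 E (dE r).
  move=> r0; have d1 := is_deriveB_fun (is_derive_J r0) (is_derive_cst c0 r 1).
  have dl : is_derive r 1 (fun r : R => beta * r) beta.
    by apply: is_derive_eq; rewrite /GRing.scale/=; ring.
  have d2 := @is_derive1_comp _ (@expR R) (fun r : R => beta * r) r _ _ (is_derive_expR _) dl.
  apply: (is_derive_conv (is_deriveM_fun d1 d2)).
  by rewrite subr0 /dE [expR _ * beta]mulrC.
have dE0 r : 0 < r -> dE r <= 0.
  move=> r0; rewrite /dE -J_bregmanE// mulrA [_ * (\int[_]_(_ in _) _)]mulrC -mulrDl.
  rewrite mulr_le0_ge0 ?expR_ge0//; have [h _] := dissipation pO A0 rate r0.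
  by move: h; lra.
have cE : {within `[s, t], continuous E}.
  apply: derivable_within_continuous => r; rewrite in_itv/= => /andP[sr _].
  by have [] := dEP r (lt_le_trans s0 sr).
have dE' r : r \in `]s, t[%R -> is_derive r 1 E (dE r).
  by rewrite in_itv/= => /andP[sr _]; apply: dEP; exact: lt_trans s0 sr.
have [r /[!in_itv]/= /andP[sr _] Er] := MVT_segment st' dE' cE.
rewrite (J_bregmanE t0) (J_bregmanE s0) -subr_le0 -/(E t) -/(E s) Er.
by rewrite mulr_le0_ge0 ?subr_ge0// dE0// (lt_le_trans s0).
Qed.

(** * The limit at the initial time *)

Variables u0 u1 : 'rV[R]_n -> R.
Hypothesis id0 : initial_data Om u0 u1 u.

(** Derivability of u0 is inherited from u(., 0), with which it agrees on the open set Om. *)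
Lemma pd_initial i x : Om x -> is_derive x (delta_mx ord0 i) u0 (pd i u0 x) /\
  pd i (u ^~ k.+1%:R^-1) x @[k --> \oo] --> pd i u0 x.
Proof.
move=> Ox; have [F [cF FE]] := extension CcU (delta_mx ord0 i, 0).
have d0 := ux_initial oO CU CcU cF FE Ox.
have uu0 : \forall y \near x, u y 0 = u0 y.
  have : \forall y \near x, Om y by exact: open_nbhs_nbhs.
  by apply: filterS => y Oy; have [] := id0 Oy.
have [d1 d2] := near_eq_is_derive uu0 d0.
split; first exact: derivableP.
rewrite /pd d2; have := natSinv_cvg0 (ext_time (subset_closure Ox) cF).
have -> : (fun k => F (x, k.+1%:R^-1)) = (fun k => pd i (u ^~ k.+1%:R^-1) x).
  by apply/funext => k; rewrite uxE -FE.
exact.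
Qed.

Lemma value_initial x : Om x -> u x k.+1%:R^-1 @[k --> \oo] --> u0 x /\
  derive1 (u x) k.+1%:R^-1 @[k --> \oo] --> u1 x.
Proof.
move=> Ox; have [ux0 ux1] := id0 Ox; split.
  rewrite -ux0; exact: (natSinv_cvg0 (ext_time (subset_closure Ox) (cU CcU))).
have [F [cF FE]] := extension CcU (0, 1).
have FE' y s : Om y -> 0 < s -> F (y, s) = derive1 (u y) s by move=> Oy s0; rewrite FE// -(utE u).
rewrite -(ut_initial oO CU CcU cF FE' Ox ux1).
have := natSinv_cvg0 (ext_time (subset_closure Ox) cF).
have -> : (fun k => F (x, k.+1%:R^-1)) = (fun k => derive1 (u x) k.+1%:R^-1).
  by apply/funext => k; rewrite FE'.
exact.
Qed.

Definition J_initial := \int[leb]_(x in Om) (u1 x ^+ 2 / 2 +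
  (D1 Phi ustar u0 x + D2 Psi ustar u0 x) +
  a / 2 * (u1 x * (u0 x - ustar x)) + a ^+ 2 / 4 * (u0 x - ustar x) ^+ 2).

(** Along t = 1 / (k + 1) the integrands are bounded by constants, through [uniform_bounds] and the
    upper Bregman bounds. The second claim makes the H^1 norm at t = 0 finite. *)
Lemma initial_limits :
  J_bregman k.+1%:R^-1 @[k --> \oo] --> J_initial /\
  leb.-integrable Om (EFin \o (fun x => (u0 x - ustar x) ^+ 2 + sqn (grad u0 x - grad ustar x))).
Proof.
have [M M0 hM] := uniform_bounds 1.
have tk k : 0 < (k.+1%:R^-1 : R) <= 1 by rewrite invr_gt0 ltr0n invf_le1// ler1n.
have tk' k : 0 <= (k.+1%:R^-1 : R) <= 1 by have /andP[h1 h2] := tk k; rewrite ltW.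
have Az k := admissible_slice hM (tk k).
have cz k := adm_C2 (Az k).
have parts k := integrable_J_parts hM (tk k).
have breg k := integrable_breg S cs mu0 (Az k).
have mint (f : 'rV[R]_n -> R) : leb.-integrable Om (EFin \o f) -> measurable_fun Om f.
  by move=> if_; apply/measurable_EFinP; exact: measurable_int if_.
have ic (c : R) : leb.-integrable Om (EFin \o (fun=> c)).
  by apply: (@integrable_bounded _ _ _ _ `|c| oO bO) => //; exact: measurable_cst.
have lim_w x : Om x -> u x k.+1%:R^-1 - ustar x @[k --> \oo] --> u0 x - ustar x.
  by move=> Ox; apply: cvgB; [have [] := value_initial Ox|exact: cvg_cst].
have lim_g x i : Om x ->
    (grad (u ^~ k.+1%:R^-1) x - grad ustar x) ord0 i @[k --> \oo] --> (grad u0 x - grad ustar x) ord0 i.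
  move=> Ox; rewrite !mxE; under eq_fun do rewrite !mxE.
  by apply: cvgB; [have [] := pd_initial i Ox|exact: cvg_cst].
have lim_G x : Om x -> grad (u ^~ k.+1%:R^-1) x @[k --> \oo] --> grad u0 x.
  move=> Ox; apply: cvg_rV => i; rewrite mxE; under eq_fun do rewrite mxE.
  by have [] := pd_initial i Ox.
have lim_sq (f : nat -> R) (l : R) : f k @[k --> \oo] --> l -> f k ^+ 2 @[k --> \oo] --> l ^+ 2.
  by move=> fl; rewrite expr2; under eq_fun do rewrite expr2; exact: cvgM.
have limJ x : Om x -> derive1 (u x) k.+1%:R^-1 ^+ 2 / 2 +
    (D1 Phi ustar (u ^~ k.+1%:R^-1) x + D2 Psi ustar (u ^~ k.+1%:R^-1) x) +
    a / 2 * (derive1 (u x) k.+1%:R^-1 * (u x k.+1%:R^-1 - ustar x)) +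
    a ^+ 2 / 4 * (u x k.+1%:R^-1 - ustar x) ^+ 2 @[k --> \oo] -->
    u1 x ^+ 2 / 2 + (D1 Phi ustar u0 x + D2 Psi ustar u0 x) +
    a / 2 * (u1 x * (u0 x - ustar x)) + a ^+ 2 / 4 * (u0 x - ustar x) ^+ 2.
  move=> Ox; have [lu lp] := value_initial Ox; have lw := lim_w x Ox.
  have [dPsi _] := Psi_slice S Ox; have [dPhi _] := Phi_slice S Ox.
  have cPsi : {for u0 x, continuous (Psi x)} by apply: differentiable_continuous; apply/derivable1_diffP.
  have cPhi : {for grad u0 x, continuous (Phi x)} by apply: differentiable_continuous; exact: dPhi.
  apply: cvgD; last by apply: cvgM; [exact: cvg_cst|exact: lim_sq].
  apply: cvgD; last by apply: cvgM; [exact: cvg_cst|exact: cvgM].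
  apply: cvgD; first by apply: cvgM; [exact: lim_sq|exact: cvg_cst].
  apply: cvgD.
    apply: cvgB; last by apply: cvg_dotv => i; exact: lim_g.
    apply: cvgB; last exact: cvg_cst.
    exact: (cvg_comp _ _ (lim_G x Ox) cPhi).
  apply: cvgB; last by apply: cvgM; [exact: cvg_cst|exact: lw].
  apply: cvgB; last exact: cvg_cst.
  exact: (cvg_comp _ _ lu cPsi).
split.
  pose f k x := derive1 (u x) k.+1%:R^-1 ^+ 2 / 2 +
    (D1 Phi ustar (u ^~ k.+1%:R^-1) x + D2 Psi ustar (u ^~ k.+1%:R^-1) x) +
    a / 2 * (derive1 (u x) k.+1%:R^-1 * (u x k.+1%:R^-1 - ustar x)) +
    a ^+ 2 / 4 * (u x k.+1%:R^-1 - ustar x) ^+ 2.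
  have mf k : measurable_fun Om (f k).
    have [p1 _ p3 p4] := parts k; have [iD1 iD2 _ _ _] := breg k.
    apply: measurable_funD (mint _ p4); apply: measurable_funD (mint _ p3).
    by apply: measurable_funD (mint _ p1) _; apply: measurable_funD (mint _ iD1) (mint _ iD2).
  pose c := M * M / 2 + (n%:R * M ^+ 2 / (2 * theta) + mu / 2 * M ^+ 2) + a / 2 * (M * M) + a ^+ 2 / 4 * (M * M).
  have mfl := measurable_fun_cvg mf limJ.
  have bnd k x : Om x -> `|f k x| <= c.
    move=> Ox; have /andP[t0 _] := tk k.
    have [wM _ /(_ t0) pM] := hM x _ Ox (tk' k).
    have [h1 _ h3 _] := Phi_bounds (grad (u ^~ k.+1%:R^-1) x) (grad ustar x) S Ox.
    have [k1 _ k3 _] := Psi_bounds (u x k.+1%:R^-1) (ustar x) S Ox.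
    have th0 := theta_gt0 S.
    rewrite /f /c; apply: le_trans (ler_normD _ _) _; apply: lerD; last first.
      have a2 : 0 <= a ^+ 2 / 4 by rewrite divr_ge0// sqr_ge0.
      by rewrite normrM (ger0_norm a2) expr2 normrM ler_wpM2l// ler_pM.
    apply: le_trans (ler_normD _ _) _; apply: lerD; last first.
      have a2 : 0 <= a / 2 by rewrite divr_ge0// ltW.
      by rewrite normrM (ger0_norm a2) ler_wpM2l// normrM ler_pM.
    apply: le_trans (ler_normD _ _) _; apply: lerD.
      rewrite normrM (ger0_norm (_ : 0 <= 2^-1))// ler_wpM2r// expr2 normrM ler_pM//.
    apply: le_trans (ler_normD _ _) _; apply: lerD.
      rewrite /D1 ger0_norm; last by apply: le_trans h1; rewrite mulr_ge0 ?sqn_ge0 ?divr_ge0// ltW.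
      apply: le_trans h3 _; rewrite ler_wpM2r ?invr_ge0 ?mulr_ge0 ?(ltW th0)//.
      exact: (sqn_grad_le (Az k) Ox).
    rewrite /D2 ger0_norm//; apply: le_trans k3 _.
    by rewrite ler_wpM2l ?divr_ge0 ?(ltW mu0)//; exact: (sq_le (Az k) Ox).
  by have [] := Rdominated_cvg mO mf mfl (aeW _ limJ) (ic c) bnd.
pose f k x := (u x k.+1%:R^-1 - ustar x) ^+ 2 + sqn (grad (u ^~ k.+1%:R^-1) x - grad ustar x).
have mf k : measurable_fun Om (f k).
  by have [_ _ _ _ [i1 i2]] := breg k; apply: measurable_funD (mint _ i2) (mint _ i1).
have limf x : Om x -> f k x @[k --> \oo] --> (u0 x - ustar x) ^+ 2 + sqn (grad u0 x - grad ustar x).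
  move=> Ox; apply: cvgD; first by apply: lim_sq; exact: lim_w.
  by apply: cvg_sqn => i; exact: lim_g.
have mfl := measurable_fun_cvg mf limf.
have bnd k x : Om x -> `|f k x| <= M ^+ 2 + n%:R * M ^+ 2.
  move=> Ox; rewrite ger0_norm; last by rewrite addr_ge0 ?sqr_ge0 ?sqn_ge0.
  by apply: lerD; [exact: (sq_le (Az k) Ox)|exact: (sqn_grad_le (Az k) Ox)].
by have [] := Rdominated_cvg mO mf mfl (aeW _ limf) (ic _) bnd.
Qed.

(** * Decay of the H^1 norm *)

Lemma H1_normsq_diff z : Ck 2 Om z ->
  H1_normsq Om (fun x => z x - ustar x) =
  (\int[leb]_(x in Om) ((z x - ustar x) ^+ 2 + sqn (grad z x - grad ustar x))%:E)%E.
Proof.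
move=> cz; apply: eq_integral => x /set_mem Ox.
by rewrite (grad_B (CkS cz) (CkS cs) Ox).
Qed.

(** u(., 0) and u0 agree on Om only, which suffices for the gradients because Om is open. Finiteness
    from [initial_limits] makes [fine] lossless. *)
Lemma H1_normsq_initial : H1_normsq Om (fun x => u x 0 - ustar x) =
  (fine (H1_normsq Om (fun x => u0 x - ustar x)))%:E.
Proof.
have [_ i0] := initial_limits.
have E : H1_normsq Om (fun x => u0 x - ustar x) =
    (\int[leb]_(x in Om) ((u0 x - ustar x) ^+ 2 + sqn (grad u0 x - grad ustar x))%:E)%E.
  apply: eq_integral => x /set_mem Ox; congr (_ + sqn _)%:E.
  apply/rowP => i; rewrite !mxE; have [d0 _] := pd_initial i Ox.
  have ds := derivableP (Ck1_derivable (CkS cs) x (delta_mx ord0 i) Ox).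
  by have [_] := is_deriveB_fun d0 ds.
rewrite fineK; last by rewrite E; exact: (integrable_fin_num mO i0).
apply: eq_integral => x /set_mem Ox; have [-> _] := id0 Ox; congr (_ + sqn _)%:E.
apply/rowP => i; rewrite !mxE; apply: near_eq_derive.
have : \forall y \near x, Om y by exact: open_nbhs_nbhs.
by apply: filterS => y Oy; have [-> _] := id0 Oy.
Qed.

(** The factor 2 / theta comes from J >= (theta / 2) int |grad w|^2, and the Poincare inequality
    adds the L^2 part with factor 1 / lambda. *)
Lemma H1_decay (lambda A beta t : R) :
  0 < lambda -> poincare_ineq Om lambda -> 0 <= A ->
  pointwise_decay theta mu a lambda A beta -> 0 < t ->
  (H1_normsq Om (fun x => u x t - ustar x)%R <=
   ((1 + lambda^-1) * (2 / theta) * J_initial * expR (- beta * t))%:E)%E.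
Proof.
move=> l0 pO A0 rate t0; have [M M0 hM] := uniform_bounds t.
have tt : 0 < t <= t by rewrite t0 lexx.
have Az := admissible_slice hM tt; have cz := adm_C2 Az.
have [_ _ _ _ [ig iw]] := integrable_breg S cs mu0 Az.
rewrite H1_normsq_diff//.
have -> : (\int[leb]_(x in Om) ((u x t - ustar x) ^+ 2 + sqn (grad (u ^~ t) x - grad ustar x))%:E)%E =
    (\int[leb]_(x in Om) ((u x t - ustar x) ^+ 2) +
     \int[leb]_(x in Om) (sqn (grad (u ^~ t) x - grad ustar x)))%:E.
  have <- := @RintegralD _ _ _ leb Om _ _ mO iw ig.
  by rewrite /Rintegral fineK//; exact: (integrable_fin_num mO (integrableRD mO iw ig)).
rewrite lee_fin -[leRHS]mulrA.
have pc := poincare_static S cs mu0 pO Az.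
have [_ J1] := dissipation pO A0 rate t0.
(* Decay from s = 1 / (k + 1) to t, in the limit s -> 0. *)
have J2 : J_bregman t * expR (beta * t) <= J_initial.
  have [lJ _] := initial_limits.
  have lE : expR (beta * k.+1%:R^-1) @[k --> \oo] --> (1 : R).
    have lb : beta * k.+1%:R^-1 @[k --> \oo] --> beta * (0 : R).
      by apply: cvgM; [exact: cvg_cst|exact: cvg_harmonic].
    by have := cvg_comp _ _ lb (@continuous_expR R (beta * 0)); rewrite mulr0 expR0.
  have lp : J_bregman k.+1%:R^-1 * expR (beta * k.+1%:R^-1) @[k --> \oo] --> J_initial.
    by rewrite -[J_initial]mulr1; exact: cvgM.
  apply: (cvgr_to_ge lp); have := near_infty_natSinv_lt (PosNum t0) => /=.
  by apply: filterS => k kt; apply: (J_bregman_decay pO A0 rate) => //; exact: ltW.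
have E0 := expR_gt0 (beta * t).
have J3 : J_bregman t <= J_initial * expR (- beta * t).
  by rewrite mulNr expRN ler_pdivlMr.
move: J1 J3 pc; move: (J_initial * _) (J_bregman t) (\int[leb]_(x in Om) (sqn _))
  (\int[leb]_(x in Om) (_ ^+ 2)) => K J I1 I2 J1 J3 pc.
have th0 := theta_gt0 S.
have h1 : I2 <= lambda^-1 * I1 by rewrite ler_pdivlMl.
have h2 : I1 <= 2 / theta * K.
  rewrite -(ler_pM2l (_ : 0 < theta / 2)) ?divr_gt0// (le_trans (le_trans J1 J3))//.
  by rewrite mulrA (_ : theta / 2 * (2 / theta) = 1) ?mul1r//; field; rewrite gt_eqF.
have l1 : 0 <= 1 + lambda^-1 by rewrite addr_ge0// invr_ge0 ltW.
apply: (@le_trans _ _ ((1 + lambda^-1) * I1)); first by rewrite mulrDl mul1r addrC lerD2l.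
by rewrite -mulrA ler_wpM2l.
Qed.

End Dynamic.

(* The empty domain and the one-point space R^0 have no positive (largest)
   Poincare constant, so there is a point of Om and a nonzero direction. *)
Lemma poincare_constant_nontrivial (R : realType) n (Om : set 'rV[R]_n) (lambda : R) :
  open Om -> bounded_set Om -> 0 < lambda -> poincare_constant Om lambda ->
  (0 < n)%N /\ exists x, Om x.
Proof.
move=> oO bO l0 [pO pmax].
have [x Ox] : exists x, Om x.
  apply: contrapT => nO; have O0 : Om = set0 by apply/seteqP; split => // x Ox; apply: nO; exists x.
  have : lambda + 1 <= lambda.
    by apply: pmax => w G _; rewrite O0 !integral_set0 mule0.
  by rewrite gerDl ler10.
split; last by exists x.
case: n => [|//] in Om oO bO pO pmax x Ox *.
have eq0 (y : 'rV[R]_0) : y = x by apply/rowP => -[].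
have OT : Om = [set x] by apply/seteqP; split => y // _; rewrite (eq0 y).
have C1 : C1c Om (cst (1 : R)).
  split; first exact: Ck1_cst.
  exists Om; split => //; first by rewrite OT; exact: compact_set1.
  by move=> y; rewrite (eq0 y).
have := pO _ _ (C1c_H10 oO bO C1).
rewrite [leRHS]integral0_eq; last by move=> y _; rewrite /sqn /dotv big_ord0.
under eq_integral do rewrite expr1n.
rewrite integral_cst; last exact: open_measurable_rV.
rewrite mul1e /= diracE mem_set; last by rewrite (eq0 0).
by rewrite mule1 lee_fin leNgt l0.
Qed.

(** Testing both bounds on one unit vector gives theta <= 1 / theta. This makes theta^-1 - theta
    nonnegative in the rate. *)
Lemma hess_bounds_theta_le1 (R : realType) n (H : 'M[R]_n) (theta : R) :
  (0 < n)%N -> 0 < theta -> psd_le theta%:M H -> psd_le H (theta^-1)%:M -> theta <= 1.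
Proof.
case: n H => // n H _ th0 h1 h2; pose v : 'rV[R]_n.+1 := delta_mx ord0 ord0.
have v1 : sqn v = 1.
  rewrite /sqn /dotv (bigD1 ord0)//= big1 => [|i i0]; first by rewrite mxE !eqxx mulr1 addr0.
  by rewrite mxE (negPf i0) andbF mul0r.
have := le_trans ((psd_le_scalar H theta v).1 h1) ((psd_le_scalar H theta^-1 v).2 h2).
rewrite v1 !mulr1 -[leRHS]mul1r ler_pdivlMr// -expr2.
by rewrite expr_le1// ltW.
Qed.

Unset Implicit Arguments.

Theorem theorem4 (R : realType) (n : nat) (Om : set 'rV[R]_n)
    (Phi : 'rV[R]_n -> 'rV[R]_n -> R) (Psi : 'rV[R]_n -> R -> R)
    (g ustar : 'rV[R]_n -> R) (lambda a theta : R) (u0 u1 : 'rV[R]_n -> R) :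
  open Om -> bounded_set Om -> lipschitz_boundary Om ->
  Ck 2 (Om `*` setT) (fun q : 'rV[R]_n * 'rV[R]_n => Phi q.1 q.2) ->
  Ck 2 (Om `*` setT) (fun q : 'rV[R]_n * R => Psi q.1 q.2) ->
  (forall x, Om x -> convex_function setT (Phi x)) ->
  (forall x, Om x -> @convex_function R R^o setT (Psi x)) ->
  0 < theta ->
  (forall x p, Om x ->
     psd_le theta%:M (hess (Phi x) p) /\ psd_le (hess (Phi x) p) (theta^-1)%:M) ->
  steady_state Om Phi Psi g ustar ->
  0 < a ->
  0 < lambda -> poincare_constant Om lambda ->
  exists C : R, 0 < C /\
  forall (mu : R) (u : 'rV[R]_n -> R -> R),
    0 < mu -> (forall x z, Om x -> derive1n 2 (Psi x) z <= mu) ->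
    wave_regular Om Phi Psi u ->
    damped_wave Om Phi Psi a g u ->
    initial_data Om u0 u1 u ->
    let c := a + mu / a + 2 * lambda / a * (theta^-1 - theta) in
    let beta := (a * Num.sqrt (c ^+ 2 + 4 * lambda * theta) - a * c) /
                (2 * Num.sqrt (lambda * theta) + a) in
    forall t : R, 0 <= t ->
      (H1_normsq Om (fun x => u x t - ustar x)%R <=
       (C * expR (- beta * t))%:E)%E.
Proof.
move=> oO bO _ CPhi CPsi _ cPsi th0 psd st a0 l0 pc.
have [n0 [x0 Ox0]] := poincare_constant_nontrivial oO bO l0 pc; have [pO _] := pc.
have th1 : theta <= 1.
  by have [h1 h2] := psd x0 0 Ox0; exact: (hess_bounds_theta_le1 n0 th0 h1 h2).
(* C is fixed before mu and u, so it is built from [J_initial], which is written in terms of u0 and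
   u1 rather than u. *)
pose K := (1 + lambda^-1) * (2 / theta) * J_initial Om Phi Psi ustar a u0 u1.
pose N := fine (H1_normsq Om (fun x => u0 x - ustar x)).
have N0 : 0 <= N.
  by apply: fine_ge0; apply: integral_ge0 => x _; rewrite lee_fin addr_ge0 ?sqr_ge0 ?sqn_ge0.
(* The 1 makes C positive; the absolute value is there because the sign of [J_initial] is unknown
   before a solution with these data is given; N covers t = 0. *)
exists (1 + `|K| + N); split; first by rewrite ltr_pwDl ?ltr_pwDl ?ltr01 ?normr_ge0.
move=> mu u mu0 Pmu wr dw id0 c beta t.
have S : energy_data Om Phi Psi theta mu by split.
rewrite le_eqVlt => /orP[/eqP <-|t0].
  rewrite (H1_normsq_initial S st mu0 a0 wr dw id0) lee_fin mulr0 expR0 mulr1 -/N.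
  by rewrite lerDr addr_ge0.
have [A A0 rate] := decay_rate_ineq l0 th0 th1 a0 mu0.
apply: le_trans (H1_decay S st mu0 a0 wr dw id0 l0 pO A0 rate t0) _.
rewrite lee_fin ler_wpM2r ?expR_ge0// -/K.
by have := ler_norm K; lra.
Qed.
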